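(* Let $k\geqslant1$ and $n\geqslant1$. The reduced dimension $\psi^k_n$ of type $n$ invariants of the pure braid group $\mathcal P_k$ is given by $$\psi^k_n=\frac1n\sum_{m\mid n}\mu\left(n/m\right)\operatorname{sur}(m,k-1),$$ where $\mu$ is the Möbius function of number theory.
   Context: $\mathcal P_k$ is the pure braid group on $k$ strands. All invariants are $\mathbb Q$-valued. A map $v\colon\mathcal P_k\to\mathbb Q$ is of type $n$ if its linear extension to $\mathbb Q\mathcal P_k$ vanishes on all singular pure braids with more than $n$ double points, where a double point is identified with (positive crossing) $-$ (negative crossing) in the group algebra; equivalently, the linear extension vanishes on $J^{n+1}\mathcal P_k$, the $(n+1)$-st power of the augmentation ideal of $\mathbb Q\mathcal P_k$. Let $\mathcal V^n_k$ be the $\mathbb Q$-vector space of type $n$ invariants of $\mathcal P_k$ (with $\mathcal V^{-1}_k=0$). Pointwise multiplication makes $\bigoplus_{n\geqslant0}\mathcal V^n_k/\mathcal V^{n-1}_k$ a commutative graded algebra. With $I_k$ the ideal of positive-degree elements, the space of indecomposable type $n$ invariants modulo type $n-1$ invariants is the degree $n$ part $(I_k/I_k^2)_n$ of $I_k/I_k^2$. For each $l<k$ there are $\binom kl$ homomorphisms $\mathcal P_k\to\mathcal P_l$ obtained by picking $l$ of the $k$ strands and forgetting the rest. Pulling back along such a map takes type $n$ invariants of $\mathcal P_l$ to type $n$ invariants of $\mathcal P_k$, hence induces a linear map $(I_l/I_l^2)_n\to(I_k/I_k^2)_n$. The number $\psi^k_n$ is the dimension over $\mathbb Q$ of the quotient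 of $(I_k/I_k^2)_n$ by the span of the images of all these maps for all $l<k$, i.e. the dimension of the space of type $n$ indecomposable invariants of $\mathcal P_k$ modulo the type $n$ invariants induced from pure braid groups on fewer strands. For $m>0$, $\operatorname{sur}(m,j)$ is the number of surjections from an $m$-element set to a $j$-element set, with the convention $\operatorname{sur}(m,0)=0$. *)

(* Defs.v *)
From HB Require Import structures.
From mathcomp Require Import all_boot all_order all_algebra perm.
From mathcomp Require Import zify.
From mathcomp Require Import boolp functions.

Set Implicit Arguments.
Unset Strict Implicit.
Unset Printing Implicit Defensive.

Import GRing.Theory.

Local Open Scope quotient_scope.
Local Open Scope ring_scope.

Section LinearAlgebra.
Variable R : pzRingType.

(* A [submodClosed] predicate is only known to be stable by the operations of
   semimodules; {ideal_quot _} needs the [zmodClosed] structure as well. *)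
Definition as_zmod (V : lmodType R) (S : submodClosed V) : {pred V} := S.
HB.instance Definition _ (V : lmodType R) (S : submodClosed V) :=
  GRing.isZmodClosed.Build V (as_zmod S)
    (GRing.submod_closedB (submodClosedP S)).

Definition lquot (V : lmodType R) (S : submodClosed V) :=
  {ideal_quot as_zmod S}.

HB.instance Definition _ (V : lmodType R) (S : submodClosed V) :=
  GRing.Zmodule.on (lquot S).
HB.instance Definition _ (V : lmodType R) (S : submodClosed V) :=
  EqQuotient.on (lquot S).

Section Lquot.
Variables (V : lmodType R) (S : submodClosed V).

Lemma lquotP (x y : V) :
  reflect (\pi_(lquot S) x = \pi y) (x - y \in S).
Proof. by rewrite (Quotient.idealrBE (as_zmod S)); apply: eqP. Qed.

Lemma lquotD (x y : V) : \pi_(lquot S) (x + y) = \pi x + \pi y.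
Proof. exact: (Quotient.pi_add (as_zmod S)). Qed.

Definition lquot_scale (a : R) (x : lquot S) : lquot S :=
  \pi_(lquot S) (a *: repr x).

Lemma lquotZ (a : R) (x : V) : lquot_scale a (\pi x) = \pi_(lquot S) (a *: x).
Proof.
apply/lquotP; rewrite -scalerBr rpredZ //.
by apply/lquotP; rewrite reprK.
Qed.

Fact lquot_scaleA a b x :
  lquot_scale a (lquot_scale b x) = lquot_scale (a * b) x.
Proof.
rewrite -[x]reprK [lquot_scale b _](lquotZ b) [LHS](lquotZ a).
by rewrite [RHS](lquotZ (a * b)) scalerA.
Qed.
Fact lquot_scale1 : left_id 1 lquot_scale.
Proof. by move=> x; rewrite -[x]reprK [LHS](lquotZ 1) scale1r. Qed.
Fact lquot_scaleDr : right_distributive lquot_scale +%R.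
Proof.
move=> a x y; rewrite -[x]reprK -[y]reprK -lquotD [LHS](lquotZ a).
by rewrite scalerDr lquotD !lquotZ.
Qed.
Fact lquot_scaleDl x : {morph lquot_scale^~ x : a b / a + b}.
Proof.
move=> a b /=; rewrite -[x]reprK [LHS](lquotZ (a + b)).
by rewrite scalerDl lquotD !lquotZ.
Qed.

HB.instance Definition _ := GRing.Zmodule_isLmodule.Build R (lquot S)
  lquot_scaleA lquot_scale1 lquot_scaleDr lquot_scaleDl.

Lemma pi_lquot_linear : linear (\pi_(lquot S) : V -> lquot S).
Proof. by move=> a x y; rewrite lquotD -lquotZ. Qed.

End Lquot.

Definition spanned (V : lmodType R) (A : V -> Prop) : {pred V} :=
  fun v => `[< exists2 s : seq (R * V),
    (forall p, p \in s -> A p.2) & v = \sum_(p <- s) p.1 *: p.2 >].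

Fact spanned_submod (V : lmodType R) (A : V -> Prop) :
  submod_closed (spanned A).
Proof.
split=> [|a x y]; first by apply/asboolP; exists [::]; rewrite ?big_nil.
move=> /asboolP [s As ->] /asboolP [t At ->]; apply/asboolP.
exists ([seq (a * p.1, p.2) | p <- s] ++ t) => [p|].
  by rewrite mem_cat => /orP [/mapP [q /As Aq ->] //|/At].
rewrite big_cat big_map scaler_sumr; congr (_ + _).
by apply: eq_bigr => p _; rewrite scalerA.
Qed.

HB.instance Definition _ (V : lmodType R) (A : V -> Prop) :=
  GRing.isSubmodClosed.Build R V (spanned A) (spanned_submod A).

Lemma spanned_sub (V : lmodType R) (A : V -> Prop) (S : submodClosed V) v :
  (forall x, A x -> x \in S) -> v \in spanned A -> v \in S.
Proof.
move=> AS /asboolP [s As ->]; rewrite big_seq; apply: rpred_sum => p /As Ap.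
by apply: rpredZ; apply: AS.
Qed.

Lemma mem_spanned (V : lmodType R) (A : V -> Prop) v : A v -> v \in spanned A.
Proof.
move=> Av; apply/asboolP; exists [:: (1, v)]; last first.
  by rewrite big_seq1 scale1r.
by move=> p; rewrite inE => /eqP ->.
Qed.

End LinearAlgebra.

Definition has_dim (F : fieldType) (V : lmodType F) (d : nat) : Prop :=
  inhabited (Vector.axiom d V).

(* A diagram on k strands is a sequence of crossings, read from top to bottom.
   A crossing (i, o) involves the strands in positions i and i.+1 (positions
   are numbered from 0), and o tells what kind of crossing it is. *)
Definition diagram (O : Type) (k : nat) := seq ('I_k.-1 * O).

(* true is the positive crossing, i.e. the Artin generator sigma_i, and false
   is its inverse. *)
Definition word := diagram bool.

(* In a singular braid, [None] is a double point. *)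
Definition sword := diagram (option bool).

Definition lpos k (i : 'I_k.-1) : 'I_k := widen_ord (leq_pred k) i.

Fact rpos_subproof k (i : 'I_k.-1) : (i.+1 < k)%N.
Proof. by rewrite -ltn_predRL. Qed.
Definition rpos k (i : 'I_k.-1) : 'I_k := Ordinal (rpos_subproof i).

Definition crossing_perm k (i : 'I_k.-1) : 'S_k := tperm (lpos i) (rpos i).

(* The strand that starts in position j ends in position [dperm d j]. *)
Fixpoint dperm O k (d : diagram O k) : 'S_k :=
  if d is (i, _) :: d' then (crossing_perm i * dperm d')%g else 1%g.

Lemma dperm_cat O k (u v : diagram O k) :
  dperm (u ++ v) = (dperm u * dperm v)%g.
Proof. by elim: u => [|[i o] u IH] /=; rewrite ?mul1g // IH mulgA. Qed.

Definition rank k (S : {set 'I_k}) (m : nat) : nat :=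
  #|[set x in S | (x < m)%N]|.

(* [S] is the set of the positions, at the top of [d], of the strands that are
   kept, and [l] is meant to be #|S|. A crossing survives if both of its strands
   are kept, and [rank] counts the kept strands on its left: [insub] only fails
   if l differs from #|S|. *)
Fixpoint keep O k l (S : {set 'I_k}) (d : diagram O k) : diagram O l :=
  if d is (i, o) :: d' then
    let d1 := keep l (crossing_perm i @: S) d' in
    let c : option 'I_l.-1 :=
      if (lpos i \in S) && (rpos i \in S) then insub (rank S i) else None in
    if c is Some r then (r, o) :: d1 else d1
  else [::].

Inductive braid_rel k : word k -> word k -> Prop :=
| BraidCancel i b : braid_rel [:: (i, b); (i, ~~ b)] [::]
| BraidFar (i j : 'I_k.-1) : (i.+1 < j)%N ->
    braid_rel [:: (i, true); (j, true)] [:: (j, true); (i, true)]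
| BraidYB (i j : 'I_k.-1) : j = i.+1 :> nat ->
    braid_rel [:: (i, true); (j, true); (i, true)]
              [:: (j, true); (i, true); (j, true)].

Inductive braid_eq k : word k -> word k -> Prop :=
| BraidStep u v x y : braid_rel x y -> braid_eq (u ++ x ++ v) (u ++ y ++ v)
| BraidRefl u : braid_eq u u
| BraidSym u v : braid_eq u v -> braid_eq v u
| BraidTrans u v w : braid_eq u v -> braid_eq v w -> braid_eq u w.

Lemma braid_eq_cat k (u u' v v' : word k) :
  braid_eq u u' -> braid_eq v v' -> braid_eq (u ++ v) (u' ++ v').
Proof.
move=> Hu Hv; apply: (@BraidTrans _ _ (u' ++ v)).
  elim: Hu => {u u'} [u w x y Hxy|u|u w _ IH|u w t _ IH1 _ IH2].
  - by rewrite -!catA; apply: BraidStep.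
  - exact: BraidRefl.
  - exact: BraidSym.
  - exact: BraidTrans IH1 IH2.
elim: Hv => {v v'} [v w x y Hxy|v|v w _ IH|v w t _ IH1 _ IH2].
- by rewrite ![u' ++ v ++ _]catA; apply: BraidStep.
- exact: BraidRefl.
- exact: BraidSym.
- exact: BraidTrans IH1 IH2.
Qed.

Definition word_inv k (u : word k) : word k := rev [seq (p.1, ~~ p.2) | p <- u].

Lemma word_invK k : involutive (@word_inv k).
Proof.
move=> u; rewrite /word_inv map_rev revK -map_comp map_id_in //.
by case=> i b _ /=; rewrite negbK.
Qed.

Lemma word_mulV k (u : word k) : braid_eq (u ++ word_inv u) [::].
Proof.
elim/last_ind: u => [|u [i b] IH]; first exact: BraidRefl.
rewrite /word_inv map_rcons rev_rcons -cats1 -catA /=.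
apply: BraidTrans IH; rewrite -[X in braid_eq _ X](cat0s).
exact: (@BraidStep _ u (word_inv u) _ _ (BraidCancel i b)).
Qed.

Lemma word_mulV' k (u : word k) : braid_eq (word_inv u ++ u) [::].
Proof. by rewrite -{2}(word_invK u); apply: word_mulV. Qed.

Lemma word_inv_eq k (u v : word k) :
  braid_eq u v -> braid_eq (word_inv u) (word_inv v).
Proof.
move=> Huv; apply: (@BraidTrans _ _ (word_inv u ++ (v ++ word_inv v))).
  rewrite -{1}[word_inv u]cats0; apply: braid_eq_cat; first exact: BraidRefl.
  exact/BraidSym/word_mulV.
rewrite catA -[X in braid_eq _ X](cat0s (word_inv v)).
apply: braid_eq_cat; last exact: BraidRefl.
apply: BraidTrans (word_mulV' u); apply: braid_eq_cat; first exact: BraidRefl.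
exact: BraidSym.
Qed.

Definition braid_eqb k : rel (word k) := fun u v => `[< braid_eq u v >].

Fact braid_eqb_equiv k : equiv_class_of (@braid_eqb k).
Proof.
split=> [u|u v|v u w]; first by apply/asboolP; apply: BraidRefl.
  by apply/asboolP/asboolP; apply: BraidSym.
by move=> /asboolP Huv /asboolP Hvw; apply/asboolP; apply: BraidTrans Hvw.
Qed.

Canonical braid_equiv k := EquivRelPack (@braid_eqb_equiv k).

Definition braid k := {eq_quot @braid_eqb k}.
HB.instance Definition _ k := EqQuotient.on (braid k).
HB.instance Definition _ k := Choice.on (braid k).

Lemma braidP k (u v : word k) :
  reflect (\pi_(braid k) u = \pi v) `[< braid_eq u v >].
Proof. by apply: (iffP idP) => [H|/eqmodP //]; apply/eqmodP. Qed.

Lemma braid_reprK k (u : word k) : braid_eq (repr (\pi_(braid k) u)) u.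
Proof. by apply/asboolP/braidP; rewrite reprK. Qed.

Definition braid_mul k (x y : braid k) : braid k :=
  \pi_(braid k) (repr x ++ repr y).
Definition braid_inv k (x : braid k) : braid k :=
  \pi_(braid k) (word_inv (repr x)).
Definition braid_one k : braid k := \pi_(braid k) [::].

Lemma pi_braidM k (u v : word k) :
  braid_mul (\pi u) (\pi v) = \pi_(braid k) (u ++ v).
Proof. by apply/braidP/asboolP; apply: braid_eq_cat; apply: braid_reprK. Qed.

Lemma pi_braidV k (u : word k) : braid_inv (\pi u) = \pi_(braid k) (word_inv u).
Proof. by apply/braidP/asboolP; apply: word_inv_eq; apply: braid_reprK. Qed.

Fact braid_mulA k : associative (@braid_mul k).
Proof.
by move=> x y z; elim/quotW: x; elim/quotW: y; elim/quotW: z => x y z;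
  rewrite [braid_mul (\pi y) _]pi_braidM [braid_mul (\pi z) (\pi y)]pi_braidM
          [LHS]pi_braidM [RHS]pi_braidM catA.
Qed.
Fact braid_mul1 k : left_id (@braid_one k) (@braid_mul k).
Proof. by elim/quotW => x; rewrite [LHS]pi_braidM. Qed.
Fact braid_1mul k : right_id (@braid_one k) (@braid_mul k).
Proof. by elim/quotW => x; rewrite [LHS]pi_braidM cats0. Qed.
Fact braid_mulV k : left_inverse (@braid_one k) (@braid_inv k) (@braid_mul k).
Proof.
elim/quotW => x; rewrite [braid_inv _]pi_braidV [LHS]pi_braidM.
by apply/braidP/asboolP; apply: word_mulV'.
Qed.
Fact braid_Vmul k : right_inverse (@braid_one k) (@braid_inv k) (@braid_mul k).
Proof.
elim/quotW => x; rewrite [braid_inv _]pi_braidV [LHS]pi_braidM.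
by apply/braidP/asboolP; apply: word_mulV.
Qed.

HB.instance Definition _ k := isGroup.Build (braid k)
  (@braid_mulA k) (@braid_mul1 k) (@braid_1mul k) (@braid_mulV k)
  (@braid_Vmul k).

Lemma crossing_perm_val k (i : 'I_k.-1) (x : 'I_k) :
  crossing_perm i x =
    (if x == i :> nat then i.+1 else if x == i.+1 :> nat then i : nat else x)
    :> nat.
Proof.
rewrite /crossing_perm; case: tpermP => [->|->|].
- by rewrite /= eqxx.
- by rewrite /= gtn_eqF // eqxx.
- by move=> /eqP; rewrite -val_eqE /= => /negPf -> /eqP;
    rewrite -val_eqE /= => /negPf ->.
Qed.

Lemma braid_eq_dperm k (u v : word k) : braid_eq u v -> dperm u = dperm v.
Proof.
elim=> {u v} [u v x y Hxy|//|u v _ -> //|u v w _ -> _ -> //].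
rewrite !dperm_cat; congr (_ * (_ * _))%g.
case: Hxy => [i b|i j ij|i j ij] /=; rewrite ?mulg1; first exact: tperm2.
- apply/permP => z; apply/val_inj; rewrite /= !permM !crossing_perm_val.
  by do ![case: eqP => /=]; lia.
- apply/permP => z; apply/val_inj; rewrite /= !permM !crossing_perm_val.
  by do ![case: eqP => /=]; lia.
Qed.

Definition braid_perm k (x : braid k) : 'S_k := dperm (repr x).

Lemma braid_perm_pi k (u : word k) : braid_perm (\pi u) = dperm u.
Proof. exact/braid_eq_dperm/braid_reprK. Qed.

Lemma braid_permM k : {morph @braid_perm k : x y / (x * y)%g}.
Proof.
by elim/quotW => x; elim/quotW => y; rewrite [(_ * _)%g]pi_braidM
  !braid_perm_pi dperm_cat.
Qed.

Lemma braid_perm1 k : braid_perm (1%g : braid k) = 1%g.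
Proof. exact: braid_perm_pi. Qed.

Definition is_pure k : pred (braid k) := fun x => braid_perm x == 1%g.

Fact is_pure_group k : group_closed (@is_pure k).
Proof.
split=> [|x y]; rewrite !unfold_in ?braid_perm1 //.
move=> /eqP Hx /eqP Hy; rewrite braid_permM Hx mul1g.
by have := braid_permM y y^-1%g; rewrite mulgV braid_perm1 Hy mul1g => <-.
Qed.

Definition pure k := {x : braid k | is_pure x}.
HB.instance Definition _ k := SubChoice.on (pure k).
HB.instance Definition _ k :=
  SubChoice_isSubGroup.Build (braid k) (@is_pure k) (pure k) (@is_pure_group k).

(* The class of a word in the pure braid group; the default value 1 is only
   used for words that do not represent a pure braid. *)
Definition pure_class k (u : word k) : pure k := insubd 1%g (\pi_(braid k) u).

Lemma val_pure_class k (u : word k) :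
  dperm u = 1%g -> val (pure_class u) = \pi_(braid k) u.
Proof. by move=> Hu; rewrite insubdK // unfold_in braid_perm_pi Hu. Qed.

Lemma pure_class_eq k (u v : word k) :
  braid_eq u v -> pure_class u = pure_class v.
Proof. by move=> Huv; congr insubd; apply/braidP/asboolP. Qed.

Lemma pure_class_repr k (x : pure k) : pure_class (repr (val x)) = x.
Proof. by rewrite /pure_class reprK valKd. Qed.

Section Rank.
Variable k : nat.
Implicit Types (S : {set 'I_k}) (x : 'I_k) (i : 'I_k.-1).

Lemma rankS S x : rank S x.+1 = (rank S x + (x \in S))%N.
Proof.
rewrite /rank (cardsD1 x) inE ltnSn andbT addnC; congr (_ + _)%N.
by apply: eq_card => y; rewrite !inE -val_eqE /= ltnS; case: ltngtP;
  rewrite ?andbF ?andbT.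
Qed.

Lemma rank_lt_in S m n : (m <= n)%N -> (rank S m <= rank S n)%N.
Proof.
move=> mn; apply/subset_leq_card/subsetP => y; rewrite !inE => /andP [-> ym].
exact: leq_trans ym mn.
Qed.

Lemma rank_le S m : (rank S m <= #|S|)%N.
Proof. by apply/subset_leq_card/subsetP => y; rewrite inE => /andP []. Qed.

Lemma rank0 S : rank S 0 = 0%N.
Proof. by apply/eqP; rewrite cards_eq0; apply/eqP/setP => y; rewrite !inE andbF. Qed.

Lemma rank_full S : rank S k = #|S|.
Proof. by apply: eq_card => y; rewrite inE ltn_ord andbT. Qed.

Lemma crossing_permK i : involutive (crossing_perm i).
Proof. exact: tpermK. Qed.

Lemma mem_crossing S i x :
  (x \in crossing_perm i @: S) = (crossing_perm i x \in S).
Proof.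
apply/imsetP/idP => [[y yS ->]|xS]; first by rewrite crossing_permK.
by exists (crossing_perm i x); rewrite ?crossing_permK.
Qed.

Lemma rank_crossing S i m :
  m != i.+1 -> rank (crossing_perm i @: S) m = rank S m.
Proof.
move=> mi; rewrite /rank -[RHS](card_imset _ (@perm_inj _ (crossing_perm i))).
apply: eq_card => x; rewrite inE !mem_crossing inE; congr (_ && _).
by rewrite crossing_perm_val; do ![case: eqP => /=]; lia.
Qed.

Lemma rank_crossing1 S i :
  rank (crossing_perm i @: S) i.+1 = (rank S i + (rpos i \in S))%N.
Proof.
rewrite (rankS _ (lpos i)) rank_crossing; last by rewrite /=; lia.
by rewrite mem_crossing tpermL.
Qed.

Lemma rank_onto S (a m : nat) :
  (m <= k)%N -> (a < rank S m)%N -> exists2 x : 'I_k, x \in S & rank S x = a.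
Proof.
elim: m => [|m IH] mk; first by rewrite rank0.
have [/(IH (ltnW mk)) //|] := ltnP a (rank S m).
rewrite (rankS S (Ordinal mk)) /= => ma.
case xS: (_ \in S) => H; last by lia.
by exists (Ordinal mk) => //=; lia.
Qed.

End Rank.

Section Keep.
Variables (O : Type) (k l : nat).
Implicit Types (S : {set 'I_k}) (d : diagram O k).

Definition keep1 S i (o : O) : diagram O l :=
  if (lpos i \in S) && (rpos i \in S) then
    if insub (rank S i) is Some r then [:: (r, o)] else [::]
  else [::].

Lemma keep_cons S i o d :
  keep l S ((i, o) :: d) = keep1 S i o ++ keep l (crossing_perm i @: S) d.
Proof. by rewrite /keep1 /=; case: ifP => // _; case: insub. Qed.

Lemma keep_cat S (u v : diagram O k) :
  keep l S (u ++ v) = keep l S u ++ keep l (dperm u @: S) v.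
Proof.
elim: u S => [|[i o] u IH] S.
  by rewrite /= (eq_imset _ (@perm1 _)) imset_id.
rewrite cat_cons !keep_cons IH catA; congr (_ ++ keep l _ _).
by rewrite -imset_comp; apply: eq_imset => x /=; rewrite permM.
Qed.

Lemma keep_dperm S d (x : 'I_k) (a : 'I_l) : #|S| = l -> x \in S ->
  a = rank S x :> nat ->
  dperm (keep l S d) a = rank (dperm d @: S) (dperm d x) :> nat.
Proof.
elim: d S x a => [|[i o] d IH] S x a Sl xS ax.
  by rewrite /= !perm1 (eq_imset _ (@perm1 _)) imset_id.
rewrite keep_cons dperm_cat permM [dperm (_ :: _)]/= permM.
have -> : (crossing_perm i * dperm d)%g @: S =
    dperm d @: (crossing_perm i @: S).
  by rewrite -imset_comp; apply: eq_imset => y /=; rewrite permM.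
set t := crossing_perm i; have tl : #|t @: S| = l.
  by rewrite card_imset //; exact: perm_inj.
have tx : t x \in t @: S by apply: imset_f.
apply: (IH _ _ _ tl tx); rewrite /keep1.
have rl := rankS S (lpos i); have rr := rankS S (rpos i).
have rx := rankS S x; rewrite xS in rx.
have rk1 := rank_crossing1 S i; rewrite -/t in rk1.
have tv := crossing_perm_val i x; rewrite -/t in tv.
rewrite /= in rl rr.
have [[e]|xi] := (eqVneq (x : nat) i : _).
- have {e} e : x = lpos i by apply: val_inj.
  move: tv; rewrite e /= eqxx => ->; rewrite rk1 -/t.
  rewrite -e xS /=; case: ifP => rS; last by rewrite perm1 ax e /=; lia.
  have rll := rank_le S i.+2; rewrite Sl in rll.
  case: insubP => [r _ rE|]; last by rewrite -e xS rS in rl rr; lia.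
  rewrite /= mulg1 crossing_perm_val.
  by rewrite ax rE e /= eqxx; lia.
have [[e]|xi1] := (eqVneq (x : nat) i.+1 : _).
- have {e} e : x = rpos i by apply: val_inj.
  move: tv; rewrite e /= eqxx gtn_eqF // => ->.
  rewrite rank_crossing; last by lia.
  rewrite -e xS andbT; case: ifP => lS; last by rewrite perm1 ax e /=; lia.
  have rll := rank_le S i.+2; rewrite Sl in rll.
  case: insubP => [r _ rE|]; last by rewrite -e xS lS in rl rr; lia.
  rewrite /= mulg1 crossing_perm_val ax rE e /= rl lS.
  by rewrite addn1 gtn_eqF // eqxx.
move: tv; rewrite (negPf xi) (negPf xi1) => ->.
rewrite rank_crossing //; case: ifP => [/andP [lS rS]|_]; last by rewrite perm1.
case: insubP => [r _ rE|_]; last by rewrite perm1.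
rewrite /= mulg1 crossing_perm_val ax rE.
rewrite lS in rl; rewrite rS in rr.
have := @rank_lt_in _ S x.+1 i; have := @rank_lt_in _ S i.+2 x.
move: xi xi1; do ![case: eqP => /=]; lia.
Qed.

Lemma keep_pure S d : #|S| = l -> dperm d = 1%g -> dperm (keep l S d) = 1%g.
Proof.
move=> Sl d1; apply/permP => a; apply: val_inj; rewrite perm1.
have [||x xS xa] := @rank_onto _ S a k; rewrite ?rank_full ?Sl //=.
rewrite (keep_dperm d Sl xS (esym xa)) d1 perm1.
by rewrite (eq_imset _ (@perm1 _)) imset_id.
Qed.

End Keep.

Lemma rank_crossing_far k (S : {set 'I_k}) (i j : 'I_k.-1) :
  (i.+1 < j)%N || (j.+1 < i)%N ->
  [/\ (lpos j \in crossing_perm i @: S) = (lpos j \in S),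
      (rpos j \in crossing_perm i @: S) = (rpos j \in S)
    & rank (crossing_perm i @: S) j = rank S j].
Proof.
move=> ij; rewrite !mem_crossing rank_crossing; last by lia.
by rewrite /crossing_perm !tpermD // -val_eqE /=; lia.
Qed.

Lemma keep_rel k l (S : {set 'I_k}) (u v : word k) : #|S| = l ->
  braid_rel u v -> braid_eq (keep l S u) (keep l S v).
Proof.
move=> Sl [i b|i j ij|i j ij].
- rewrite !keep_cons /= cats0 /keep1 !mem_crossing !tpermL !tpermR.
  rewrite rank_crossing; last by lia.
  rewrite andbC; case: ifP => _; last exact: BraidRefl.
  case: insub => [r|]; last exact: BraidRefl.
  exact: (@BraidStep _ [::] [::] _ _ (BraidCancel r b)).
- rewrite !keep_cons /= !cats0 /keep1.
  have [-> -> ->] := @rank_crossing_far k S i j (introT orP (or_introl ij)).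
  have [-> -> ->] := @rank_crossing_far k S j i (introT orP (or_intror ij)).
  case: ifP => [/andP [il ir]|_]; last by rewrite cats0; apply: BraidRefl.
  case: ifP => [/andP [jl jr]|_]; last by rewrite cats0; apply: BraidRefl.
  case: insubP => [r _ rE|_]; last by rewrite cats0; apply: BraidRefl.
  case: insubP => [q _ qE|_]; last by apply: BraidRefl.
  apply: (@BraidStep _ [::] [::] _ _ (BraidFar _)); rewrite rE qE.
  have := rank_lt_in S ij; have := rankS S (rpos i); have := rankS S (lpos i).
  by rewrite il ir /=; lia.
rewrite !keep_cons /= !cats0 /keep1.
have lj : lpos j = rpos i by apply: val_inj.
have iA : crossing_perm i (lpos i) = rpos i by rewrite /crossing_perm tpermL.
have iB : crossing_perm i (rpos i) = lpos i by rewrite /crossing_perm tpermR.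
have iC : crossing_perm i (rpos j) = rpos j.
  by rewrite /crossing_perm tpermD // -val_eqE /=; lia.
have jA : crossing_perm j (lpos i) = lpos i.
  by rewrite /crossing_perm tpermD // -val_eqE /=; lia.
have jB : crossing_perm j (rpos i) = rpos j.
  by rewrite /crossing_perm -lj tpermL.
have jC : crossing_perm j (rpos j) = rpos i.
  by rewrite /crossing_perm -lj tpermR.
have ni : (i : nat) != i.+1 by lia.
have nj : (j : nat) != j.+1 by lia.
have nij : (i : nat) != j.+1 by lia.
have E1 : rank (crossing_perm i @: S) j = (rank S i + (rpos i \in S))%N.
  by rewrite [nat_of_ord j]ij rank_crossing1.
have E2 : rank (crossing_perm j @: (crossing_perm i @: S)) i = rank S i.
  by rewrite !rank_crossing.
have E3 : rank S j = (rank S i + (lpos i \in S))%N.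
  by rewrite [nat_of_ord j]ij (rankS S (lpos i)).
have E4 : rank (crossing_perm j @: S) i = rank S i by rewrite rank_crossing.
have E5 : rank (crossing_perm i @: (crossing_perm j @: S)) j =
    (rank S i + (rpos j \in S))%N.
  by rewrite [nat_of_ord j]ij rank_crossing1 E4 mem_crossing jB.
rewrite E1 E2 E3 E4 E5 {E1 E2 E4 E5} !mem_crossing lj ?(iA, iB, iC, jA, jB, jC).
have := rank_le S j.+2; have := rankS S (rpos j); have := rankS S (lpos j).
rewrite lj /= -ij E3 Sl {E3}.
case: (lpos i \in S); case: (rpos i \in S); case: (rpos j \in S) => //= r1 r2 r3;
  rewrite ?addn0 ?addn1 ?cats0; try exact: BraidRefl.
case: insubP => [r _ rE|]; last by lia.
case: insubP => [q _ qE|]; last by lia.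
by apply: (@BraidStep _ [::] [::] _ _ (BraidYB _)); rewrite rE qE.
Qed.

Lemma keep_eq k l (S : {set 'I_k}) (u v : word k) : #|S| = l ->
  braid_eq u v -> braid_eq (keep l S u) (keep l S v).
Proof.
move=> Sl Huv.
elim: Huv S Sl => {u v} [u v x y Hxy|u|u v _ IH|u v w _ IH1 _ IH2] S Sl.
- rewrite !keep_cat; apply: braid_eq_cat; first exact: BraidRefl.
  have -> : dperm y = dperm x.
    by apply: braid_eq_dperm; have := BraidStep [::] [::] Hxy;
      rewrite !cats0 => /BraidSym.
  apply: braid_eq_cat; last exact: BraidRefl.
  by apply: keep_rel Hxy; rewrite card_imset //; exact: perm_inj.
- exact: BraidRefl.
- exact/BraidSym/IH.
- exact: BraidTrans (IH1 _ Sl) (IH2 _ Sl).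
Qed.

Definition forget k (S : {set 'I_k}) (x : pure k) : pure #|S| :=
  pure_class (keep #|S| S (repr (val x))).

Lemma dperm_pure k (x : pure k) : dperm (repr (val x)) = 1%g.
Proof. exact/eqP/(valP x). Qed.

Lemma forget_pure_class k (S : {set 'I_k}) (u : word k) : dperm u = 1%g ->
  forget S (pure_class u) = pure_class (keep #|S| S u).
Proof.
move=> u1; apply/pure_class_eq/keep_eq => //.
by rewrite val_pure_class //; apply: braid_reprK.
Qed.

Fact forgetM k (S : {set 'I_k}) : {morph @forget k S : x y / (x * y)%g}.
Proof.
move=> x y.
have pM l (u v : word l) : dperm u = 1%g -> dperm v = 1%g ->
    pure_class (u ++ v) = (pure_class u * pure_class v)%g.
  move=> u1 v1; apply: val_inj; rewrite valM !val_pure_class //.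
    by rewrite [RHS]pi_braidM.
  by rewrite dperm_cat u1 v1 mulg1.
rewrite -{1}[x]pure_class_repr -{1}[y]pure_class_repr.
rewrite -pM ?dperm_pure // forget_pure_class; last first.
  by rewrite dperm_cat !dperm_pure mulg1.
rewrite keep_cat dperm_pure (eq_imset _ (@perm1 _)) imset_id.
by rewrite pM //; apply: keep_pure => //; apply: dperm_pure.
Qed.

HB.instance Definition _ k (S : {set 'I_k}) :=
  isMultiplicative.Build (pure k) (pure #|S|) (@forget k S) (@forgetM k S).

Definition invariant k := pure k -> rat^o.
HB.instance Definition _ k := GRing.Lmodule.on (invariant k).
HB.instance Definition _ k := GRing.ComPzRing.on (invariant k).

(* The image of a singular braid in the group algebra, as a list of words with
   coefficients; a double point is (positive crossing) - (negative crossing). *)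
Fixpoint resolve k (s : sword k) : seq (rat * word k) :=
  match s with
  | [::] => [:: (1, [::])]
  | (i, Some b) :: s' => [seq (t.1, (i, b) :: t.2) | t <- resolve s']
  | (i, None) :: s' =>
      [seq (t.1, (i, true) :: t.2) | t <- resolve s'] ++
      [seq (- t.1, (i, false) :: t.2) | t <- resolve s']
  end.

Definition lin_ext k (f : word k -> rat) (s : sword k) : rat :=
  \sum_(t <- resolve s) t.1 * f t.2.

Definition double_points k (s : sword k) : nat :=
  count (fun c => c.2 == None) s.

(* All the words in [resolve s] have the same permutation as s, so that the
   default value of [pure_class] is not used here. *)
Definition finite_type k n : {pred invariant k} := fun v =>
  `[< forall s : sword k, dperm s = 1%g -> (n < double_points s)%N ->
      lin_ext (fun w => v (pure_class w)) s = 0 >].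

Section LinExt.
Variable k : nat.
Implicit Types (f g : word k -> rat) (s : sword k).

Lemma lin_ext_nil f : lin_ext f [::] = f [::].
Proof. by rewrite /lin_ext big_seq1 mul1r. Qed.

Lemma lin_ext_some f i b s :
  lin_ext f ((i, Some b) :: s) = lin_ext (fun w => f ((i, b) :: w)) s.
Proof. by rewrite /lin_ext big_map. Qed.

Lemma lin_ext_none f i s :
  lin_ext f ((i, None) :: s) = lin_ext (fun w => f ((i, true) :: w)) s
                             - lin_ext (fun w => f ((i, false) :: w)) s.
Proof.
rewrite /lin_ext big_cat !big_map -sumrN; congr (_ + _).
by apply: eq_bigr => t _; rewrite mulNr.
Qed.

Lemma lin_ext_lin f g a s :
  lin_ext (fun w => a * f w + g w) s = a * lin_ext f s + lin_ext g s.
Proof.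
rewrite /lin_ext mulr_sumr -big_split; apply: eq_bigr => t _.
by rewrite mulrDr mulrCA.
Qed.

Lemma lin_ext_sub f g s :
  lin_ext (fun w => f w - g w) s = lin_ext f s - lin_ext g s.
Proof.
by rewrite /lin_ext -sumrB; apply: eq_bigr => t _; rewrite mulrBr.
Qed.

Lemma resolve_dperm s t : t \in resolve s -> dperm t.2 = dperm s.
Proof.
elim: s t => [|[i [b|]] s IH] t /=; first by rewrite inE => /eqP ->.
  by move=> /mapP [u us ->] /=; rewrite IH.
by rewrite mem_cat => /orP [] /mapP [u us ->] /=; rewrite IH.
Qed.

Lemma eq_lin_ext f g s : dperm s = 1%g ->
  (forall w, dperm w = 1%g -> f w = g w) -> lin_ext f s = lin_ext g s.
Proof.
move=> s1 fg; rewrite /lin_ext !big_seq; apply: eq_bigr => t /resolve_dperm ts.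
by rewrite fg // ts.
Qed.

(* f(+)g(+) - f(-)g(-) = (f(+) - f(-)) g(+) + f(-) (g(+) - g(-)). *)
Fixpoint coresolve s : seq (sword k * sword k) :=
  match s with
  | [::] => [:: ([::], [::])]
  | (i, Some b) :: s' =>
      [seq ((i, Some b) :: t.1, (i, Some b) :: t.2) | t <- coresolve s']
  | (i, None) :: s' =>
      [seq ((i, None) :: t.1, (i, Some true) :: t.2) | t <- coresolve s'] ++
      [seq ((i, Some false) :: t.1, (i, None) :: t.2) | t <- coresolve s']
  end.

Lemma coresolveP s t : t \in coresolve s ->
  [/\ dperm t.1 = dperm s, dperm t.2 = dperm s &
      (double_points t.1 + double_points t.2 = double_points s)%N].
Proof.
elim: s t => [|[i [b|]] s IH] t /=; first by rewrite inE => /eqP ->.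
  by move=> /mapP [u /IH [H1 H2 H3] ->]; rewrite /= H1 H2.
by rewrite mem_cat => /orP [] /mapP [u /IH [H1 H2 H3] ->];
  rewrite /= H1 H2; split=> //; rewrite /double_points /= in H3 *; lia.
Qed.

Lemma lin_extM f g s : lin_ext (fun w => f w * g w) s =
  \sum_(t <- coresolve s) lin_ext f t.1 * lin_ext g t.2.
Proof.
elim: s f g => [|[i [b|]] s IH] f g.
- by rewrite big_seq1 !lin_ext_nil.
- rewrite lin_ext_some IH big_map; apply: eq_bigr => t _.
  by rewrite !lin_ext_some.
rewrite lin_ext_none !IH big_cat !big_map /= -sumrB -big_split.
apply: eq_bigr => t _; rewrite /= !lin_ext_none !lin_ext_some.
by rewrite mulrBl mulrBr addrA subrK.
Qed.

End LinExt.

Fact finite_type_submod k n : submod_closed (@finite_type k n).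
Proof.
split=> [|a v w /asboolP Hv /asboolP Hw]; apply/asboolP => s s1 sn.
  by rewrite /lin_ext big1 // => t _; rewrite mulr0.
by rewrite (lin_ext_lin _ _ a) Hv // Hw // mulr0 addr0.
Qed.

HB.instance Definition _ k n :=
  GRing.isSubmodClosed.Build rat (invariant k) (@finite_type k n)
    (@finite_type_submod k n).

Lemma finite_typeM k a b (v w : invariant k) :
  v \in finite_type a -> w \in finite_type b -> v * w \in finite_type (a + b).
Proof.
move=> /asboolP Hv /asboolP Hw; apply/asboolP => s s1 sn.
rewrite lin_extM big_seq big1 // => t /coresolveP [t1 t2 ts].
have [at1|at1] := ltnP a (double_points t.1).
  by rewrite Hv ?t1 // mul0r.
have bt2 : (b < double_points t.2)%N by lia.
by rewrite Hw ?t2 ?mulr0.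
Qed.

Lemma finite_typeW k m n (v : invariant k) :
  (m <= n)%N -> v \in finite_type m -> v \in finite_type n.
Proof.
move=> mn /asboolP Hv; apply/asboolP => s s1 sn; apply: Hv => //.
exact: leq_ltn_trans sn.
Qed.

Lemma lin_ext_keep k l (S : {set 'I_k}) (g : word l -> rat) (s : sword k) :
  lin_ext (fun w => g (keep l S w)) s =
  if double_points (keep l S s) == double_points s
  then lin_ext g (keep l S s) else 0.
Proof.
have keep_le (T : {set 'I_k}) (u : sword k) :
    (double_points (keep l T u) <= double_points u)%N.
  elim: u T => [|[j o] u IHu] T //; rewrite keep_cons /double_points count_cat.
  apply: leq_add; last exact: IHu.
  by rewrite /keep1 /=; case: ifP => // _; case: insub => //= r; rewrite addn0.
elim: s S g => [|[i [b|]] s IH] S g.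
- by rewrite !lin_ext_nil.
- rewrite lin_ext_some keep_cons /keep1.
  case E: (_ && _); last first.
    by rewrite -IH; congr lin_ext; apply: funext => w;
      rewrite keep_cons /keep1 E.
  case F: (insub _) => [r|]; last first.
    by rewrite -IH; congr lin_ext; apply: funext => w;
      rewrite keep_cons /keep1 E F.
  rewrite cat1s lin_ext_some -[double_points _]/(double_points (keep _ _ _)).
  rewrite -[double_points (_ :: s)]/(double_points s) -IH.
  by congr lin_ext; apply: funext => w; rewrite keep_cons /keep1 E F.
rewrite lin_ext_none keep_cons /keep1.
have dS : double_points ((i, None) :: s) = (double_points s).+1 by [].
case E: (_ && _); last first.
  rewrite -lin_ext_sub ifF; last first.
    by rewrite dS; apply/negbTE; rewrite neq_ltn /= ltnS keep_le.
  rewrite /lin_ext big1 // => t _.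
  by rewrite !keep_cons /keep1 E subrr mulr0.
case F: (insub _) => [r|]; last first.
  rewrite -lin_ext_sub ifF; last first.
    by rewrite dS; apply/negbTE; rewrite neq_ltn /= ltnS keep_le.
  rewrite /lin_ext big1 // => t _.
  by rewrite !keep_cons /keep1 E F subrr mulr0.
rewrite cat1s lin_ext_none dS.
rewrite -[double_points (_ :: _)]/(double_points (keep _ _ _)).+1 eqSS.
have K b : lin_ext (fun w => g (keep l S ((i, b) :: w))) s =
    lin_ext (fun w => g ((r, b) :: keep l (crossing_perm i @: S) w)) s.
  by congr lin_ext; apply: funext => w; rewrite keep_cons /keep1 E F.
rewrite !K (IH _ (fun w => g ((r, true) :: w))).
rewrite (IH _ (fun w => g ((r, false) :: w))).
by case: ifP; rewrite ?subrr.
Qed.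

Lemma finite_type_forget k n (S : {set 'I_k}) (v : invariant #|S|) :
  v \in finite_type n -> (v \o forget S : invariant k) \in finite_type n.
Proof.
move=> /asboolP Hv; apply/asboolP => s s1 sn.
rewrite (@eq_lin_ext _ _ (fun w => v (pure_class (keep #|S| S w)))) //.
  rewrite (lin_ext_keep _ (fun w => v (pure_class w))); case: eqP => // e.
  by rewrite Hv ?e // keep_pure.
by move=> w w1 /=; rewrite forget_pure_class.
Qed.

Definition Vspace k n := {v : invariant k | v \in finite_type n}.
HB.instance Definition _ k n := SubChoice.on (Vspace k n).
HB.instance Definition _ k n := [SubChoice_isSubLmodule of Vspace k n by <:].

(* V^(n-1) as a subspace of V^n, with V^(-1) = 0. *)
Definition lower k n : {pred Vspace k n} := fun v =>
  if n is m.+1 then val v \in finite_type m else v == 0.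

Fact lower_submod k n : submod_closed (@lower k n).
Proof.
case: n => [|n]; split=> [|a v w].
- exact: eqxx.
- by move=> /eqP -> /eqP ->; rewrite scaler0 addr0; apply: eqxx.
- exact: (rpred0 (@finite_type k n)).
- move=> Hv Hw; rewrite -[_ \in _]/(val (a *: v + w) \in finite_type n).
  by rewrite linearP; apply: rpredD => //; apply: rpredZ.
Qed.

HB.instance Definition _ k n :=
  GRing.isSubmodClosed.Build rat (Vspace k n) (@lower k n) (@lower_submod k n).

Definition gr k n := lquot (@lower k n).

Fact Vmul_subproof k a b n (e : (a + b)%N = n) (v : Vspace k a) (w : Vspace k b) :
  val v * val w \in finite_type n.
Proof. by rewrite -e; apply: finite_typeM; apply: valP. Qed.

Definition Vmul k a b n (e : (a + b)%N = n) (v : Vspace k a) (w : Vspace k b) : Vspace k n :=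
  Sub (val v * val w) (Vmul_subproof e v w).

Definition gr_mul k a b n (e : (a + b)%N = n) (x : gr k a) (y : gr k b) :
  gr k n := \pi_(gr k n) (Vmul e (repr x) (repr y)).

(* The degree n part of I^2, where I is the sum of the [gr k a] with a > 0: it
   is spanned by products of homogeneous elements of I. *)
Definition decomposable k n : {pred gr k n} := spanned (fun z : gr k n =>
  exists a b (e : (a + b)%N = n) (x : gr k a) (y : gr k b),
    [/\ (0 < a)%N, (0 < b)%N & z = gr_mul e x y]).

HB.instance Definition _ k n := GRing.SubmodClosed.on (@decomposable k n).

(* (I / I^2)_n for n > 0; for n = 0, I has no part of degree 0, whereas [gr k 0]
   is not 0. *)
Definition indec k n := lquot (@decomposable k n).

Lemma VmulC k a b n (e : (a + b)%N = n) (e' : (b + a)%N = n)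
    (v : Vspace k a) (w : Vspace k b) : Vmul e v w = Vmul e' w v.
Proof. by apply: val_inj; rewrite !SubK mulrC. Qed.

Lemma VmulBl k a b n (e : (a + b)%N = n) (v v' : Vspace k a) (w : Vspace k b) :
  Vmul e (v - v') w = Vmul e v w - Vmul e v' w.
Proof.
by apply: val_inj; rewrite [RHS]raddfB ![val (Vmul _ _ _)]SubK raddfB mulrBl.
Qed.

Lemma lower_mull k a b n (e : (a + b)%N = n) (v : Vspace k a) (w : Vspace k b) :
  v \in @lower k a -> Vmul e v w \in @lower k n.
Proof.
case: a e v => [|a] e v vl.
  have -> : Vmul e v w = 0; last exact: rpred0.
  by apply: val_inj; rewrite SubK (eqP vl) /= mul0r.
case: n e => // n e; rewrite -[_ \in _]/(_ * _ \in finite_type n).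
have {}e : (a + b)%N = n by lia.
by rewrite -e; apply: finite_typeM => //; apply: valP.
Qed.

Lemma gr_mul_pi k a b n (e : (a + b)%N = n) (v : Vspace k a) (w : Vspace k b) :
  gr_mul e (\pi v) (\pi w) = \pi_(gr k n) (Vmul e v w).
Proof.
have Hpi c (u : Vspace k c) : repr (\pi_(gr k c) u) - u \in @lower k c.
  by apply/lquotP; rewrite reprK.
have e' : (b + a)%N = n by lia.
apply: (@etrans _ _ (\pi_(gr k n) (Vmul e v (repr (\pi_(gr k b) w))))).
  by apply/lquotP; rewrite -VmulBl; apply/lower_mull/Hpi.
by apply/lquotP; rewrite !(VmulC e e') -VmulBl; apply/lower_mull/Hpi.
Qed.

Definition Vpull k n (S : {set 'I_k}) (v : Vspace #|S| n) : Vspace k n :=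
  Sub (val v \o forget S : invariant k) (finite_type_forget (valP v)).

Definition gr_pull k n (S : {set 'I_k}) (x : gr #|S| n) : gr k n :=
  \pi_(gr k n) (Vpull (repr x)).

Definition indec_pull k n (S : {set 'I_k}) (x : indec #|S| n) : indec k n :=
  \pi_(indec k n) (gr_pull (repr x)).

Fact Vpull_linear k n (S : {set 'I_k}) : linear (@Vpull k n S).
Proof. by move=> a v w; apply: val_inj; apply: funext => x. Qed.

Lemma gr_pull_pi k n (S : {set 'I_k}) (v : Vspace #|S| n) :
  gr_pull (\pi v) = \pi_(gr k n) (Vpull v).
Proof.
have PB (u w : Vspace #|S| n) : Vpull u - Vpull w = Vpull (u - w).
  by apply: val_inj; apply: funext.
apply/lquotP; rewrite PB.
have : repr (\pi_(gr #|S| n) v) - v \in @lower #|S| n.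
  by apply/lquotP; rewrite reprK.
move: (_ - _) => {PB}u; case: n v u => [|n] v u.
  move=> /eqP ->; have -> : Vpull (0 : Vspace #|S| 0) = 0 :> Vspace k 0.
    by apply: val_inj; apply: funext.
  exact: rpred0.
by move=> Hu; apply: (finite_type_forget Hu).
Qed.

Fact gr_pull_linear k n (S : {set 'I_k}) : linear (@gr_pull k n S).
Proof.
move=> a; elim/quotW => v; elim/quotW => w.
rewrite -[_ + _ in LHS](pi_lquot_linear _ a v w) [LHS]gr_pull_pi.
by rewrite Vpull_linear pi_lquot_linear -!gr_pull_pi.
Qed.

HB.instance Definition _ k n (S : {set 'I_k}) :=
  GRing.isLinear.Build rat (gr #|S| n) (gr k n) _ (@gr_pull k n S)
    (@gr_pull_linear k n S).

Lemma gr_pull_mul k a b n (e : (a + b)%N = n) (S : {set 'I_k})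
    (x : gr #|S| a) (y : gr #|S| b) :
  gr_pull (gr_mul e x y) = gr_mul e (gr_pull x) (gr_pull y).
Proof.
rewrite gr_mul_pi gr_pull_pi; congr (\pi _).
by apply: val_inj; apply: funext.
Qed.

Lemma indec_pull_pi k n (S : {set 'I_k}) (x : gr #|S| n) :
  indec_pull (\pi x) = \pi_(indec k n) (gr_pull x).
Proof.
apply/lquotP; rewrite -raddfB /=.
have : repr (\pi_(indec #|S| n) x) - x \in @decomposable #|S| n.
  by apply/lquotP; rewrite reprK.
move: (_ - _) => {}x /asboolP [s sP ->]; rewrite linear_sum big_seq.
apply: rpred_sum => p /sP [a [b [e [y [z [a0 b0 ->]]]]]].
rewrite linearZ rpredZ //; apply: mem_spanned.
exists a, b, e, (gr_pull y), (gr_pull z); split=> //.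
exact: gr_pull_mul.
Qed.

(* A choice of l < k strands is a set S of l = #|S| initial positions. *)
Definition induced k n : {pred indec k n} := spanned (fun z : indec k n =>
  exists (S : {set 'I_k}) (x : indec #|S| n),
    (#|S| < k)%N /\ z = indec_pull x).

HB.instance Definition _ k n := GRing.SubmodClosed.on (@induced k n).

Definition reduced k n := lquot (@induced k n).

Definition mobius (n : nat) : int :=
  if all (fun p => logn p n == 1%N) (primes n) then (-1) ^+ size (primes n)
  else 0.

Definition sur (m j : nat) : nat :=
  #|[set f : {ffun 'I_m -> 'I_j} | [forall y, exists x, f x == y]]|.

(* Main.v *)
From HB Require Import structures.
From mathcomp Require Import all_boot all_order all_algebra perm.
From mathcomp Require Import zify ring.
From mathcomp Require Import boolp functions.
Require Import Defs.

Set Implicit Arguments.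
Unset Strict Implicit.
Unset Printing Implicit Defensive.

Import Order.TTheory GRing.Theory Num.Theory.

Local Open Scope quotient_scope.
Local Open Scope ring_scope.

(** The idea is to let the last strand carry everything. The kernel of
    forgetting it is generated by the braids [gen s], in which it links once
    with the strand [s], and every pure braid [p] is the product of an element
    of this kernel and of the braid [rest p] on the other strands ([comb]). A
    Taylor expansion of an invariant [v] of type [n] along the generators gives
      [v p = \sum_w milnor w p * diffs w v (rest p)]
    ([taylor_rest]), where [w] ranges over the words of length at most [n] in
    the first [k - 1] strands and [milnor w] is the coefficient of [w] in the
    Magnus expansion of the longitude of the last strand. The second factor is
    induced from [k - 1] strands. Since [milnor w] has type [size w]
    ([milnor_type]), the terms with [0 < size w < n] are decomposable, and the
    one of the empty word is induced: the reduced space is spanned by the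
    classes of the [milnor w] with [size w = n] ([red_class_expand]).

    The same formula gives the relations between these classes. Applied to a
    product of two Milnor invariants, it says that the shuffles of two nonempty
    words have sum 0 ([red_class_shuffles]); applied to an invariant induced
    from fewer strands, it says that the class of a word that misses a letter is
    0 ([red_class_missing]). A word that is not a Lyndon word is the largest
    shuffle of two nonempty words ([nonlyndon_shuffle]), so the Lyndon words of
    length [n] in which all the [k - 1] letters occur suffice
    ([milnor_spanned]).

    They are independent. A Lyndon word [w] is the leading word of the Magnus
    expansion of an iterated commutator of the generators that occur in [w]
    ([lyndon_leads]). Such a commutator is congruent to 1 modulo the [n]-th
    power of the augmentation ideal, and becomes trivial when a strand is
    forgotten if all the letters occur in [w]. So the difference of the values
    of an invariant at the commutator and at 1 is a functional on the reduced
    space, and these functionals have a unitriangular matrix in the Milnor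
    invariants ([reduced_dim]).

    Finally, every word is in a unique way a power of a primitive word, and a
    primitive word has exactly one rotation that is a Lyndon word; Moebius
    inversion turns this into the formula ([card_lyndon_words]). *)

(** * Noncommutative power series and their units *)

Definition series (T : Type) := seq T -> rat.
HB.instance Definition _ (T : Type) := GRing.Zmodule.on (series T).

Section Series.
Variable T : Type.
Implicit Types f g h : series T.

Definition smul f g : series T :=
  fun u => \sum_(i < (size u).+1) f (take i u) * g (drop i u).

Definition sone : series T := fun u => (nilp u)%:R.

Definition sderiv (a : T) f : series T := fun u => f (a :: u).

Lemma smul_nil f g : smul f g [::] = f [::] * g [::].
Proof. by rewrite /smul big_ord1. Qed.

Lemma smul_cons f g a u :
  smul f g (a :: u) = f [::] * g (a :: u) + smul (sderiv a f) g u.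
Proof. by rewrite /smul big_ord_recl. Qed.

Fact smulDl : left_distributive smul +%R.
Proof.
move=> f g h; apply: funext => u.
rewrite -[RHS]/(smul f h u + smul g h u) /smul -big_split.
by apply: eq_bigr => i _ /=; rewrite -mulrDl.
Qed.

Fact smulDr : right_distributive smul +%R.
Proof.
move=> f g h; apply: funext => u.
rewrite -[RHS]/(smul f g u + smul f h u) /smul -big_split.
by apply: eq_bigr => i _ /=; rewrite -mulrDr.
Qed.

Lemma smulZl (c : rat) f g u :
  smul (fun v => c * f v) g u = c * smul f g u.
Proof. by rewrite /smul mulr_sumr; apply: eq_bigr => i _; rewrite mulrA. Qed.

Fact smulA : associative smul.
Proof.
move=> f g h; apply: funext => u.
elim: u f g => [|a u IH] f g; first by rewrite !smul_nil mulrA.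
rewrite !smul_cons IH mulrDr mulrA smul_nil -addrA; congr (_ + _).
have -> : sderiv a (smul f g) =
    (fun v => f [::] * sderiv a g v : rat) + smul (sderiv a f) g.
  by apply: funext => v; rewrite /sderiv smul_cons.
rewrite smulDl -[RHS]/(smul (fun v => f [::] * _) h u + smul _ h u).
by rewrite smulZl.
Qed.

Fact smul1l : left_id sone smul.
Proof.
move=> f; apply: funext => -[|a u]; first by rewrite smul_nil mul1r.
rewrite smul_cons mul1r /smul big1 ?addr0 // => i _.
by rewrite mul0r.
Qed.

Fact smul1r : right_id sone smul.
Proof.
move=> f; apply: funext => u; elim: u f => [|a u IH] f.
  by rewrite smul_nil mulr1.
by rewrite smul_cons mulr0 add0r IH.
Qed.

HB.instance Definition _ := GRing.Zmodule_isPzRing.Build (series T)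
  smulA smul1l smul1r smulDl smulDr.

Lemma seriesM f g u :
  (f * g) u = \sum_(i < (size u).+1) f (take i u) * g (drop i u).
Proof. by []. Qed.

Lemma seriesM_nil f g : (f * g) [::] = f [::] * g [::].
Proof. exact: smul_nil. Qed.

Lemma seriesM_cons f g a u :
  (f * g) (a :: u) = f [::] * g (a :: u) + (sderiv a f * g) u.
Proof. exact: smul_cons. Qed.

Lemma series1E u : (1 : series T) u = (nilp u)%:R. Proof. by []. Qed.
Lemma seriesDE f g u : (f + g) u = f u + g u. Proof. by []. Qed.
Lemma seriesNE f u : (- f) u = - f u. Proof. by []. Qed.
Lemma seriesBE f g u : (f - g) u = f u - g u. Proof. by []. Qed.

End Series.

Section UnitPairs.
Variable R : pzRingType.

(** The group of units of a ring that need not be commutative; a unit carries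
    its inverse, so that inversion is a computation. *)
Definition unit_pair := {x : R * R | (x.1 * x.2 == 1) && (x.2 * x.1 == 1)}.
HB.instance Definition _ := Choice.on unit_pair.

Definition uval (x : unit_pair) : R := (val x).1.
Definition uinv (x : unit_pair) : R := (val x).2.

Lemma uvalV x : uval x * uinv x = 1.
Proof. by have /andP [/eqP] := valP x. Qed.
Lemma uinvK x : uinv x * uval x = 1.
Proof. by have /andP [_ /eqP] := valP x. Qed.

Fact upair_mul_subproof (x y : unit_pair) :
  ((uval x * uval y) * (uinv y * uinv x) == 1) &&
  ((uinv y * uinv x) * (uval x * uval y) == 1).
Proof.
rewrite !mulrA -(mulrA (uval x)) uvalV mulr1 uvalV eqxx.
by rewrite -(mulrA (uinv y)) uinvK mulr1 uinvK eqxx.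
Qed.
Definition upair_mul (x y : unit_pair) : unit_pair :=
  exist _ (uval x * uval y, uinv y * uinv x) (upair_mul_subproof x y).

Fact upair_inv_subproof (x : unit_pair) :
  (uinv x * uval x == 1) && (uval x * uinv x == 1).
Proof. by rewrite uvalV uinvK eqxx. Qed.
Definition upair_inv (x : unit_pair) : unit_pair :=
  exist _ (uinv x, uval x) (upair_inv_subproof x).

Fact upair_one_subproof : ((1 : R) * 1 == 1) && ((1 : R) * 1 == 1).
Proof. by rewrite mulr1 eqxx. Qed.
Definition upair_one : unit_pair := exist _ (1, 1) upair_one_subproof.

Lemma unit_pair_inj x y : uval x = uval y -> uinv x = uinv y -> x = y.
Proof.
case: x y => [[x x'] px] [[y y'] py]; rewrite /uval /uinv /= => exy exy'.
by apply: val_inj; rewrite /= exy exy'.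
Qed.

Fact upair_mulA : associative upair_mul.
Proof. by move=> x y z; apply: unit_pair_inj;
  rewrite /uval /uinv /= !mulrA. Qed.
Fact upair_mul1 : left_id upair_one upair_mul.
Proof.
by move=> x; apply: unit_pair_inj; rewrite /uval /uinv /= ?mul1r ?mulr1.
Qed.
Fact upair_1mul : right_id upair_one upair_mul.
Proof.
by move=> x; apply: unit_pair_inj; rewrite /uval /uinv /= ?mul1r ?mulr1.
Qed.
Fact upair_mulV : left_inverse upair_one upair_inv upair_mul.
Proof.
by move=> x; apply: unit_pair_inj; rewrite /uval /uinv /= -/(uval x) -/(uinv x)
  uinvK.
Qed.
Fact upair_Vmul : right_inverse upair_one upair_inv upair_mul.
Proof.
by move=> x; apply: unit_pair_inj; rewrite /uval /uinv /= -/(uval x) -/(uinv x)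
  uvalV.
Qed.

HB.instance Definition _ := isGroup.Build unit_pair
  upair_mulA upair_mul1 upair_1mul upair_mulV upair_Vmul.

Lemma uvalM (x y : unit_pair) : uval (x * y)%g = uval x * uval y.
Proof. by []. Qed.
Lemma uval1 : uval (1%g : unit_pair) = 1.
Proof. by []. Qed.
End UnitPairs.

Lemma commutator_sub1 (R : pzRingType) (x y : R) :
  (x - 1) * (y - 1) - (y - 1) * (x - 1) = x * y - y * x.
Proof.
have E (a b : R) : (a - 1) * (b - 1) = a * b - (a + b - 1).
  by rewrite mulrBl mulrBr mul1r mulr1 -addrA -opprD addrA.
by rewrite !E (addrC y) [- (_ * _ - _)]opprB addrA subrK.
Qed.

Section Magnus.
Variable T : eqType.

Definition letter (a : T) : series T := fun u => (u == [:: a])%:R.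

Definition geometric (a : T) : series T :=
  fun u => if all (pred1 a) u then (-1) ^+ size u else 0.

Lemma letter_mul_nil a f : (letter a * f) [::] = 0.
Proof. by rewrite seriesM_nil mul0r. Qed.

Lemma sderiv_letter a b : sderiv b (letter a) = if b == a then 1 else 0.
Proof.
apply: funext => u; rewrite /sderiv /letter eqseq_cons.
by case: eqP => _ //; rewrite series1E; case: u.
Qed.

Lemma letter_mul_cons a f b u :
  (letter a * f) (b :: u) = if b == a then f u else 0.
Proof.
rewrite seriesM_cons mul0r add0r sderiv_letter.
by case: eqP => _; rewrite ?mul1r // mul0r.
Qed.

Lemma geometricP a : (1 + letter a) * geometric a = 1.
Proof.
apply: funext => u; rewrite mulrDl mul1r seriesDE.
case: u => [|b u]; first by rewrite letter_mul_nil addr0.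
rewrite letter_mul_cons /geometric /= series1E /=.
by case: eqP => _ /=; rewrite ?addr0 //; case: ifP => _; rewrite ?addr0 // exprS
  mulN1r addNr.
Qed.

Lemma geometric_letterC a : letter a * geometric a = geometric a * letter a.
Proof.
apply: funext; elim=> [|b u IH];
  first by rewrite letter_mul_nil seriesM_nil mulr0.
rewrite letter_mul_cons seriesM_cons -[geometric a [::]]/(1 : rat) mul1r.
have -> : sderiv b (geometric a) = if b == a then - geometric a else 0.
  apply: funext => v; rewrite /sderiv /geometric /=.
  case: eqP => _ //=; rewrite seriesNE.
  by case: ifP => _; rewrite ?oppr0 // exprS mulN1r.
case: (b =P a) => [->|ba]; last first.
  by rewrite mul0r addr0 /letter eqseq_cons (introF eqP ba).
rewrite mulNr seriesNE -IH.
case: u {IH} => [|c u]; first by rewrite letter_mul_nil subr0 /letter eqxx.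
rewrite letter_mul_cons {1}/letter eqseq_cons andbF add0r /geometric /=.
by case: eqP => _ /=; rewrite ?oppr0 //; case: ifP;
  rewrite ?oppr0 // exprS mulN1r.
Qed.

Fact magnus_subproof a :
  ((1 + letter a) * geometric a == 1) && (geometric a * (1 + letter a) == 1).
Proof.
rewrite geometricP eqxx mulrDr mulr1 -geometric_letterC.
by rewrite -(geometricP a) mulrDl mul1r eqxx.
Qed.

Definition magnus (a : T) : unit_pair (series T) :=
  exist _ (1 + letter a, geometric a) (magnus_subproof a).

End Magnus.
(** * Meridians and the longitude of the last strand *)

Section Run.
Variable G : groupType.

(** At a positive crossing the strand that comes from position i passes under
    the other one, at a negative crossing it passes over; the meridian of the
    strand that passes under is conjugated by that of the other one. *)
Definition cross (m : nat -> G) (i : nat) (b : bool) : nat -> G := fun p =>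
  if b then
    if p == i then m i.+1 else if p == i.+1 then (m i ^ m i.+1)%g else m p
  else
    if p == i then (m i.+1 ^ (m i)^-1)%g else if p == i.+1 then m i else m p.

Definition swap_pos (i q : nat) : nat :=
  if q == i then i.+1 else if q == i.+1 then i else q.

(** What a crossing at i contributes to the longitude of the strand in position
    q: the meridian, or its inverse, of the strand that it passes under. *)
Definition overpass (m : nat -> G) (i : nat) (b : bool) (q : nat) : G :=
  if b then if q == i then m i.+1 else 1%g
  else if q == i.+1 then (m i)^-1%g else 1%g.

(** The meridians of the strands, by position, together with the position and
    the longitude of one marked strand. *)
Record state := State { mer : nat -> G; mark : nat; lon : G }.

Definition step (st : state) (i : nat) (b : bool) : state :=
  State (cross (mer st) i b) (swap_pos i (mark st))
        (lon st * overpass (mer st) i b (mark st))%g.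

Variable k : nat.
Implicit Types w : word k.

Definition run (st : state) w : state :=
  foldl (fun s (c : 'I_k.-1 * bool) => step s c.1 c.2) st w.

Lemma run_cat st w w' : run st (w ++ w') = run (run st w) w'.
Proof. exact: foldl_cat. Qed.

Lemma eq_state (s t : state) :
  mer s =1 mer t -> mark s = mark t -> lon s = lon t -> s = t.
Proof. by case: s t => [m q l] [m' q' l'] /= /funext -> -> ->. Qed.

(** In the third Reidemeister move, a meridian is conjugated by exactly the
    meridians that its strand passes under, so that the marked strand meets the
    same product of meridians on both sides. *)
Lemma run_rel st w w' : braid_rel w w' -> run st w = run st w'.
Proof.
case: st => m q l; have Sn (n : nat) : (n.+1 == n) = false by rewrite gtn_eqF.
case=> [i [|]|i j ij|i j ij]; apply: eq_state; rewrite /= /swap_pos /overpass.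
- move=> p; rewrite /cross /= !eqxx Sn.
  case: eqP => [->|_]; first by rewrite conjgK.
  by case: eqP => [->|].
- by do ![case: eqP => /= //]; lia.
- rewrite /cross /= !eqxx.
  by do ![case: eqP => /= //]; rewrite ?mulg1 ?mulgK //; lia.
- move=> p; rewrite /cross /= !eqxx Sn.
  case: eqP => [->|_] //.
  by case: eqP => [->|] //; rewrite conjgKV.
- by do ![case: eqP => /= //]; lia.
- rewrite /cross /= !eqxx Sn.
  by do ![case: eqP => /= //]; rewrite ?mulg1 ?mulgVK //; lia.
- move=> p; rewrite /cross /=.
  by do ![case: eqP => /= //]; lia.
- by do ![case: eqP => /= //]; lia.
- rewrite /cross /=.
  by do ![case: eqP => /= //]; rewrite ?mulg1 //; lia.
- move=> p; rewrite /cross /= ij.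
  do ![case: eqP => /= //]; try lia.
  by move=> *; rewrite -!conjgM -conjgC.
- by rewrite ij; do ![case: eqP => /= //]; lia.
- rewrite /cross /= ij.
  do ![case: eqP => /= //]; rewrite ?mulg1 //; try lia.
  by move=> *; rewrite -!mulgA -conjgC.
Qed.

Lemma run_braid_eq st w w' : braid_eq w w' -> run st w = run st w'.
Proof.
move=> Hw; elim: Hw st => {w w'} [u v x y Hxy|//|u v _ IH|u v w _ IH1 _ IH2] st.
- by rewrite !run_cat (run_rel _ Hxy).
- by rewrite IH.
- by rewrite IH1.
Qed.

Definition lmul (g : G) (st : state) : state :=
  State (mer st) (mark st) (g * lon st)%g.

Lemma run_lmul g st w : run (lmul g st) w = lmul g (run st w).
Proof.
elim: w st => [|c w IH] st //=.
by rewrite -IH /lmul /step /= mulgA.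
Qed.

(** Crossings on the left of the marked strand do not meet it. *)
Lemma run_below_mark st w :
  all (fun c : 'I_k.-1 * bool => (c.1.+1 < mark st)%N) w ->
  mark (run st w) = mark st /\ lon (run st w) = lon st.
Proof.
elim: w st => [|[i b] w IH] st //= /andP [iq wq].
have sq : swap_pos i (mark st) = mark st.
  by rewrite /swap_pos !gtn_eqF // ltnW.
have [|-> ->] := IH (step st i b); first by rewrite /= sq.
by rewrite /= sq /overpass !gtn_eqF // ?(ltnW iq) //; case: b; rewrite mulg1.
Qed.

End Run.
(** * The Milnor invariants have finite type *)

Lemma lin_ext_sum k (J : Type) (r : seq J) (F : J -> word k -> rat)
    (s : sword k) :
  lin_ext (fun w => \sum_(j <- r) F j w) s = \sum_(j <- r) lin_ext (F j) s.
Proof.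
rewrite /lin_ext exchange_big; apply: eq_bigr => t _.
by rewrite mulr_sumr.
Qed.

Lemma lin_ext_cat k (f : word k -> rat) (s t : sword k) :
  lin_ext f (s ++ t) = lin_ext (fun w => lin_ext (fun x => f (w ++ x)) t) s.
Proof.
elim: s f => [|[i [b|]] s IH] f /=; first by rewrite lin_ext_nil.
  by rewrite !lin_ext_some IH.
by rewrite !lin_ext_none !IH.
Qed.

Lemma lin_ext_rcons_some k (f : word k -> rat) (s : sword k) i b :
  lin_ext f (rcons s (i, Some b)) = lin_ext (fun w => f (rcons w (i, b))) s.
Proof.
rewrite -cats1 lin_ext_cat; congr lin_ext; apply: funext => w.
by rewrite lin_ext_some lin_ext_nil cats1.
Qed.

Lemma lin_ext_rcons_none k (f : word k -> rat) (s : sword k) i :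
  lin_ext f (rcons s (i, None)) =
  lin_ext (fun w => f (rcons w (i, true)) - f (rcons w (i, false))) s.
Proof.
rewrite -cats1 lin_ext_cat; congr lin_ext; apply: funext => w.
by rewrite lin_ext_none !lin_ext_nil !cats1.
Qed.

Lemma resolve_fst k (s : sword k) t :
  t \in resolve s -> map fst t.2 = map fst s.
Proof.
elim: s t => [|[i [b|]] s IH] t /=; first by rewrite inE => /eqP ->.
  by move=> /mapP [u us ->] /=; rewrite IH.
by rewrite mem_cat => /orP [] /mapP [u us ->] /=; rewrite IH.
Qed.

Lemma coresolve_fst k (s : sword k) t : t \in coresolve s ->
  map fst t.1 = map fst s /\ map fst t.2 = map fst s.
Proof.
elim: s t => [|[i [b|]] s IH] t /=; first by rewrite inE => /eqP ->.
  by move=> /mapP [u /IH [H1 H2] ->]; rewrite /= H1 H2.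
by rewrite mem_cat => /orP [] /mapP [u /IH [H1 H2] ->]; rewrite /= H1 H2.
Qed.

Section Filtration.
Variables (k : nat) (T : Type).
Implicit Types (I : seq 'I_k.-1) (f g : word k -> series T)
  (m : word k -> unit_pair (series T)).

(** [filt I e f]: on the singular words with underlying crossings [I], each
    double point raises the order of the power series [f] by one, starting from
    order [e]. Fixing [I] makes the position of a strand the same in all the
    resolutions of a singular word. *)
Definition filt I (e : nat) f : Prop :=
  forall s : sword k, map fst s = I -> forall u,
    (size u < e + double_points s)%N -> lin_ext (fun w => f w u) s = 0.

Lemma eq_filt I e f g : (forall w, map fst w = I -> f w = g w) ->
  filt I e f -> filt I e g.
Proof.
move=> fg Hf s sI u us; rewrite -[RHS](Hf s sI u us) /lin_ext !big_seq.
by apply: eq_bigr => t /resolve_fst ts; rewrite fg // ts.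
Qed.

Lemma filtW I e e' f : (e' <= e)%N -> filt I e f -> filt I e' f.
Proof. by move=> ee Hf s sI u us; apply: Hf => //; lia. Qed.

Lemma filtD I e f g :
  filt I e f -> filt I e g -> filt I e (fun w => f w + g w).
Proof.
move=> Hf Hg s sI u us; rewrite -[RHS]addr0 -{1}(Hf s sI u us) -(Hg s sI u us).
by rewrite /lin_ext -big_split; apply: eq_bigr => t _ /=; rewrite -mulrDr.
Qed.

Lemma filtN I e f : filt I e f -> filt I e (fun w => - f w).
Proof.
move=> Hf s sI u us; rewrite -[RHS]oppr0 -(Hf s sI u us) /lin_ext -sumrN.
by apply: eq_bigr => t _; rewrite -mulrN.
Qed.

Lemma filt0 I e : filt I e (fun=> 0).
Proof. by move=> s _ u _; rewrite /lin_ext big1 // => t _; rewrite mulr0. Qed.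

Lemma filt1 I : filt I 0 (fun=> 1).
Proof.
move=> s _ u us; have {us}: (0 < double_points s)%N by lia.
elim: s => [//|[i [b|]] s IH] s0; last by rewrite lin_ext_none subrr.
by rewrite lin_ext_some IH.
Qed.

(** A singular word of a product is a sum over the ways to give each double
    point to one of the two factors. *)
Lemma filtM I e e' f g : filt I e f -> filt I e' g ->
  filt I (e + e') (fun w => f w * g w).
Proof.
move=> Hf Hg s sI u us.
transitivity (\sum_(i < (size u).+1)
    lin_ext (fun w => f w (take i u) * g w (drop i u)) s).
  by rewrite -lin_ext_sum.
rewrite big1 // => i _; rewrite lin_extM big_seq big1 // => -[a b] ab.
have [_ _ /= abn] := coresolveP ab; have [/= aI bI] := coresolve_fst ab.
have iu : (size (take i u) + size (drop i u))%N = size u.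
  by rewrite -size_cat cat_take_drop.
have [Ha|Ha] := ltnP (size (take i u)) (e + double_points a)%N.
  by rewrite Hf ?aI // mul0r.
by rewrite Hg ?bI ?mulr0 //; lia.
Qed.

Lemma filt_rcons I i e f :
  filt I e (fun w => f (rcons w (i, true))) ->
  filt I e (fun w => f (rcons w (i, false))) ->
  filt I e.+1 (fun w => f (rcons w (i, true)) - f (rcons w (i, false))) ->
  filt (rcons I i) e f.
Proof.
move=> Ht Hf Hd s; case/lastP: s => [|s [j o]].
  by move=> /(congr1 size); rewrite size_rcons.
rewrite map_rcons => /rcons_inj [sI /= ->] u.
have -> : double_points (rcons s (i, o)) = (double_points s + (o == None))%N.
  by rewrite /double_points -cats1 count_cat /= addn0.
case: o => [[|]|] us.
- by rewrite lin_ext_rcons_some; apply: Ht => //; move: us; rewrite addn0.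
- by rewrite lin_ext_rcons_some; apply: Hf => //; move: us; rewrite addn0.
rewrite lin_ext_rcons_none; apply: Hd => //.
by rewrite addSnnS -(addn1 (double_points s)).
Qed.

Definition unipotent I m : Prop :=
  filt I 1 (fun w => uval (m w) - 1) /\ filt I 1 (fun w => uval (m w)^-1%g - 1).

Lemma unipotentV I m : unipotent I m -> unipotent I (fun w => (m w)^-1%g).
Proof.
by case=> H1 H2; split=> //; apply: eq_filt H1 => w _; rewrite invgK.
Qed.

Lemma unipotent_filt I m : unipotent I m -> filt I 0 (fun w => uval (m w)).
Proof.
move=> [/(filtW (leq0n 1)) H _]; apply: eq_filt (filtD H (@filt1 I)) => w _.
by rewrite subrK.
Qed.

Lemma uval_conj (R : pzRingType) (x y : unit_pair R) :
  uval (x ^ y)%g = uval y^-1%g * uval x * uval y.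
Proof. by rewrite conjgE !uvalM mulrA. Qed.

Lemma uval_mulV (R : pzRingType) (x : unit_pair R) : uval x^-1%g * uval x = 1.
Proof. exact: uinvK. Qed.

Lemma unipotentJ I m (g : word k -> unit_pair (series T)) :
  unipotent I m -> unipotent I g ->
  unipotent I (fun w => (m w ^ g w)%g).
Proof.
have H a : filt I 1 (fun w => uval (a w) - 1) -> unipotent I g ->
    filt I 1 (fun w => uval (a w ^ g w)%g - 1).
  move=> Ha Hg; have G1 := unipotent_filt Hg.
  have G2 := unipotent_filt (unipotentV Hg).
  apply: eq_filt (filtM (filtM G2 Ha) G1) => w _.
  by rewrite uval_conj mulrBr mulrBl mulr1 uval_mulV.
move=> [m1 m2] Hg; split; first exact: H.
by apply: eq_filt (H (fun w => (m w)^-1%g) m2 Hg) => w _; rewrite conjVg.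
Qed.

(** Conjugation is trivial up to commutators, which have order two. *)
Lemma filt_conjB I m (g : word k -> unit_pair (series T)) :
  unipotent I m -> unipotent I g ->
  filt I 2 (fun w => uval (m w ^ g w)%g - uval (m w)).
Proof.
move=> [m1 _] Hg; have G2 := unipotent_filt (unipotentV Hg); case: Hg => g1 _.
have H := filtD (filtM m1 g1) (filtN (filtM g1 m1)).
apply: eq_filt (filtM G2 H) => w _; rewrite uval_conj.
rewrite commutator_sub1.
by rewrite mulrBr !mulrA uval_mulV mul1r.
Qed.

Lemma unipotent_rcons I i m :
  unipotent I (fun w => m (rcons w (i, true))) ->
  unipotent I (fun w => m (rcons w (i, false))) ->
  filt I 2 (fun w => uval (m (rcons w (i, true))) -
                     uval (m (rcons w (i, false)))) ->
  filt I 2 (fun w => uval (m (rcons w (i, true)))^-1%g -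
                     uval (m (rcons w (i, false)))^-1%g) ->
  unipotent (rcons I i) m.
Proof.
move=> [t1 t2] [f1 f2] d1 d2; split; apply: filt_rcons => //.
  by apply: eq_filt d1 => w _; rewrite opprB addrA subrK.
by apply: eq_filt d2 => w _; rewrite opprB addrA subrK.
Qed.

End Filtration.

Section Longitude.
Variable k : nat.
Implicit Types (w : word k) (p : pure k) (u : seq 'I_k.-1).

(** The last strand is marked, and its own meridian is set to 1, so that its
    longitude is a word in the meridians of the other strands. *)
Definition base_mer (q : nat) : unit_pair (series 'I_k.-1) :=
  if insub q is Some s then magnus s else 1%g.

Definition base_state := State base_mer k.-1 1%g.

Definition word_longitude w := lon (run base_state w).

Lemma run_rcons (G : groupType) (st : state G) w c :
  run st (rcons w c) = step (run st w) c.1 c.2.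
Proof. by rewrite /run foldl_rcons. Qed.

Lemma mark_run (G : groupType) (st : state G) w :
  mark (run st w) =
  foldl (fun q (i : 'I_k.-1) => swap_pos i q) (mark st) (map fst w).
Proof. by elim: w st => [|c w IH] st //=; rewrite IH. Qed.

(** A double point changes a meridian by a commutator and the longitude by a
    factor of the form m - 1, where m is a meridian; so each double point raises
    the order. *)
Lemma filt_run (I : seq 'I_k.-1) :
  (forall q, unipotent I (fun w => mer (run base_state w) q)) /\
  filt I 0 (fun w => uval (word_longitude w)).
Proof.
elim/last_ind: I => [|I i [Hm Hl]].
  split=> [q|]; last by case=> // _ u.
  have base0 : uval (base_mer q) [::] = 1 /\ uval (base_mer q)^-1%g [::] = 1.
    by rewrite /base_mer; case: insub => [s|].
  split; case=> // _ [|//] _; rewrite lin_ext_nil seriesBE /=.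
    by rewrite (proj1 base0) subrr.
  by rewrite (proj2 base0) subrr.
split=> [q|].
  have E b w : mer (run base_state (rcons w (i, b))) q =
      cross (mer (run base_state w)) i b q by rewrite run_rcons.
  have E1 b : (fun w => mer (run base_state (rcons w (i, b))) q) =
      (fun w => cross (mer (run base_state w)) i b q) by apply: funext.
  apply: unipotent_rcons.
  - rewrite /= (E1 true) /cross; case: (q == i); [exact: Hm|].
    case: (q == i.+1); last exact: Hm.
    exact: unipotentJ.
  - rewrite /= (E1 false) /cross; case: (q == i); [|case: (q == i.+1);
    exact: Hm].
    by apply: unipotentJ => //; apply: unipotentV.
  - apply: (@eq_filt _ _ _ _ (fun w =>
      uval (cross (mer (run base_state w)) i true q) -
      uval (cross (mer (run base_state w)) i false q))) => [w _|].
      by rewrite !E.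
    rewrite /cross; case: (q == i); [|case: (q == i.+1)].
    + have := filtN (filt_conjB (Hm i.+1) (unipotentV (Hm i))).
      by apply: eq_filt => w _; rewrite opprB.
    + exact: filt_conjB.
    + by apply: eq_filt (@filt0 _ _ I 2) => w _; rewrite subrr.
  - apply: (@eq_filt _ _ _ _ (fun w =>
      uval (cross (mer (run base_state w)) i true q)^-1%g -
      uval (cross (mer (run base_state w)) i false q)^-1%g)) => [w _|].
      by rewrite !E.
    rewrite /cross; case: (q == i); [|case: (q == i.+1)].
    + have := filtN (filt_conjB (unipotentV (Hm i.+1)) (unipotentV (Hm i))).
      by apply: eq_filt => w _; rewrite opprB conjVg.
    + have := filt_conjB (unipotentV (Hm i)) (Hm i.+1).
      by apply: eq_filt => w _; rewrite conjVg.
    + by apply: eq_filt (@filt0 _ _ I 2) => w _; rewrite subrr.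
pose q := foldl (fun q (j : 'I_k.-1) => swap_pos j q) k.-1 I.
have E b w : map fst w = I -> word_longitude (rcons w (i, b)) =
    (word_longitude w * overpass (mer (run base_state w)) i b q)%g.
  by move=> wI; rewrite /word_longitude run_rcons /= mark_run wI.
apply: filt_rcons.
- apply: eq_filt (fun w wI => congr1 (@uval _) (esym (E true w wI))) _.
  rewrite /overpass; case: (q == i); last first.
    by apply: eq_filt Hl => w _; rewrite mulg1.
  exact: filtM Hl (unipotent_filt (Hm _)).
- apply: eq_filt (fun w wI => congr1 (@uval _) (esym (E false w wI))) _.
  rewrite /overpass; case: (q == i.+1); last first.
    by apply: eq_filt Hl => w _; rewrite mulg1.
  exact: filtM Hl (unipotent_filt (unipotentV (Hm _))).
apply: (@eq_filt _ _ _ _ (fun w =>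
    uval (word_longitude w * overpass (mer (run base_state w)) i true q)%g -
    uval (word_longitude w * overpass (mer (run base_state w)) i false q)%g))
    => [w wI|]; first by rewrite !E.
rewrite /overpass; case: (q =P i :> nat) => [->|_].
  rewrite ltn_eqF //; have [H _] := Hm i.+1.
  by apply: eq_filt (filtM Hl H) => w _; rewrite mulg1 uvalM mulrBr mulr1.
case: (q =P i.+1) => [_|_].
  have [_ H] := Hm i.
  apply: eq_filt (filtN (filtM Hl H)) => w _.
  by rewrite mulg1 uvalM mulrBr mulr1 opprB.
by apply: eq_filt (@filt0 _ _ I 1) => w _; rewrite subrr.
Qed.

Definition longitude p := word_longitude (repr (val p)).

Lemma longitude_pure_class w :
  dperm w = 1%g -> longitude (pure_class w) = word_longitude w.
Proof.
move=> w1; rewrite /longitude /word_longitude val_pure_class //.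
by rewrite (run_braid_eq _ (braid_reprK w)).
Qed.

(** A Milnor invariant of the last strand, in Magnus's form. *)
Definition milnor u : invariant k := fun p => uval (longitude p) u.

Lemma milnor_type u : milnor u \in finite_type (size u).
Proof.
apply/asboolP => s s1 us.
rewrite (@eq_lin_ext _ _ (fun w => uval (word_longitude w) u)) //; last first.
  by move=> w w1; rewrite /milnor longitude_pure_class.
by have [_ H] := filt_run (map fst s); apply: H.
Qed.

End Longitude.
(** * Combing a pure braid *)

Section Evaluation.
Variables (J : Type) (G : groupType) (phi : J -> G).

(** A list stands for a product of generators and of their inverses. The group
    is arbitrary because the same product is evaluated on pure braids, on power
    series and on braids where strands are forgotten. *)
Fixpoint evalg (l : seq (J * bool)) : G :=
  if l is (j, b) :: l' then
    ((if b then phi j else (phi j)^-1) * evalg l')%g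
  else 1%g.

Definition invl (l : seq (J * bool)) : seq (J * bool) :=
  rev [seq (c.1, ~~ c.2) | c <- l].

Lemma evalg_cat l l' : evalg (l ++ l') = (evalg l * evalg l')%g.
Proof. by elim: l => [|[j b] l IH] /=; rewrite ?mul1g // IH mulgA. Qed.

Lemma evalg_inv l : evalg (invl l) = (evalg l)^-1%g.
Proof.
elim: l => [|[j b] l IH] /=; first by rewrite invg1.
rewrite /invl /= rev_cons -cats1 evalg_cat IH /= mulg1 invgM.
by case: b => //=; rewrite invgK.
Qed.

End Evaluation.

Lemma evalg_morph (J : Type) (G H : groupType) (f : G -> H) (phi : J -> G) l :
  {morph f : x y / (x * y)%g} -> f (evalg phi l) = evalg (f \o phi) l.
Proof.
move=> fM; have f1 : f 1%g = 1%g.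
  by apply: (mulgI (f 1%g)); rewrite -fM !mulg1.
elim: l => [//|[j b] l IH] /=; rewrite fM IH; congr (_ * _)%g.
case: b => //; apply: (mulgI (f (phi j))).
by rewrite -fM !mulgV.
Qed.

Section Generators.
Variable k : nat.
Implicit Types (i s : 'I_k.-1) (q : nat) (w u : word k).

(** The last strand moves left to position q, over the strands it meets. *)
Definition tau q : word k :=
  [seq (i, true) | i <- pmap (insub : nat -> option 'I_k.-1)
                             (rev (iota q (k.-1 - q)))].

Lemma tau_last : tau k.-1 = [::].
Proof. by rewrite /tau subnn. Qed.

Lemma tau_rcons i : tau i = rcons (tau i.+1) (i, true).
Proof.
rewrite /tau; have -> : (k.-1 - i = (k.-1 - i.+1).+1)%N.
  by have := ltn_ord i; lia.
rewrite /= rev_cons -cats1 pmap_cat map_cat /=.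
by case: insubP => [j _ /val_inj -> /=|]; rewrite ?cats1 // ltn_ord.
Qed.

Lemma tau_ind (P : nat -> Prop) :
  P k.-1 -> (forall i, P i.+1 -> P i) -> forall q, (q <= k.-1)%N -> P q.
Proof.
move=> P1 Pi q qk; rewrite -(subKn qk).
elim: (k.-1 - q)%N (leq_subr q k.-1) => [|d IH] dk; first by rewrite subn0.
have dk' : (k.-1 - d.+1 < k.-1)%N by lia.
apply: (Pi (Ordinal dk')) => /=.
have -> : (k.-1 - d.+1).+1 = (k.-1 - d)%N by lia.
exact: IH (ltnW dk).
Qed.

Definition gen_word s : word k :=
  tau s.+1 ++ [:: (s, true); (s, true)] ++ word_inv (tau s.+1).

(** The last strand links once with the strand in position s. *)
Definition gen s : pure k := pure_class (gen_word s).

Lemma dperm_inv w : dperm (word_inv w) = (dperm w)^-1%g.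
Proof.
apply: (mulgI (dperm w)); rewrite mulgV -dperm_cat.
exact: (braid_eq_dperm (word_mulV w)).
Qed.

Lemma dperm_gen_word s : dperm (gen_word s) = 1%g.
Proof.
rewrite /gen_word !dperm_cat dperm_inv /= mulg1.
by rewrite /crossing_perm tperm2 mul1g mulgV.
Qed.

Lemma pure_classM w u : dperm w = 1%g -> dperm u = 1%g ->
  pure_class (w ++ u) = (pure_class w * pure_class u)%g.
Proof.
move=> w1 u1; apply: val_inj; rewrite valM !val_pure_class //.
  by rewrite [RHS]pi_braidM.
by rewrite dperm_cat w1 u1 mulg1.
Qed.

Lemma run_tau q : (q <= k.-1)%N ->
  run (base_state k) (tau q) =
  State (fun p => if (p < q)%N then base_mer k p else
                  if p == q then 1%g else base_mer k p.-1) q 1%g.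
Proof.
have base1 p : (k.-1 <= p)%N -> base_mer k p = 1%g.
  by move=> kp; rewrite /base_mer; case: insubP => // s; rewrite ltnNge kp.
move: q; apply: tau_ind => [|i IH].
  rewrite tau_last; apply: eq_state => //= p.
  case: ltngtP => // [kp|->]; last by rewrite base1.
  by rewrite !base1 //; lia.
rewrite tau_rcons run_rcons IH /=; apply: eq_state => /=.
- move=> p; rewrite /cross ltnn eqxx ltnS leqnn.
  case: (ltngtP p i) => [pi|pi|_] //=.
    by rewrite ltn_eqF ?ltnS 1?ltnW // ltnW.
  case: (p =P i.+1) => [->|pi']; first by rewrite conjg1.
  by rewrite ltnS leqNgt pi.
- by rewrite /swap_pos gtn_eqF // eqxx.
- by rewrite /overpass gtn_eqF // mulg1.
Qed.

(** While it moves, the last strand passes over the others, so that its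
    longitude only records the turn around the strand s; going back restores
    the meridians. *)
Lemma run_gen s :
  run (base_state k) (gen_word s) = lmul (magnus s) (base_state k).
Proof.
rewrite /gen_word run_cat run_cat.
have -> : run (run (base_state k) (tau s.+1)) [:: (s, true); (s, true)] =
    lmul (magnus s) (run (base_state k) (tau s.+1)).
  have Sn (n : nat) : (n.+1 == n) = false by rewrite gtn_eqF.
  rewrite run_tau //; apply: eq_state => /=.
  - move=> p; rewrite /cross !eqxx !Sn ltnSn ltnn.
    case: (p =P s :> nat) => [->|_]; first by rewrite ltnSn conjg1.
    by case: (p =P s.+1) => [->|//]; rewrite ltnn conj1g.
  - by rewrite /swap_pos Sn !eqxx.
  - rewrite /overpass Sn /swap_pos Sn /cross !eqxx ?Sn ?ltnn ?mulg1 ?mul1g.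
    rewrite ?ltnSn ?conjg1 /base_mer.
    by case: insubP => [t _ /val_inj ->|]; rewrite ?ltn_ord.
rewrite run_lmul -run_cat; congr lmul.
by rewrite (run_braid_eq _ (word_mulV _)).
Qed.

Lemma longitude_gen s (p : pure k) :
  longitude (gen s * p)%g = (magnus s * longitude p)%g.
Proof.
rewrite -[p in LHS]pure_class_repr -pure_classM ?dperm_gen_word ?dperm_pure //.
rewrite longitude_pure_class; last first.
  by rewrite dperm_cat dperm_gen_word dperm_pure mulg1.
by rewrite /word_longitude run_cat run_gen run_lmul.
Qed.

Lemma longitude_evalg l (p : pure k) :
  longitude (evalg gen l * p)%g = (evalg (@magnus _) l * longitude p)%g.
Proof.
elim: l => [|[s b] l IH] /=; first by rewrite !mul1g.
rewrite -!mulgA -IH; case: b; first exact: longitude_gen.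
by rewrite -[in RHS](mulVKg (gen s) (evalg gen l * p)%g) longitude_gen mulKg.
Qed.

(** Such a word is a braid on the first k - 1 strands. *)
Definition avoids_last w := all (fun c : 'I_k.-1 * bool => (c.1.+1 < k.-1)%N) w.

Lemma longitude_avoids_last w : dperm w = 1%g -> avoids_last w ->
  longitude (pure_class w) = 1%g.
Proof.
move=> w1 sw; rewrite longitude_pure_class // /word_longitude.
by have [_ ->] := @run_below_mark _ _ (base_state k) w sw.
Qed.

End Generators.
Section Combing.
Variable k : nat.
Implicit Types (i j s : 'I_k.-1) (q : nat) (w u : word k) (b : bool).

Local Notation cl w := (\pi_(braid k) w).
Local Notation sg i := (cl [:: (i, true)]).

Lemma cl_cat w u : cl (w ++ u) = (cl w * cl u)%g.
Proof. by rewrite [RHS]pi_braidM. Qed.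

Lemma cl_nil : cl [::] = 1%g. Proof. by []. Qed.

Lemma cl_inv w : cl (word_inv w) = (cl w)^-1%g.
Proof. by rewrite [RHS]pi_braidV. Qed.

Lemma cl_letter i b : cl [:: (i, b)] = if b then sg i else (sg i)^-1%g.
Proof. by case: b => //; rewrite -cl_inv. Qed.

Lemma cl_rel w u : braid_rel w u -> cl w = cl u.
Proof.
move=> wu; apply/braidP/asboolP.
by have := BraidStep [::] [::] wu; rewrite !cats0.
Qed.

Lemma sg_far i j : (i.+1 < j)%N -> (sg i * sg j = sg j * sg i)%g.
Proof. by move=> ij; rewrite -!cl_cat; apply/cl_rel/BraidFar. Qed.

Lemma sg_braid i j : j = i.+1 :> nat ->
  (sg i * sg j * sg i = sg j * sg i * sg j)%g.
Proof. by move=> ij; rewrite -!cl_cat; apply/cl_rel/BraidYB. Qed.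

Lemma cl_tau i : cl (tau k i) = (cl (tau k i.+1) * sg i)%g.
Proof. by rewrite tau_rcons -cats1 cl_cat. Qed.

Lemma tau_below q i : (i.+1 < q <= k.-1)%N ->
  (cl (tau k q) * sg i = sg i * cl (tau k q))%g.
Proof.
case/andP => iq qk; move: q qk iq; apply: tau_ind => [_|j IH].
  by rewrite tau_last cl_nil mul1g mulg1.
by move=> ij; rewrite cl_tau -mulgA -(sg_far ij) mulgA IH ?mulgA // ltnW.
Qed.

Lemma tau_above q i j : j = i.+1 :> nat -> (q <= i)%N ->
  (cl (tau k q) * sg j = sg i * cl (tau k q))%g.
Proof.
move=> ji qi; have qk : (q <= k.-1)%N by have := ltn_ord i; lia.
move: q qk qi; apply: tau_ind => [|s IH]; first by have := ltn_ord i; lia.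
rewrite leq_eqVlt => /orP [/eqP/val_inj ->|si].
  rewrite cl_tau -ji cl_tau -!mulgA [X in (_ * X)%g]mulgA -sg_braid //.
  by rewrite !mulgA tau_below // ji ltnSn -ji ltn_ord.
by rewrite cl_tau -mulgA sg_far ?ji // mulgA IH ?mulgA.
Qed.

Lemma commute_inv (G : groupType) (x y z : G) :
  (x * y = z * x -> x * y^-1 = z^-1 * x)%g.
Proof.
by move=> xy; apply: (mulgI z); rewrite mulVKg mulgA -xy mulgK.
Qed.

Lemma tau_below_letter q i b : (i.+1 < q <= k.-1)%N ->
  (cl (tau k q) * cl [:: (i, b)] = cl [:: (i, b)] * cl (tau k q))%g.
Proof.
move=> iq; have H := tau_below iq.
by rewrite (cl_letter i b); case: b => //; apply: commute_inv.
Qed.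

Lemma tau_above_letter q i j b : j = i.+1 :> nat -> (q <= i)%N ->
  (cl (tau k q) * cl [:: (j, b)] = cl [:: (i, b)] * cl (tau k q))%g.
Proof.
move=> ji qi; have H := tau_above ji qi.
by rewrite (cl_letter i b) (cl_letter j b); case: b => //; apply: commute_inv.
Qed.

Definition generated (x : braid k) : Prop :=
  exists l, x = evalg (fun s => cl (gen_word s)) l.

Lemma generated1 : generated 1%g. Proof. by exists [::]. Qed.

Lemma generatedM x y : generated x -> generated y -> generated (x * y)%g.
Proof. by move=> [l ->] [l' ->]; exists (l ++ l'); rewrite evalg_cat. Qed.

Lemma generatedV x : generated x -> generated x^-1%g.
Proof. by move=> [l ->]; exists (invl l); rewrite evalg_inv. Qed.

Lemma generated_gen s : generated (cl (gen_word s)).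
Proof. by exists [:: (s, true)]; rewrite /= mulg1. Qed.

Lemma cl_gen s : cl (gen_word s) =
  (cl (tau k s.+1) * (sg s * sg s) * (cl (tau k s.+1))^-1)%g.
Proof. by rewrite /gen_word !cl_cat cl_inv (cl_cat [:: _] [:: _]) !mulgA. Qed.

Lemma sg_gen i j : j = i.+1 :> nat ->
  (sg i * cl (gen_word i) = cl (gen_word j) * sg i)%g.
Proof.
move=> ji; have br := sg_braid ji.
have cT : (cl (tau k j.+1) * sg i = sg i * cl (tau k j.+1))%g.
  by apply: tau_below; rewrite ji ltnSn -ji ltn_ord.
rewrite !cl_gen -ji cl_tau invgM.
move: (cl (tau k j.+1)) (sg i) (sg j) br cT => T x y br cT.
have cT' : (T^-1 * x = x * T^-1)%g.
  by apply: (mulgI T); rewrite mulVKg mulgA cT mulgK.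
rewrite -!mulgA cT' !mulgA -cT -!mulgA; congr (T * _)%g; rewrite !mulgA.
congr (_ * _)%g; apply: (mulIg y); rewrite mulgVK.
by rewrite br -!mulgA; congr (_ * _)%g; rewrite !mulgA br.
Qed.

Lemma sg_gen_next i j : j = i.+1 :> nat ->
  (cl (gen_word j) * (sg i * cl (gen_word j)) =
   cl (gen_word i) * cl (gen_word j) * sg i)%g.
Proof.
move=> ji; have br := sg_braid ji.
have cT : (cl (tau k j.+1) * sg i = sg i * cl (tau k j.+1))%g.
  by apply: tau_below; rewrite ji ltnSn -ji ltn_ord.
rewrite !cl_gen -ji cl_tau invgM.
move: (cl (tau k j.+1)) (sg i) (sg j) br cT => T x y br cT.
have cT' : (T^-1 * x = x * T^-1)%g.
  by apply: (mulgI T); rewrite mulVKg mulgA cT mulgK.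
have -> : (T * (y * y) * T^-1 * (x * (T * (y * y) * T^-1)) =
    T * (y * y * x * y * y) * T^-1)%g.
  rewrite -!mulgA; do 3!congr (_ * _)%g.
  by rewrite (mulgA x T) -cT -(mulgA T x) mulKg.
have -> : (T * y * (x * x) * (y^-1 * T^-1) * (T * (y * y) * T^-1) * x =
    T * (y * x * x * y * x) * T^-1)%g.
  by rewrite -!mulgA mulKg mulKg cT'.
congr (_ * _ * _)%g; rewrite -!mulgA; congr (_ * _)%g; rewrite !mulgA.
by rewrite -br -!mulgA; congr (_ * _)%g; rewrite !mulgA br.
Qed.

(** The generated subgroup is normalized by the braids on the first k - 1
    strands: with A_i the generator [gen_word i], the crossing sigma_i sends A_i
    to A_(i+1), and A_(i+1) to the conjugate of A_i by A_(i+1); it fixes the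
    others. *)
Lemma generated_conj i b x : (i.+1 < k.-1)%N -> generated x ->
  exists2 y, generated y & (cl [:: (i, b)] * x = y * cl [:: (i, b)])%g.
Proof.
move=> ik; pose P x := exists2 y, generated y &
  (cl [:: (i, b)] * x = y * cl [:: (i, b)])%g.
have PM y z : P y -> P z -> P (y * z)%g.
  move=> [y' gy' ey] [z' gz' ez]; exists (y' * z')%g; first exact: generatedM.
  by rewrite mulgA ey -mulgA ez mulgA.
have PV y : P y -> P y^-1%g.
  move=> [y' gy' ey]; exists y'^-1%g; first exact: generatedV.
  exact: commute_inv.
suff Pg s : P (cl (gen_word s)).
  case=> l ->; elim: l => [|[s c] l IH] /=.
    by exists 1%g; [exact: generated1|rewrite mul1g mulg1].
  by apply: PM => //; case: c => //; apply: PV.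
pose j := Ordinal ik; have ji : j = i.+1 :> nat by [].
have gi := generated_gen i; have gj := generated_gen j.
have Hi := sg_gen ji; have Hj := sg_gen_next ji.
(* Away from i and i.+1, the crossing commutes with the generator. *)
have far : (cl [:: (i, true)] * cl (gen_word s) =
    cl (gen_word s) * cl [:: (i, true)])%g -> P (cl (gen_word s)).
  move=> H; exists (cl (gen_word s)); first exact: generated_gen.
  rewrite (cl_letter i b); case: b {P PM PV} => //; exact/esym/commute_inv.
have [si|si|/val_inj si] := ltngtP s i.
- apply: far; rewrite cl_gen.
  have H1 : (cl (tau k s.+1) * sg j = sg i * cl (tau k s.+1))%g.
    exact: tau_above.
  have H2 : (sg j * sg s = sg s * sg j)%g by rewrite [RHS]sg_far.
  have H3 : ((cl (tau k s.+1))^-1 * sg i = sg j * (cl (tau k s.+1))^-1)%g.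
    by apply: (mulgI (cl (tau k s.+1))); rewrite mulVKg mulgA H1 mulgK.
  rewrite !mulgA -H1 -!mulgA H3; congr (_ * _)%g.
  by rewrite !mulgA H2; congr (_ * _)%g; rewrite -!mulgA H2.
- have [sj|sj] := eqVneq (s : nat) i.+1.
    have {sj far} -> : s = j by apply: val_inj.
    rewrite /P (cl_letter i b); case: b {P PM PV}.
      exists ((cl (gen_word j))^-1 * cl (gen_word i) * cl (gen_word j))%g.
        by apply: generatedM => //; apply: generatedM => //; apply: generatedV.
      by apply: (mulgI (cl (gen_word j))); rewrite Hj -!mulgA mulVKg.
    exists (cl (gen_word i)) => //.
    by apply: (mulgI (sg i)); rewrite mulVKg mulgA Hi mulgK.
  apply: far; rewrite cl_gen.
  have H1 : (cl (tau k s.+1) * sg i = sg i * cl (tau k s.+1))%g.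
    by apply: tau_below; have := ltn_ord s; lia.
  have H2 : (sg i * sg s = sg s * sg i)%g by apply: sg_far; lia.
  have H3 : ((cl (tau k s.+1))^-1 * sg i = sg i * (cl (tau k s.+1))^-1)%g.
    by apply: (mulgI (cl (tau k s.+1))); rewrite mulVKg mulgA H1 mulgK.
  rewrite !mulgA -H1 -!mulgA H3; congr (_ * _)%g.
  by rewrite !mulgA H2; congr (_ * _)%g; rewrite -!mulgA H2.
rewrite si /P (cl_letter i b); case: b {P PM PV far}.
  by exists (cl (gen_word j)).
exists (cl (gen_word i) * cl (gen_word j) * (cl (gen_word i))^-1)%g.
  by apply: generatedM; [apply: generatedM|apply: generatedV].
have Hi' : ((cl (gen_word i))^-1 * (sg i)^-1 =
    (sg i)^-1 * (cl (gen_word j))^-1)%g by rewrite -!invgM Hi.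
apply: (mulgI (sg i)); rewrite mulVKg -!mulgA Hi' !mulgA Hi.
by rewrite -(mulgA (cl (gen_word j))) Hj !mulgK.
Qed.

Lemma generated_conj_word u x : avoids_last u -> generated x ->
  exists2 y, generated y & (cl u * x = y * cl u)%g.
Proof.
elim: u x => [|[i b] u IH] x /=.
  by move=> _ gx; exists x => //; rewrite mulg1 mul1g.
move=> /andP [ik su] gx; have [y gy uy] := IH _ su gx.
have [z gz iz] := generated_conj b ik gy.
by exists z => //; rewrite -cat1s cl_cat -mulgA uy mulgA iz mulgA.
Qed.

(** The braids [tau q] represent the cosets of the subgroup of the braids that
    fix the last position. A crossing permutes these cosets up to an element of
    this subgroup, which is a generator or a crossing of the other strands. *)
Lemma coset_form w : exists f u q,
  [/\ generated f, avoids_last u, (q <= k.-1)%N &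
      cl w = (f * cl u * cl (tau k q))%g].
Proof.
elim/last_ind: w => [|w [i b] [f [u [q [gf su qk wE]]]]].
  exists 1%g, [::], k.-1; split=> //; first exact: generated1.
  by rewrite tau_last !mul1g.
have -> : cl (rcons w (i, b)) =
    (f * cl u * (cl (tau k q) * cl [:: (i, b)]))%g.
  by rewrite -cats1 cl_cat wE mulgA.
(* By normality, a generator that appears after [u] moves to its left. *)
have absorb x q' : generated x -> (q' <= k.-1)%N ->
    (cl (tau k q) * cl [:: (i, b)] = x * cl (tau k q'))%g ->
    exists f' u' q', [/\ generated f', avoids_last u', (q' <= k.-1)%N &
      (f * cl u * (cl (tau k q) * cl [:: (i, b)]) =
       f' * cl u' * cl (tau k q'))%g].
  move=> gx qk' ->; have [y gy uy] := generated_conj_word su gx.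
  exists (f * y)%g, u, q'; split=> //; first exact: generatedM.
  by rewrite !mulgA -(mulgA f) uy mulgA.
have slide j : (j.+1 < k.-1)%N ->
    (cl (tau k q) * cl [:: (i, b)] = cl [:: (j, b)] * cl (tau k q))%g ->
    exists f' u' q', [/\ generated f', avoids_last u', (q' <= k.-1)%N &
      (f * cl u * (cl (tau k q) * cl [:: (i, b)]) =
       f' * cl u' * cl (tau k q'))%g].
  move=> jk ->; exists f, (rcons u (j, b)), q; split=> //.
    by rewrite /avoids_last all_rcons /= jk.
  by rewrite -cats1 cl_cat !mulgA.
have [iq|qi] := ltnP i.+1 q.
  apply: (slide i); first exact: leq_trans qk.
  by apply: tau_below_letter; rewrite iq.
have [qi'|] := ltnP q i.
  have i1 : (i.-1 < k.-1)%N by have := ltn_ord i; lia.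
  have ii : i = (Ordinal i1).+1 :> nat by rewrite /= prednK //; lia.
  apply: (slide (Ordinal i1)); first by rewrite -ii.
  by apply: tau_above_letter; rewrite //=; lia.
rewrite leq_eqVlt => /orP [/eqP iq|iq].
  case: b absorb {slide} => absorb.
    apply: (absorb (cl (gen_word i)) i.+1) => //; first exact: generated_gen.
    by rewrite -iq cl_gen cl_tau -!mulgA mulVg mulg1.
  apply: (absorb 1%g i.+1) => //; first exact: generated1.
  by rewrite -iq cl_tau (cl_letter i false) mulgK mul1g.
have {qi iq} qE : q = i.+1 by lia.
case: b absorb {slide} => absorb.
  apply: (absorb 1%g i); [exact: generated1|exact: ltnW|].
  by rewrite mul1g cl_tau qE.
apply: (absorb (cl (gen_word i))^-1%g i); last 1 first.
- rewrite qE cl_gen cl_tau (cl_letter i false) !invgM invgK -!mulgA.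
  by rewrite mulKg mulVg mulg1.
- exact/generatedV/generated_gen.
- exact: ltnW.
Qed.

Lemma foldl_swap_dperm w (x : 'I_k) :
  foldl (fun q (i : 'I_k.-1) => swap_pos i q) x (map fst w) = dperm w x.
Proof.
elim: w x => [|[i b] w IH] x /=; first by rewrite perm1.
rewrite permM -IH; congr foldl.
by rewrite crossing_perm_val /swap_pos.
Qed.

(** A pure braid is in the coset of [tau k.-1], which is 1. *)
Lemma comb (p : pure k) : exists l u,
  [/\ avoids_last u, dperm u = 1%g & p = (evalg (@gen k) l * pure_class u)%g].
Proof.
have [_ [u [q [[l ->] su qk pE]]]] := coset_form (repr (val p)).
rewrite reprK in pE.
have genE : (fun s => cl (gen_word s)) = val \o @gen k.
  by apply: funext => s; rewrite /= val_pure_class // dperm_gen_word.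
have evE : evalg (fun s => cl (gen_word s)) l = val (evalg (@gen k) l).
  by rewrite genE (evalg_morph _ _ (fun x y => valM x y)).
rewrite evE in pE.
have pureP (x : pure k) : braid_perm (val x) = 1%g by apply/eqP;
  apply: (valP x).
have utE : (dperm u * dperm (tau k q))%g = 1%g.
  have := congr1 (@braid_perm k) pE.
  by rewrite !braid_permM !pureP mul1g !braid_perm_pi.
have qE : q = k.-1.
  have [k0|k0] := posnP k.-1; first by move: qk; rewrite k0 leqn0 => /eqP.
  have kk : (k.-1 < k)%N by lia.
  have := congr1 (fun s : 'S_k => s (Ordinal kk) : nat) utE.
  rewrite permM perm1 /=.
  have -> : dperm u (Ordinal kk) = Ordinal kk.
    apply: val_inj; rewrite /= -foldl_swap_dperm.
    have [+ _] := @run_below_mark _ _ (base_state k) u su.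
    by rewrite mark_run.
  rewrite -foldl_swap_dperm.
  have := congr1 (@mark _) (run_tau qk).
  by rewrite mark_run /= => ->.
have u1 : dperm u = 1%g by move: utE; rewrite qE tau_last mulg1.
exists l, u; split=> //; apply: val_inj.
by rewrite pE qE tau_last mulg1 valM val_pure_class.
Qed.

End Combing.
(** * Taylor expansion along the generators *)

Lemma sum_tupleS (V : nmodType) (T : finType) m (F : m.+1.-tuple T -> V) :
  \sum_(w : m.+1.-tuple T) F w =
  \sum_(s : T) \sum_(w : m.-tuple T) F [tuple of s :: w].
Proof.
rewrite pair_big /=.
rewrite (reindex (fun p : T * m.-tuple T => [tuple of p.1 :: p.2])) //=.
exists (fun w : m.+1.-tuple T => (thead w, [tuple of behead w]))
  => [[s w]|w] _ /=.
  by rewrite theadE; congr (_, _); apply: val_inj.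
by rewrite [RHS]tuple_eta; apply: val_inj.
Qed.

Lemma sum_tuple0 (V : nmodType) (T : finType) (F : 0.-tuple T -> V) :
  \sum_(w : 0.-tuple T) F w = F [tuple].
Proof.
rewrite (big_pred1 [tuple]) // => w.
exact/esym/eqP/tuple0.
Qed.

Section Difference.
Variable k : nat.
Implicit Types (s : 'I_k.-1) (v : invariant k) (y : pure k)
  (g h : series 'I_k.-1).

Definition diff s v : invariant k := fun y => v (gen s * y)%g - v y.

Definition diffs (w : seq 'I_k.-1) v : invariant k :=
  foldl (fun v s => diff s v) v w.

Lemma diffD s (f g : invariant k) : diff s (f + g) = diff s f + diff s g.
Proof. by apply: funext => y; rewrite /diff opprD addrACA. Qed.

Lemma diffs0 w : diffs w 0 = 0.
Proof.
have d0 s : diff s 0 = 0 by apply: funext => y; rewrite /diff subrr.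
by elim: w => [//|s w IH] /=; rewrite d0.
Qed.

Lemma diffsD w (f g : invariant k) : diffs w (f + g) = diffs w f + diffs w g.
Proof. by elim: w f g => [//|s w IH] f g /=; rewrite diffD IH. Qed.

Lemma diffM s (f g : invariant k) :
  diff s (f * g) = diff s f * g + f * diff s g + diff s f * diff s g.
Proof.
apply: funext => y; rewrite /diff.
rewrite -[RHS]/((f (gen s * y)%g - f y) * g y + f y * (g (gen s * y)%g - g y) +
  (f (gen s * y)%g - f y) * (g (gen s * y)%g - g y) : rat).
rewrite -[LHS]/(f (gen s * y)%g * g (gen s * y)%g - f y * g y : rat).
by ring.
Qed.

Lemma lin_ext_pos (F : word k -> rat) (w : word k) (t : sword k) :
  lin_ext F ([seq (c.1, Some c.2) | c <- w] ++ t) =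
  lin_ext (fun x => F (w ++ x)) t.
Proof. by elim: w F => [//|[i b] w IH] F /=; rewrite lin_ext_some IH. Qed.

Lemma dperm_map (O O' : Type) (h : O -> O') (d : diagram O k) :
  dperm [seq (c.1, h c.2) | c <- d] = dperm d.
Proof. by elim: d => [//|[i o] d IH] /=; rewrite IH. Qed.

(** [gen s - 1] as a singular braid: one of the two crossings of [gen s] is
    turned into a double point. *)
Definition sgen s : sword k :=
  [seq (c.1, Some c.2) | c <- tau k s.+1] ++
  [:: (s, Some true); (s, None)] ++
  [seq (c.1, Some c.2) | c <- word_inv (tau k s.+1)].

Lemma dperm_sgen s : dperm (sgen s) = 1%g.
Proof.
rewrite /sgen !dperm_cat !dperm_map dperm_inv /= mulg1.
by rewrite /crossing_perm tperm2 mul1g mulgV.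
Qed.

Lemma double_points_sgen s : double_points (sgen s) = 1%N.
Proof.
have D0 (w : word k) : count (fun c : 'I_k.-1 * option bool => c.2 == None)
    [seq (c.1, Some c.2) | c <- w] = 0%N by elim: w.
by rewrite /double_points /sgen !count_cat !D0.
Qed.

Lemma lin_ext_diff s v (t : sword k) : dperm t = 1%g ->
  lin_ext (fun w => diff s v (pure_class w)) t =
  lin_ext (fun w => v (pure_class w)) (sgen s ++ t).
Proof.
move=> t1; rewrite /sgen -!catA lin_ext_pos /= lin_ext_some lin_ext_none.
rewrite !lin_ext_pos -lin_ext_sub; apply: eq_lin_ext => // w w1.
rewrite /diff -pure_classM ?dperm_gen_word //; congr (v _ - v _).
  by rewrite /gen_word -!catA.
apply: pure_class_eq; apply: BraidSym.
apply: (@BraidTrans _ _ (tau k s.+1 ++ word_inv (tau k s.+1) ++ w)).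
  exact: (@BraidStep _ (tau k s.+1) _ _ _ (BraidCancel s true)).
rewrite catA -[X in braid_eq _ X]cat0s; apply: braid_eq_cat (word_mulV _) _.
exact: BraidRefl.
Qed.

(** A difference has one double point more. *)
Lemma diff_vanish n s v (t : sword k) : v \in finite_type n ->
  dperm t = 1%g -> (n <= double_points t)%N ->
  lin_ext (fun w => diff s v (pure_class w)) t = 0.
Proof.
move=> /asboolP Hv t1 nt; rewrite lin_ext_diff // Hv //.
  by rewrite dperm_cat dperm_sgen t1 mulg1.
by rewrite /double_points count_cat -!/(double_points _) double_points_sgen.
Qed.

Lemma diff_type n s v : v \in finite_type n.+1 -> diff s v \in finite_type n.
Proof. by move=> Hv; apply/asboolP => t t1 nt; apply: diff_vanish Hv _ _. Qed.

Lemma diff_type0 s v : v \in finite_type 0 -> diff s v = 0.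
Proof.
move=> Hv; apply: funext => y.
have := @diff_vanish 0 s v [seq (c.1, Some c.2) | c <- repr (val y)] Hv.
rewrite dperm_map dperm_pure -[X in lin_ext _ X]cats0 lin_ext_pos lin_ext_nil.
by rewrite cats0 pure_class_repr => ->.
Qed.

Lemma diffs_type n w v : v \in finite_type n -> (size w <= n)%N ->
  diffs w v \in finite_type (n - size w).
Proof.
elim: w n v => [|s w IH] n v Hv; first by rewrite subn0.
by case: n Hv => // n Hv /= wn; apply: IH => //; apply: diff_type.
Qed.

Lemma diffs_type0 n w v : v \in finite_type n -> (n < size w)%N ->
  diffs w v = 0.
Proof.
elim: w n v => [//|s w IH] [|n] v Hv /= wn.
  by rewrite diff_type0 // diffs0.
by apply: (IH n) => //; apply: diff_type.
Qed.

(** The Taylor polynomial of degree n at y, in the direction of a series. *)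
Definition taylor n (g : series 'I_k.-1) v y : rat :=
  \sum_(m < n.+1) \sum_(w : m.-tuple 'I_k.-1) g w * diffs w v y.

Lemma taylor0 g v y : taylor 0 g v y = g [::] * v y.
Proof. by rewrite /taylor big_ord1 sum_tuple0. Qed.

Lemma taylorS n g v y : taylor n.+1 g v y =
  g [::] * v y + \sum_s taylor n (sderiv s g) (diff s v) y.
Proof.
rewrite /taylor big_ord_recl sum_tuple0; congr (_ + _).
rewrite exchange_big; apply: eq_bigr => m _.
exact: sum_tupleS.
Qed.

Lemma taylor1 n v y : taylor n 1 v y = v y.
Proof.
case: n => [|n]; first by rewrite taylor0 mul1r.
rewrite taylorS mul1r big1 ?addr0 // => s _.
rewrite /taylor big1 // => m _; rewrite big1 // => w _.
by rewrite mul0r.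
Qed.

Lemma taylorD n g h v y :
  taylor n (g + h) v y = taylor n g v y + taylor n h v y.
Proof.
rewrite /taylor -big_split; apply: eq_bigr => m _ /=.
rewrite -big_split; apply: eq_bigr => w _ /=.
by rewrite -mulrDl.
Qed.

Lemma taylor_series0 n v y : taylor n 0 v y = 0.
Proof.
by rewrite /taylor big1 // => m _; rewrite big1 // => w _; rewrite mul0r.
Qed.

Lemma taylor_letter n s g v y :
  taylor n.+1 (letter s * g) v y = taylor n g (diff s v) y.
Proof.
rewrite taylorS letter_mul_nil mul0r add0r (bigD1 s) //= big1 ?addr0 => [|t ts].
  congr taylor; apply: funext => u.
  by rewrite /sderiv letter_mul_cons eqxx.
rewrite -[RHS](taylor_series0 n (diff t v) y); congr taylor; apply: funext => u.
by rewrite /sderiv letter_mul_cons (negPf ts).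
Qed.

(** Multiplication of the argument by [gen s] corresponds to multiplication of
    the series by [1 + letter s]. For the inverse of a generator, induction on
    the type applies to the difference, evaluated at the new argument. *)
Lemma taylor_evalg n v l y : v \in finite_type n ->
  v (evalg (@gen k) l * y)%g = taylor n (uval (evalg (@magnus _) l)) v y.
Proof.
elim: n v l y => [|n IHn] v l y Hv.
  rewrite taylor0; have D z s : v (gen s * z)%g = v z.
    by apply/eqP; rewrite -subr_eq0; rewrite -[_ - _]/(diff s v z) diff_type0.
  elim: l => [|[s b] l IH] /=; first by rewrite mul1g mul1r.
  rewrite uvalM seriesM_nil.
  have -> : uval (if b then magnus s else (magnus s)^-1)%g [::] = 1.
    by case: b.
  rewrite mul1r -IH -mulgA; case: b => //.
  by rewrite -[LHS](D _ s) mulVKg.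
have key s g : taylor n.+1 ((1 + letter s) * g) v y =
    taylor n.+1 g v y + taylor n g (diff s v) y.
  by rewrite mulrDl mul1r taylorD taylor_letter.
elim: l => [|[s b] l IH]; first by rewrite mul1g taylor1.
rewrite -[evalg (@gen k) _]/((if b then gen s else (gen s)^-1) *
  evalg (@gen k) l)%g -mulgA.
case: b; last first.
  set g := uval _; set z := ((gen s)^-1 * _)%g.
  have zE : v z = v (evalg (@gen k) l * y)%g - diff s v z.
    by rewrite /diff /z mulVKg opprB addrC subrK.
  rewrite zE IH /z mulgA (IHn (diff s v) ((s, false) :: l));
    last exact: diff_type.
  apply/eqP; rewrite subr_eq -key -/g; apply/eqP; congr taylor.
  by rewrite /g /= uvalM mulrA -[1 + letter s]/(uval (magnus s)) uvalV mul1r.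
rewrite -[uval (evalg _ _)]/((1 + letter s) * uval (evalg (@magnus _) l)).
rewrite key -IH -(IHn (diff s v) l); last exact: diff_type.
by rewrite /diff addrC subrK.
Qed.

End Difference.
(** * Forgetting strands *)

Section Inflate.
Variables (k l : nat) (lk : (l <= k)%N).

Fact inflate_le : (l.-1 <= k.-1)%N.
Proof. by move: lk; lia. Qed.

Definition inflate_word (O : Type) (d : diagram O l) : diagram O k :=
  [seq (widen_ord inflate_le c.1, c.2) | c <- d].

Lemma inflate_cat O (d d' : diagram O l) :
  inflate_word (d ++ d') = inflate_word d ++ inflate_word d'.
Proof. exact: map_cat. Qed.

Lemma inflate_eq (w u : word l) :
  braid_eq w u -> braid_eq (inflate_word w) (inflate_word u).
Proof.
elim=> {w u} [u v x y xy|u|u v _|u v w _ + _].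
- rewrite !inflate_cat; apply: BraidStep.
  by case: xy => [i b|i j ij|i j ij]; constructor.
- exact: BraidRefl.
- exact: BraidSym.
- exact: BraidTrans.
Qed.

Lemma dperm_inflate O (d : diagram O l) :
  dperm d = 1%g -> dperm (inflate_word d) = 1%g.
Proof.
move=> d1; apply/permP => x; rewrite perm1.
have [xl|lx] := ltnP x l.
  have H (y : 'I_l) : dperm (inflate_word d) (widen_ord lk y) =
      widen_ord lk (dperm d y).
    elim: d y {d1} => [|[i o] d IH] y /=; first by rewrite !perm1.
    rewrite !permM -IH; congr (dperm _ _); apply: val_inj.
    by rewrite /= !crossing_perm_val.
  have -> : x = widen_ord lk (Ordinal xl) by apply: val_inj.
  by rewrite H d1 perm1.
elim: d {d1} => [|[i o] d IH] /=; first by rewrite perm1.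
rewrite permM -[RHS]IH; congr (dperm _ _); apply: val_inj.
rewrite /= crossing_perm_val /=; have := ltn_ord i.
by do ![case: eqP => /=]; lia.
Qed.

(** Adding k - l trivial strands on the right. *)
Definition inflate (x : pure l) : pure k :=
  pure_class (inflate_word (repr (val x))).

Lemma inflate_pure_class (w : word l) : dperm w = 1%g ->
  inflate (pure_class w) = pure_class (inflate_word w).
Proof.
move=> w1; apply/pure_class_eq/inflate_eq.
by rewrite val_pure_class //; apply: braid_reprK.
Qed.

Lemma inflate1 : inflate 1%g = 1%g.
Proof.
have pc1 m : (1%g : pure m) = pure_class [::].
  by apply: val_inj; rewrite val_pure_class.
by rewrite pc1 inflate_pure_class // pc1.
Qed.

Lemma lin_ext_inflate (F : word k -> rat) (s : sword l) :
  lin_ext (fun w => F (inflate_word w)) s = lin_ext F (inflate_word s).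
Proof.
elim: s F => [|[i [b|]] s IH] F; first by rewrite !lin_ext_nil.
  by rewrite /= !lin_ext_some -IH.
by rewrite /= !lin_ext_none -!IH.
Qed.

Lemma inflate_type n (v : invariant k) :
  v \in finite_type n -> (v \o inflate : invariant l) \in finite_type n.
Proof.
move=> /asboolP Hv; apply/asboolP => s s1 sn.
rewrite (@eq_lin_ext _ _ (fun w => v (pure_class (inflate_word w)))) //;
  last first.
  by move=> w w1; rewrite /= inflate_pure_class.
rewrite (lin_ext_inflate (fun w => v (pure_class w))) Hv ?dperm_inflate //.
by rewrite /double_points count_map.
Qed.

End Inflate.

Section Forget.
Variables (k : nat) (S : {set 'I_k}).
Implicit Types (s : 'I_k.-1) (w u : word k).

Lemma forget1 : forget S 1%g = 1%g.
Proof. by apply: (mulgI (forget S 1%g)); rewrite -forgetM !mulg1. Qed.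

Lemma forget_evalg (phi : 'I_k.-1 -> pure k) l :
  forget S (evalg phi l) = evalg (forget S \o phi) l.
Proof. exact/evalg_morph/forgetM. Qed.

Lemma keep_inv l (T : {set 'I_k}) w :
  keep l (dperm w @: T) (word_inv w) = word_inv (keep l T w).
Proof.
elim: w T => [//|[i b] w IH] T.
have inv_cat m (x y : word m) : word_inv (x ++ y) = word_inv y ++ word_inv x.
  by rewrite /word_inv map_cat rev_cat.
rewrite -cat1s inv_cat !keep_cat inv_cat dperm_cat.
have -> : (dperm [:: (i, b)] * dperm w)%g @: T =
    dperm w @: (dperm [:: (i, b)] @: T).
  by rewrite -imset_comp; apply: eq_imset => x /=; rewrite permM.
rewrite IH; congr (_ ++ _).
have -> : dperm (word_inv w) @: (dperm w @: (dperm [:: (i, b)] @: T)) =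
    crossing_perm i @: T.
  rewrite -!imset_comp; apply: eq_imset => x /=.
  by rewrite dperm_inv permK mulg1.
rewrite -[word_inv [:: _]]/[:: (i, ~~ b)] !keep_cons /= !cats0 /keep1.
rewrite !mem_crossing /crossing_perm tpermL tpermR -/(crossing_perm i).
rewrite rank_crossing ?ltn_eqF // andbC; case: ifP => // _.
by case: insub.
Qed.

Lemma dperm_tau_lt q (x : 'I_k) : (x < q)%N -> dperm (tau k q) x = x.
Proof.
have [qk|kq] := leqP q k.-1; last first.
  by rewrite /tau; have -> : (k.-1 - q = 0)%N by [lia|]; rewrite /= perm1.
move: q qk; apply: tau_ind => [|i IH] xq; first by rewrite tau_last perm1.
rewrite tau_rcons -cats1 dperm_cat permM IH; last exact: ltnW.
apply: val_inj; rewrite /= mulg1 crossing_perm_val.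
by rewrite !ltn_eqF // ltnW.
Qed.

Lemma mem_dperm_tau_lt q (x : 'I_k) : (x < q)%N ->
  (x \in dperm (tau k q) @: S) = (x \in S).
Proof.
by move=> xq; rewrite -{1}(dperm_tau_lt xq) mem_imset //; apply: perm_inj.
Qed.

Lemma rank_tau s : rank (dperm (tau k s.+1) @: S) s = rank S s.
Proof.
apply: eq_card => x; rewrite !inE.
by case: ltnP => [xs|]; rewrite ?andbF // mem_dperm_tau_lt // ltnW.
Qed.

Variable last : 'I_k.
Hypothesis lastE : last = k.-1 :> nat.

Lemma dperm_tau_last q : (q <= k.-1)%N -> dperm (tau k q) last = q :> nat.
Proof.
move=> qk; rewrite -foldl_swap_dperm lastE.
by have := congr1 (@mark _) (run_tau qk); rewrite mark_run.
Qed.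

Lemma mem_dperm_tau_rpos s :
  (rpos s \in dperm (tau k s.+1) @: S) = (last \in S).
Proof.
have -> : rpos s = dperm (tau k s.+1) last.
  by apply: val_inj; rewrite /= dperm_tau_last.
by rewrite mem_imset //; apply: perm_inj.
Qed.

Hypothesis lastS : last \in S.

Lemma rank_last : rank S k.-1 = #|S|.-1.
Proof.
have k0 : (0 < k)%N := leq_ltn_trans (leq0n _) (ltn_ord last).
have := rankS S last; rewrite lastS lastE prednK // rank_full => ->.
by rewrite addn1.
Qed.

Lemma rank_lt s : (lpos s \in S) -> (rank S s < #|S|.-1)%N.
Proof.
move=> sS; have := rankS S (lpos s); rewrite sS addn1 /= => <-.
by rewrite -rank_last; apply: rank_lt_in.
Qed.

(** The crossings that survive are those with the strands of S on the way. *)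
Lemma keep_tau q : (q <= k.-1)%N -> keep #|S| S (tau k q) = tau #|S| (rank S q).
Proof.
move: q; apply: tau_ind => [|s IH];
  first by rewrite tau_last rank_last tau_last.
have := rankS S (lpos s); rewrite /= => rs.
rewrite tau_rcons -cats1 keep_cat IH keep_cons /= cats0 /keep1.
rewrite mem_dperm_tau_lt ?ltnSn // mem_dperm_tau_rpos lastS andbT rank_tau rs.
case: ifP => [sS|_]; last by rewrite addn0 cats0.
case: insubP => [r _ rE|]; last by rewrite rank_lt.
by rewrite addn1 -rE tau_rcons -cats1.
Qed.

Lemma forget_gen_in s (r : 'I_#|S|.-1) :
  lpos s \in S -> r = rank S s :> nat -> forget S (gen s) = gen r.
Proof.
move=> sS rE; rewrite /gen forget_pure_class ?dperm_gen_word //.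
congr pure_class; rewrite /gen_word !keep_cat.
rewrite (_ : dperm [:: (s, true); (s, true)] = 1%g); last first.
  by rewrite /= mulg1 /crossing_perm tperm2.
rewrite [X in keep _ X (word_inv _)](eq_imset _ (@perm1 _)) imset_id keep_inv.
rewrite keep_tau //; have rs := rankS S (lpos s); rewrite sS addn1 /= -rE in rs.
rewrite rs; congr (_ ++ (_ ++ _)); rewrite !keep_cons /= cats0 /keep1.
rewrite !mem_crossing /crossing_perm tpermL tpermR -/(crossing_perm s).
rewrite mem_dperm_tau_lt ?ltnSn // mem_dperm_tau_rpos sS lastS /=.
rewrite rank_crossing ?ltn_eqF // rank_tau -rE.
by case: insubP => [r' _ /val_inj ->|]; rewrite ?ltn_ord.
Qed.

End Forget.

Lemma forget_gen_out k (S : {set 'I_k}) (last : 'I_k) (s : 'I_k.-1) :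
  last = k.-1 :> nat -> ~~ ((lpos s \in S) && (last \in S)) ->
  forget S (gen s) = 1%g.
Proof.
move=> lE out; rewrite /gen forget_pure_class ?dperm_gen_word //.
have -> : (1%g : pure #|S|) = pure_class [::].
  by apply: val_inj; rewrite val_pure_class.
apply: pure_class_eq; rewrite /gen_word !keep_cat.
rewrite (_ : dperm [:: (s, true); (s, true)] = 1%g); last first.
  by rewrite /= mulg1 /crossing_perm tperm2.
rewrite [X in keep _ X (word_inv _)](eq_imset _ (@perm1 _)) imset_id keep_inv.
rewrite !keep_cons /= !cats0 /keep1.
rewrite !mem_crossing /crossing_perm tpermL tpermR -/(crossing_perm s).
rewrite mem_dperm_tau_lt ?ltnSn // (mem_dperm_tau_rpos _ lE).
by rewrite (negPf out) andbC (negPf out) /=; apply: word_mulV.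
Qed.
(** * The reduced space is spanned by Milnor invariants *)

Lemma evalg_trivial (J : Type) (G : groupType) (phi : J -> G) l :
  (forall j, phi j = 1%g) -> evalg phi l = 1%g.
Proof.
move=> phi1; elim: l => [//|[j b] l IH] /=; rewrite IH mulg1 phi1.
by rewrite invg1 if_same.
Qed.

Lemma card_set_ord k (S : {set 'I_k}) : (#|S| <= k)%N.
Proof. by have := max_card (mem S); rewrite card_ord. Qed.

Section Rest.
Variable k : nat.
Implicit Types (p : pure k) (v : invariant k).

Definition but_last : {set 'I_k} := [set x : 'I_k | (x < k.-1)%N].

Lemma rank_but_last m : (m <= k.-1)%N -> rank but_last m = m.
Proof.
elim: m => [|m IH] mk; first exact: rank0.
have mk' : (m < k)%N by move: mk; lia.
by rewrite (rankS _ (Ordinal mk')) IH ?inE /= ?mk ?addn1 // ltnW.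
Qed.

Lemma card_but_last : #|but_last| = k.-1.
Proof.
have [k0|k0] := posnP k.
  by have := card_set_ord but_last; lia.
have kk : (k.-1 < k)%N by lia.
have := rankS but_last (Ordinal kk);
  rewrite /= (@rank_but_last k.-1) ?prednK //.
by rewrite rank_full inE ltnn addn0.
Qed.

Lemma inflate_keep (u : word k) : avoids_last u ->
  inflate_word (card_set_ord but_last) (keep #|but_last| but_last u) = u.
Proof.
elim: u => [//|[i b] u IH] /= /andP [ik su].
have -> : crossing_perm i @: but_last = but_last.
  apply/setP => x; rewrite mem_crossing !inE crossing_perm_val.
  by do ![case: eqP => /=]; lia.
rewrite !inE /= ik (ltnW ik) /= rank_but_last ?(ltnW ik) 1?ltnW //.
case: insubP => [r _ rE|/negP []]; last by rewrite card_but_last; lia.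
by rewrite /= IH //; congr ((_, _) :: _); apply: val_inj.
Qed.

(** The retraction onto the braids on the first k - 1 strands. *)
Definition rest p : pure k :=
  inflate (card_set_ord but_last) (forget but_last p).

(** Forgetting the last strand kills the generators. *)
Lemma rest_comb l (u : word k) : avoids_last u -> dperm u = 1%g ->
  rest (evalg (@gen k) l * pure_class u)%g = pure_class u.
Proof.
move=> su u1; rewrite /rest forgetM forget_evalg evalg_trivial => [|s].
  rewrite mul1g forget_pure_class // inflate_pure_class ?keep_pure //.
  by rewrite inflate_keep.
have kk : (k.-1 < k)%N by have := ltn_ord s; lia.
by apply: (@forget_gen_out _ _ (Ordinal kk)); rewrite ?inE //= ltnn andbF.
Qed.

Lemma milnor_nil p : milnor [::] p = 1.
Proof.
have [l [u [su u1 ->]]] := comb p.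
rewrite /milnor longitude_evalg longitude_avoids_last // mulg1.
elim: l => [//|[s b] l IH] /=; rewrite uvalM seriesM_nil IH mulr1.
by case: b.
Qed.

(** Combing turns the Taylor expansion along the generators into one of any
    invariant on the whole group, with coefficients induced from the first
    k - 1 strands. *)
Lemma taylor_rest n v p : v \in finite_type n ->
  v p = \sum_(m < n.+1) \sum_(w : m.-tuple 'I_k.-1)
          milnor w p * diffs w v (rest p).
Proof.
move=> Hv; have [l [u [su u1 ->]]] := comb p.
rewrite (taylor_evalg _ _ Hv) rest_comb //; apply: eq_bigr => m _.
by apply: eq_bigr => w _;
  rewrite /milnor longitude_evalg longitude_avoids_last // mulg1.
Qed.

End Rest.

(** An invariant of type 0 does not see the generators, hence it does not see
    the last strand, and there is an induction on the number of strands. *)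
Lemma type0_constant k (v : invariant k) p : v \in finite_type 0 -> v p = v 1%g.
Proof.
elim/ltn_ind: k v p => k IH v p Hv.
have [k0|k0] := posnP k.
  suff -> : p = 1%g by [].
  have [[|[s b] l] [[|[s' b'] u] [_ _ ->]]] := comb p.
  - by rewrite mul1g; apply: val_inj; rewrite val_pure_class.
  - by have := ltn_ord s'; lia.
  - by have := ltn_ord s; lia.
  - by have := ltn_ord s; lia.
have Sk : (#|but_last k| < k)%N by rewrite card_but_last; move: k0; lia.
have H := IH _ Sk _ _ (inflate_type (card_set_ord (but_last k)) Hv).
rewrite (taylor_rest _ Hv) big_ord1 sum_tuple0 milnor_nil mul1r /=.
by rewrite -[LHS]/((v \o inflate _) _) H /= inflate1.
Qed.

Section Reduced.
Variables k n : nat.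

Definition red_class (v : Vspace k n) : reduced k n :=
  \pi_(reduced k n) (\pi_(indec k n) (\pi_(gr k n) v)).

Lemma red_class_linear : linear red_class.
Proof. by move=> a v w; rewrite /red_class !pi_lquot_linear. Qed.
HB.instance Definition _ :=
  GRing.isLinear.Build rat (Vspace k n) (reduced k n) _ red_class
    red_class_linear.

Lemma pi_lquot0 (V : lmodType rat) (S : submodClosed V) (x : V) :
  x \in S -> \pi_(lquot S) x = 0.
Proof.
move=> xS; have -> : (0 : lquot S) = \pi_(lquot S) 0.
  by apply: (addrI (\pi_(lquot S) 0)); rewrite addr0 -lquotD addr0.
by apply/lquotP; rewrite subr0.
Qed.

Lemma pi_lquot_0 (V : lmodType rat) (S : submodClosed V) : \pi_(lquot S) 0 = 0.
Proof. by apply: pi_lquot0; apply: rpred0. Qed.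

Lemma red_class_Vmul a b (e : (a + b)%N = n) (v : Vspace k a) (w : Vspace k b) :
  (0 < a)%N -> (0 < b)%N -> red_class (Vmul e v w) = 0.
Proof.
move=> a0 b0; rewrite /red_class -gr_mul_pi [\pi_(indec k n) _]pi_lquot0
  ?pi_lquot_0 //.
by apply: mem_spanned; exists a, b, e, (\pi v), (\pi w).
Qed.

Lemma red_class_Vpull (S : {set 'I_k}) (v : Vspace #|S| n) :
  (#|S| < k)%N -> red_class (Vpull v) = 0.
Proof.
move=> Sk; rewrite /red_class -gr_pull_pi -indec_pull_pi pi_lquot0 //.
by apply: mem_spanned; exists S, (\pi_(indec _ _) (\pi_(gr _ _) v)).
Qed.

Hypothesis k_gt0 : (0 < k)%N.

Definition Vmilnor m (w : m.-tuple 'I_k.-1) : Vspace k m :=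
  Sub (milnor w : invariant k)
      (eq_rect (size w) (fun m => milnor w \in finite_type m) (milnor_type w) m
               (size_tuple w)).

(** Only the terms of top degree survive: the other ones are decomposable or
    induced. *)
Lemma red_class_expand (v : Vspace k n) :
  red_class v =
  \sum_(w : n.-tuple 'I_k.-1) diffs w (val v) 1%g *: red_class (Vmilnor w).
Proof.
have vT : val v \in finite_type n := valP v.
pose S := but_last k; pose lS := card_set_ord S.
have Sk : (#|S| < k)%N by rewrite card_but_last ltn_predL.
have dT m (w : m.-tuple 'I_k.-1) : (m <= n)%N ->
    (diffs w (val v) \o inflate lS : invariant #|S|) \in finite_type (n - m).
  move=> mn; apply: inflate_type.
  by have := diffs_type (w := w) vT; rewrite size_tuple; apply.
pose c m (w : m.-tuple 'I_k.-1) (mn : (m <= n)%N) : Vspace k (n - m) :=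
  Vpull (Sub (diffs w (val v) \o inflate lS : invariant #|S|) (dT m w mn)
         : Vspace #|S| (n - m)).
have mnP (m : 'I_n.+1) : (m <= n)%N by rewrite -ltnS.
pose term (m : 'I_n.+1) (w : m.-tuple 'I_k.-1) : Vspace k n :=
  Vmul (subnKC (mnP m)) (Vmilnor w) (c m w (mnP m)).
have vE : v = \sum_(m < n.+1) \sum_(w : m.-tuple 'I_k.-1) term m w.
  apply: val_inj; apply: funext => p.
  rewrite (taylor_rest p vT) raddf_sum fct_sumE; apply: eq_bigr => m _.
  by rewrite raddf_sum fct_sumE; apply: eq_bigr => w _.
rewrite [in LHS]vE raddf_sum /= big_ord_recr /= big1 ?add0r => [|m _].
  rewrite raddf_sum; apply: eq_bigr => w _ /=.
  rewrite -linearZ /=; congr red_class; apply: val_inj; apply: funext => p.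
  have d0 : diffs w (val v) \in finite_type 0.
    have := diffs_type (w := w) vT; by rewrite size_tuple subnn; apply.
  rewrite -[LHS]/(milnor w p * diffs w (val v) (rest p)) (type0_constant _ d0).
  by rewrite -[RHS]/(diffs w (val v) 1%g * milnor w p) mulrC.
rewrite raddf_sum big1 // => w _ /=.
case: (posnP m) => [m0|m0]; last first.
  by apply: red_class_Vmul => //; rewrite subn_gt0; apply: (ltn_ord m).
have cT : (diffs w (val v) \o inflate lS : invariant #|S|) \in finite_type n.
  by apply: finite_typeW (dT _ w (mnP (widen_ord (leqnSn n) m)));
    rewrite leq_subr.
pose d : Vspace #|S| n :=
  Sub (diffs w (val v) \o inflate lS : invariant #|S|) cT.
rewrite -(red_class_Vpull d Sk); congr red_class.
apply: val_inj; apply: funext => p.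
have w0 : tval w = [::] by apply: size0nil; rewrite size_tuple.
by rewrite -[LHS]/(milnor w p * diffs w (val v) (rest p)) {1}w0 milnor_nil
  mul1r.
Qed.

End Reduced.
(** * Linear relations between the Milnor invariants *)

Section Shuffles.
Variable T : eqType.

(** The number of ways in which [w] is a shuffle of [u] and [v]. *)
Fixpoint shuffles (w u v : seq T) : nat :=
  if w is a :: w' then
    ((if u is b :: u' then (b == a) * shuffles w' u' v else 0) +
     (if v is b :: v' then (b == a) * shuffles w' u v' else 0))%N
  else nilp u && nilp v.

End Shuffles.

Section Relations.
Variable k : nat.
Implicit Types (s : 'I_k.-1) (u v w x : seq 'I_k.-1).

Lemma diff_milnor s u :
  diff s (milnor u) = if u is a :: u' then (a == s)%:R *: milnor u' else 0.
Proof.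
apply: funext => y; rewrite /diff /milnor longitude_gen uvalM.
rewrite -[uval (magnus s)]/(1 + letter s) mulrDl mul1r seriesDE addrC addKr.
case: u => [|a u]; first by rewrite letter_mul_nil.
rewrite letter_mul_cons; case: eqP => _.
  by rewrite scale1r.
by rewrite scale0r.
Qed.

Lemma diffs_milnor_lower u v w : (size u + size v < size w)%N ->
  diffs w (milnor u * milnor v) = 0.
Proof. by apply: diffs_type0; apply: finite_typeM; apply: milnor_type. Qed.

Lemma diffsZ a w (f : invariant k) : diffs w (a *: f) = a *: diffs w f.
Proof.
elim: w f => [//|s w IH] f /=; rewrite -IH; congr diffs.
by apply: funext => y; rewrite /diff -[RHS]/(a * (_ - _)) mulrBr.
Qed.

Lemma invariant_scaleAl a (f g : invariant k) : (a *: f) * g = a *: (f * g).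
Proof. by apply: funext => y; rewrite -[RHS]/(a * (f y * g y)) mulrA. Qed.

Lemma invariant_scaleAr a (f g : invariant k) : f * (a *: g) = a *: (f * g).
Proof. by rewrite mulrC invariant_scaleAl mulrC. Qed.

(** In top degree [diff s] is a derivation, so that [diffs w] distributes the
    letters of [w] over the two factors, in order. *)
Lemma diffs_shuffles u v w y : (size u + size v)%N = size w ->
  diffs w (milnor u * milnor v) y = (shuffles w u v)%:R.
Proof.
elim: w u v => [|s w IH] u v.
  case: u v => [|//] [|//] _ /=.
  by rewrite -[LHS]/(milnor [::] y * milnor [::] y) milnor_nil mulr1.
move=> uvw; rewrite [shuffles _ _ _]/= [diffs _ _]/= diffM !diff_milnor !diffsD.
rewrite -[LHS]/(diffs w (_ * milnor v) y + diffs w (milnor u * _) y +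
  diffs w (_ * _) y : rat).
have -> : diffs w ((if u is a :: u' then (a == s)%:R *: milnor u' else 0) *
    (if v is a :: v' then (a == s)%:R *: milnor v' else 0)) = 0.
  case: u v uvw => [|a u] [|b v] uvw; rewrite ?mul0r ?mulr0 ?diffs0 //.
  rewrite invariant_scaleAl invariant_scaleAr !diffsZ diffs_milnor_lower
    ?scaler0 //.
  by move: uvw => /=; lia.
rewrite addr0 natrD; congr (_ + _).
  case: u uvw => [|a u] uvw; first by rewrite mul0r diffs0.
  rewrite invariant_scaleAl diffsZ -[LHS]/(_ * diffs w _ y) IH ?natrM //.
  by case: uvw.
case: v uvw => [|b v] uvw; first by rewrite mulr0 diffs0.
rewrite invariant_scaleAr diffsZ -[LHS]/(_ * diffs w _ y) IH ?natrM //.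
by move: uvw; rewrite /= addnS => -[].
Qed.

(** The left-hand side expands a product of two Milnor invariants. *)
Lemma red_class_shuffles n u v : (0 < k)%N -> (size u + size v)%N = n ->
  u != [::] -> v != [::] ->
  \sum_(w : n.-tuple 'I_k.-1) (shuffles w u v)%:R *: red_class (Vmilnor w) = 0.
Proof.
move=> k0 e u0 v0; pose vu := Vmilnor (in_tuple u);
  pose vv := Vmilnor (in_tuple v).
have := @red_class_Vmul k n _ _ e vu vv; rewrite !lt0n !size_eq0 u0 v0.
move/(_ isT isT); rewrite (red_class_expand k0) => uv0; rewrite -[RHS]uv0.
apply: eq_bigr => w _; congr (_ *: _).
by rewrite -(diffs_shuffles 1%g) // size_tuple.
Qed.

End Relations.

Section Missing.
Variables (k : nat) (S : {set 'I_k}).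
Implicit Types (s : 'I_k.-1) (x : seq 'I_k.-1).
Lemma rank_inj s s' : lpos s \in S -> lpos s' \in S -> rank S s = rank S s' ->
  s = s'.
Proof.
move=> sS sS' ss'; apply: val_inj => /=.
have := rankS S (lpos s); have := rankS S (lpos s').
rewrite sS sS' /= ss' => r r'.
case: (ltngtP s s') => // lt; have := rank_lt_in S lt; lia.
Qed.

Variable last : 'I_k.
Hypothesis lastE : last = k.-1 :> nat.
Hypothesis lastS : last \in S.

Lemma diff_forget s (f : invariant #|S|) (r : 'I_#|S|.-1) :
  lpos s \in S -> r = rank S s :> nat ->
  diff s (f \o forget S : invariant k) = diff r f \o forget S.
Proof.
move=> sS rE; apply: funext => y.
by rewrite /diff /= forgetM (forget_gen_in lastE lastS sS rE).
Qed.

Lemma diff_forget0 s (f : invariant #|S|) :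
  lpos s \notin S -> diff s (f \o forget S : invariant k) = 0.
Proof.
move=> sS; apply: funext => y.
rewrite /diff /= forgetM (forget_gen_out lastE) ?mul1g ?subrr //.
by rewrite (negPf sS).
Qed.

(** Forgetting strands relabels the generators by their ranks and kills those of
    the forgotten strands, so a single word gives a nonzero value. *)
Lemma diffs_forget x (u : seq 'I_#|S|.-1) : size x = size u ->
  diffs x (milnor u \o forget S : invariant k) 1%g =
  (all (fun s => lpos s \in S) x &&
   (map (fun s : 'I_k.-1 => rank S s) x == map val u))%:R.
Proof.
elim: x u => [|s x IH] [|a u] //=; first by rewrite forget1 milnor_nil.
move=> [xu]; have [sS|sS] := boolP (lpos s \in S); last first.
  by rewrite (diff_forget0 _ sS) diffs0.
have rs := rank_lt lastE lastS sS.
rewrite (@diff_forget s _ (Ordinal rs)) // diff_milnor eqseq_cons.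
rewrite -val_eqE /= eq_sym; case: eqP => _ /=.
  by rewrite scale1r IH.
have -> : (0%:R *: milnor u \o forget S : invariant k) = 0.
  by apply: funext => y; rewrite scale0r.
by rewrite diffs0 andbF.
Qed.

End Missing.

(** If the strand t is forgotten, the expansion of the Milnor invariant of the
    relabelled word, pulled back, has [milnor w] as its only term. *)
Lemma red_class_missing k n (w : n.-tuple 'I_k.-1) t :
  t \notin w -> red_class (Vmilnor w) = 0.
Proof.
move=> tw; have k0 : (0 < k)%N by have := ltn_ord t; lia.
have kk : (k.-1 < k)%N by lia.
pose S := [set~ lpos t]; pose last := Ordinal kk.
have lastE : last = k.-1 :> nat by [].
have lastS : last \in S by rewrite !inE -val_eqE /= gtn_eqF.
have inS s : (lpos s \in S) = (s != t) by rewrite !inE -val_eqE.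
have Sk : (#|S| < k)%N.
  by have := cardsC [set lpos t]; rewrite cards1 card_ord -/S; lia.
pose u := pmap (insub : nat -> option 'I_#|S|.-1)
  (map (fun s : 'I_k.-1 => rank S s) w).
have uE : map val u = map (fun s : 'I_k.-1 => rank S s) w.
  rewrite (pmap_filter (insubK _)); apply/all_filterP; rewrite all_map.
  apply/allP => s sw /=; rewrite isSome_insub; apply: (rank_lt lastE lastS).
  by rewrite inS; apply: contraNneq tw => <-.
have su : size u = n.
  by have := congr1 size uE; rewrite !size_map size_tuple.
have su' : size u == n by apply/eqP.
have := red_class_Vpull (Vmilnor (Tuple su')) Sk.
have dE (x : n.-tuple 'I_k.-1) :
    diffs x (val (Vpull (Vmilnor (Tuple su')))) 1%g = (x == w)%:R.
  rewrite -[val _]/(milnor u \o forget S : invariant k).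
  rewrite (diffs_forget lastE lastS) ?size_tuple // uE;
    congr (nat_of_bool _)%:R.
  apply/andP/eqP => [[xS /eqP xw]|->].
    apply: val_inj => /=; apply: (eq_from_nth (x0 := t));
      rewrite ?size_tuple //.
    move=> i ix; have iw : (i < size w)%N by move: ix; rewrite !size_tuple.
    have ix' : (i < size x)%N by rewrite size_tuple.
    have := congr1 (fun s => nth 0%N s i) xw.
    rewrite !(nth_map t) //; apply: (rank_inj (S := S)).
      by apply: (allP xS); apply: mem_nth.
    by rewrite inS; apply: contraNneq tw => <-; apply: mem_nth.
  split=> //; apply/allP => s sw.
  by rewrite inS; apply: contraNneq tw => <-.
rewrite (red_class_expand k0) (bigD1 w) //= big1 => [|x xw].
  by rewrite addr0 dE eqxx scale1r.
by rewrite dE (negPf xw) scale0r.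
Qed.
(** * Lyndon words *)

Import DefaultSeqLexiOrder.

Section Lexicographic.
Variables (d : Order.disp_t) (T : orderType d).
Implicit Types (a b : T) (u v w x y s t : seq T).

Lemma lexi_consE a b u v :
  ((a :: u <= b :: v) = (a < b) || (a == b) && (u <= v))%O.
Proof. by rewrite Order.SeqLexiOrder.Exports.lexi_cons; case: (ltgtP a b). Qed.

Lemma lexi_cat2l s u v : (s ++ u <= s ++ v)%O = (u <= v)%O.
Proof. by elim: s => [//|a s IH]; rewrite !cat_cons lexi_consE ltxx eqxx. Qed.

Lemma ltxi_cat2l s u v : (s ++ u < s ++ v)%O = (u < v)%O.
Proof. by rewrite !ltNge lexi_cat2l. Qed.

(** In the second case the first difference decides, so that it also decides
    between extensions of the two words. *)
Lemma lexi_split u v : (u <= v)%O ->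
  (exists s, v = u ++ s) \/ (forall s t, (u ++ s < v ++ t)%O).
Proof.
elim: u v => [|a u IH] [|b v] //.
- by left; exists [::].
- by left; exists (b :: v).
rewrite lexi_consE => /orP [ab|/andP [/eqP -> /IH [[s ->]|uv]]].
- by right=> s t; rewrite ltNge lexi_consE ltNge (ltW ab) /= gt_eqF.
- by left; exists s.
- by right=> s t; rewrite (ltxi_cat2l [:: b]).
Qed.

Lemma ltxi_cat u v s t : size u = size v ->
  (u ++ s < v ++ t)%O = (u < v)%O || (u == v) && (s < t)%O.
Proof.
move=> uv; have [->|] := eqVneq u v; first by rewrite ltxi_cat2l ltxx.
have case1 (x y s' t' : seq T) : size x = size y -> (x < y)%O ->
    (x ++ s' < y ++ t')%O.
  move=> xy lt; have [[r yE]|//] := lexi_split (ltW lt).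
  move: xy lt; rewrite yE size_cat => /eqP; rewrite -{1}[size x]addn0 eqn_add2l.
  by rewrite eq_sym size_eq0 => /eqP ->; rewrite cats0 ltxx.
rewrite neq_lt orbF => /orP [lt|lt]; first by rewrite lt case1.
by rewrite !ltNge (ltW lt) (ltW (case1 _ _ _ _ (esym uv) lt)).
Qed.

End Lexicographic.

Section ShuffleOrder.
Variables (d : Order.disp_t) (T : orderType d).
Implicit Types (u v w x y : seq T).

Lemma shuffles_cat u v : shuffles (u ++ v) u v != 0%N.
Proof.
elim: u => [|a u IH] /=; last by rewrite eqxx mul1n addn_eq0 negb_and IH.
elim: v => [//|b v IH] /=; by rewrite eqxx mul1n.
Qed.

Lemma shuffles_nil x v : shuffles x [::] v != 0%N -> x = v.
Proof.
elim: x v => [|a x IH] [|b v] //=; rewrite add0n muln_eq0 negb_or eqb0 negbK.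
by case/andP => /eqP -> /IH ->.
Qed.

(** The greedy rule for the largest shuffle: letters of the smaller word can
    be taken later. *)
Lemma shuffles_delay p u v x : (v <= u)%O -> shuffles x (p ++ u) v != 0%N ->
  exists2 y, shuffles y u (p ++ v) != 0%N & (x <= y)%O.
Proof.
elim: x p u v => [|c x IH] p u v vu.
  case: p u v vu => [|a p] [|b u] [|b' v] //= _ _.
  by exists [::].
case: p => [|a p] sh; first by exists (c :: x).
move: sh; rewrite /= addn_eq0 negb_and => /orP [].
  rewrite muln_eq0 negb_or eqb0 negbK => /andP [/eqP -> sh].
  have [y ys xy] := IH p u v vu sh; exists (c :: y).
    by rewrite /= eqxx mul1n addn_eq0 negb_and ys orbT.
  by rewrite lexi_consE eqxx xy orbT.
case: v vu => [//|b' v] vu.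
rewrite muln_eq0 negb_or eqb0 negbK => /andP [/eqP bc sh].
case: u vu sh => [//|b u];
  rewrite bc lexi_consE => /orP [cb|/andP [/eqP <- vu]] sh.
  exists ((b :: u) ++ (a :: p ++ c :: v)); first exact: shuffles_cat.
  by rewrite lexi_consE cb.
rewrite -[a :: p ++ _]/((a :: p) ++ (c :: u)) -cat_rcons in sh.
have [y ys xy] := IH _ _ _ vu sh; exists (c :: y).
  by rewrite -[_ :: _ ++ _]/((a :: p) ++ (c :: v)) -cat_rcons /= eqxx mul1n
    addn_eq0 negb_and ys.
by rewrite lexi_consE eqxx xy orbT.
Qed.

(** A largest shuffle starts with the larger of the two words; the hypothesis
    says that this is what remains of [u], until it is exhausted. *)
Lemma shuffles_max u v x :
  (forall u1 u2, u = u1 ++ u2 -> u2 != [::] -> (v <= u2)%O) ->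
  shuffles x u v != 0%N -> (x <= u ++ v)%O.
Proof.
elim: u x => [|a u IH] x suf; first by move=> /shuffles_nil ->.
have {}IH y : shuffles y u v != 0%N -> (y <= u ++ v)%O.
  by apply: IH => u1 u2 uE; apply: (suf (a :: u1)); rewrite uE.
case: x => [//|c x] /=; rewrite addn_eq0 negb_and => /orP [].
  rewrite muln_eq0 negb_or eqb0 negbK => /andP [/eqP -> /IH xy].
  by rewrite lexi_consE eqxx xy orbT.
have := suf [::] (a :: u) erefl isT.
case: v IH {suf} => [//|b v] IH; rewrite lexi_consE muln_eq0 negb_or eqb0 negbK.
move=> /orP [ba|/andP [/eqP ba vu]] /andP [/eqP bc sh].
  by rewrite lexi_consE -bc ba.
have [y ys xy] := @shuffles_delay [:: a] u v x vu sh.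
rewrite lexi_consE -bc ba eqxx (le_trans xy) ?orbT //.
by rewrite -ba; apply: IH; rewrite ba.
Qed.

End ShuffleOrder.

Section Lyndon.
Variables (d : Order.disp_t) (T : orderType d).
Implicit Types (u v w x y : seq T).

Definition lyndon w : bool :=
  (w != [::]) && all (fun i => (w < drop i w)%O) (iota 1 (size w).-1).

Lemma lyndonP w : reflect
  (w != [::] /\ forall u v, w = u ++ v -> u != [::] -> v != [::] -> (w < v)%O)
  (lyndon w).
Proof.
apply: (iffP andP) => -[w0 H]; split=> //.
  move=> u v wE u0 v0.
  have iw : size u \in iota 1 (size w).-1.
    rewrite mem_iota wE size_cat.
    by case: (u) (v) u0 v0 => [//|a u'] [//|b v'] _ _ /=; lia.
  by have := allP H _ iw; rewrite {2}wE drop_size_cat.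
apply/allP => i; rewrite mem_iota => iw.
apply: (H (take i w)); first by rewrite cat_take_drop.
  by rewrite -size_eq0 size_takel; case: (w) iw => [|a w'] /=; lia.
by rewrite -size_eq0 size_drop; case: (w) iw => [|a w'] /=; lia.
Qed.

Lemma min_suffix w : w != [::] -> exists u v,
  [/\ w = u ++ v, v != [::] &
      forall u' v', w = u' ++ v' -> v' != [::] -> (v <= v')%O].
Proof.
elim: w => [//|a w IH] _; have [->|w0] := eqVneq w [::].
  exists [::], [:: a]; split=> // -[|b [|c u']] v' //=.
    by move=> <-.
  by case=> _ <-.
have [u [v [wE v0 H]]] := IH w0.
have [aw|va] := leP (a :: w) v; [exists [::], (a :: w)|exists (a :: u), v].
  split=> // -[|b u'] v' /=; first by move=> <-.
  by case=> _ /H H' /H'; apply: le_trans.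
split=> //; first by rewrite wE.
by case=> [|b u'] v' /=; [move=> <- _; apply: ltW|case=> _; apply: H].
Qed.

Lemma cat_neq u v : u != [::] -> u ++ v != v.
Proof.
move=> u0; apply/eqP => /(congr1 size) /eqP.
by rewrite size_cat -{2}[size v]add0n eqn_add2r size_eq0 (negPf u0).
Qed.

(** Take for [v] the smallest suffix of [w]: it is at most every suffix of [u],
    since otherwise such a suffix, followed by [v], would be smaller. *)
Lemma nonlyndon_shuffle w : w != [::] -> ~~ lyndon w -> exists u v,
  [/\ w = u ++ v, u != [::], v != [::], shuffles w u v != 0%N &
      forall x, shuffles x u v != 0%N -> (x <= w)%O].
Proof.
move=> w0 nl; have [u [v [wE v0 H]]] := min_suffix w0.
have u0 : u != [::].
  apply: contraNneq nl => uE; apply/lyndonP; split=> // u' v' wE' u'0 v'0.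
  rewrite uE /= in wE; rewrite lt_neqAle wE (H u' v' wE' v'0) andbT -wE wE'.
  exact: cat_neq.
exists u, v; split=> //; first by rewrite wE shuffles_cat.
move=> x; rewrite wE; apply: shuffles_max => u1 u2 uE u20.
rewrite leNgt; apply/negP => u2v.
have v2 : (v <= u2 ++ v)%O.
  by apply: (H u1); [rewrite wE uE catA|case: (u2) u20].
have [[s vE]|/(_ v [::])] := lexi_split (ltW u2v); last first.
  by rewrite cats0 ltNge v2.
have s0 : s != [::] by apply: contraTneq u2v => s0; rewrite vE s0 cats0 ltxx.
have vs : (v <= s)%O by apply: (H (u ++ u2)); rewrite // wE vE catA.
move: v2; rewrite {1}vE lexi_cat2l => sv.
have/eqP := cat_neq s u20; apply; rewrite -vE.
by apply: le_anti; rewrite vs sv.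
Qed.

(** The right factor is the smallest proper suffix. *)
Lemma lyndon_factor w : lyndon w -> (1 < size w)%N -> exists u v,
  [/\ w = u ++ v, lyndon u & lyndon v].
Proof.
case/lyndonP => _ L; case: w L => [//|a w] L w1.
have w0 : w != [::] by rewrite -size_eq0 -lt0n.
have [u [v [wE v0 H]]] := min_suffix w0.
exists (a :: u), v; split; first by rewrite wE.
  apply/lyndonP; split=> // u1 u2 uE u10 u20.
  rewrite ltNge; apply/negP => u2u.
  have lt2 : (a :: w < u2 ++ v)%O.
    apply: (L u1) => //; first by rewrite wE -cat_cons uE catA.
    by case: (u2) u20.
  have [[s sE]|/(_ v v)] := lexi_split u2u; last first.
    by rewrite cat_cons -wE ltNge (ltW lt2).
  move: lt2; rewrite wE -cat_cons sE -catA ltxi_cat2l ltNge.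
  case/negP; case: u2 u20 sE {u2u uE} => [//|b u2] _ [_ sE].
  apply: (H u2); first by rewrite wE sE catA.
  by case: (s).
apply/lyndonP; split=> // v1 v2 vE v10 v20.
rewrite lt_neqAle; apply/andP; split; first by rewrite vE cat_neq.
by apply: (H (u ++ v1)); rewrite // wE vE catA.
Qed.

Lemma lyndon_lt_rot u v : u != [::] -> v != [::] -> lyndon (u ++ v) ->
  (u ++ v < v ++ u)%O.
Proof.
move=> u0 v0 /lyndonP [_ /(_ u v erefl u0 v0) lt].
have [[s vE]|/(_ [::] u)] := lexi_split (ltW lt); last by rewrite cats0.
have /(congr1 size) := vE; rewrite !size_cat.
by case: (u) u0 => [//|a u'] _ /=; lia.
Qed.

End Lyndon.
(** * Commutators attached to Lyndon words *)

Section Order.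
Variable T : eqType.
Implicit Types (f g h : series T) (x : seq T).

Definition order_ge n f : Prop := forall x, (size x < n)%N -> f x = 0.

Lemma seriesM_lead n m f g x : order_ge n f -> order_ge m g ->
  size x = (n + m)%N -> (f * g) x = f (take n x) * g (drop n x).
Proof.
move=> fn gm xnm; have nx : (n < (size x).+1)%N by lia.
rewrite seriesM (bigD1 (Ordinal nx)) //= big1 ?addr0 // => i.
rewrite -val_eqE /= neq_ltn => /orP [ni|ni].
  by rewrite fn ?mul0r // size_takel // -ltnS.
by rewrite gm ?mulr0 // size_drop; have := ltn_ord i; lia.
Qed.

Lemma order_geM n m f g : order_ge n f -> order_ge m g ->
  order_ge (n + m) (f * g).
Proof.
move=> fn gm x xnm; rewrite seriesM big1 // => i _.
have ix : (i <= size x)%N by rewrite -ltnS.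
have [ni|ni] := ltnP i n; first by rewrite fn ?mul0r // size_takel.
by rewrite gm ?mulr0 // size_drop; lia.
Qed.

Lemma order_geB n f g : order_ge n f -> order_ge n g -> order_ge n (f - g).
Proof. by move=> fn gn x xn; rewrite seriesBE fn // gn // subrr. Qed.

Lemma order_ge0 f : order_ge 0 f. Proof. by []. Qed.

End Order.

Section ListCommutator.
Variables (J : Type) (G : groupType) (phi : J -> G).
Implicit Types l : seq (J * bool).

Definition comml l l' := invl l ++ invl l' ++ l ++ l'.

Lemma evalg_comml l l' : evalg phi (comml l l') =
  ((evalg phi l)^-1 * (evalg phi l')^-1 * evalg phi l * evalg phi l')%g.
Proof. by rewrite !evalg_cat !evalg_inv !mulgA. Qed.

End ListCommutator.

Section Commutator.
Variables (d : Order.disp_t) (T : orderType d).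
Implicit Types (w x y : seq T) (l : seq (T * bool)).

Definition magnus_series l : series T := uval (evalg (@magnus T) l).

Lemma magnus_series_nil l : magnus_series l [::] = 1.
Proof.
rewrite /magnus_series; elim: l => [//|[s b] l IH] /=.
by rewrite uvalM seriesM_nil IH mulr1; case: b.
Qed.

(** [l] represents a product of commutators whose Magnus expansion starts with
    [w] plus larger words of the same length, and which dies with any letter of
    [w]. *)
Record leads w l : Prop := Leads {
  leads_order : order_ge (size w) (magnus_series l - 1);
  leads_eq : magnus_series l w = 1;
  leads_lt : forall x, size x = size w -> (x < w)%O -> magnus_series l x = 0;
  leads_kill : forall (G : groupType) (phi : T -> G) s,
    s \in w -> phi s = 1%g -> evalg phi l = 1%g }.

Lemma leads_letter (a : T) : leads [:: a] [:: (a, true)].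
Proof.
have E x : magnus_series [:: (a, true)] x = (1 + letter a) x.
  by rewrite /magnus_series /= mulg1.
split.
- case=> // _; by rewrite seriesBE magnus_series_nil subrr.
- by rewrite E seriesDE series1E /letter eqxx add0r.
- case=> [//|b [|//]] _ ba; rewrite E seriesDE series1E /letter add0r.
  by rewrite (introF eqP) // => eb; rewrite eb ltxx in ba.
- by move=> G phi s; rewrite inE => /eqP -> /= ->; rewrite mulg1.
Qed.

(** With c and e the Magnus series minus 1, the commutator minus 1 is the
    product of a unit and of c * e - e * c, whose leading part is the Lie
    bracket; since [u ++ v < v ++ u], its smallest word comes from c * e. *)
Lemma leads_comml u v l l' : u != [::] -> v != [::] -> (u ++ v < v ++ u)%O ->
  leads u l -> leads v l' -> leads (u ++ v) (comml l l').
Proof.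
move=> u0 v0 uv [lo le ll lk] [lo' le' ll' lk'].
pose C := magnus_series l; pose D := magnus_series l'.
pose C' := uval (evalg (@magnus T) l)^-1%g.
pose D' := uval (evalg (@magnus T) l')^-1%g.
pose c := C - 1; pose e := D - 1.
have CDE : magnus_series (comml l l') - 1 = C' * D' * (c * e - e * c).
  rewrite /c /e commutator_sub1.
  rewrite /magnus_series evalg_comml !uvalM -/C -/D -/C' -/D'.
  rewrite mulrBr !mulrA; congr (_ - _).
  have CC : C' * C = 1 by apply: uinvK.
  have DD : D' * D = 1 by apply: uinvK.
  by rewrite -(mulrA C' D' D) DD mulr1 CC.
have co : order_ge (size u) c by [].
have eo : order_ge (size v) e by [].
have ceo : order_ge (size u + size v) (c * e - e * c).
  by apply: order_geB; [|rewrite addnC]; apply: order_geM.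
have CD0 : (C' * D') [::] = 1.
  rewrite seriesM_nil /C' /D' -!evalg_inv.
  by rewrite -!/(magnus_series _) !magnus_series_nil mulr1.
have lead x : size x = (size u + size v)%N -> magnus_series (comml l l') x =
    C (take (size u) x) * D (drop (size u) x) -
    D (take (size v) x) * C (drop (size v) x).
  move=> xuv; have x0 : x != [::].
    by case: (x) xuv u0 => //; case: (u).
  have one_nz (y : seq T) : y != [::] -> (1 : series T) y = 0 by case: y.
  have -> : magnus_series (comml l l') x = (magnus_series (comml l l') - 1) x.
    by rewrite seriesBE one_nz // subr0.
  rewrite CDE (seriesM_lead (@order_ge0 _ (C' * D')) ceo xuv) take0 drop0.
  rewrite CD0 mul1r seriesBE (seriesM_lead co eo xuv).
  rewrite (seriesM_lead eo co) 1?addnC //.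
  have nz n : (0 < n < size x)%N -> take n x != [::] /\ drop n x != [::].
    move=> /andP [n0 nx]; rewrite -!size_eq0 size_drop subn_eq0 -ltnNge nx.
    by rewrite size_takel ?(ltnW nx) // -lt0n.
  have su : (0 < size u)%N by case: (u) u0.
  have sv : (0 < size v)%N by case: (v) v0.
  have [|t1 d1] := nz (size u);
    first by rewrite xuv su -{1}[size u]addn0 ltn_add2l.
  have [|t2 d2] := nz (size v);
    first by rewrite xuv sv -{1}[size v]add0n ltn_add2r.
  by rewrite /c /e !seriesBE !one_nz // !subr0.
have swap x : size x = (size u + size v)%N -> (x <= u ++ v)%O ->
    D (take (size v) x) * C (drop (size v) x) = 0.
  move=> xuv xle; have := le_lt_trans xle uv.
  rewrite -{1}(cat_take_drop (size v) x) ltxi_cat; last first.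
    by rewrite size_takel // xuv leq_addl.
  case/orP => [lt|/andP [_ lt]].
    by rewrite /D ll' ?mul0r // size_takel // xuv leq_addl.
  by rewrite /C ll ?mulr0 // size_drop xuv addnK.
split.
- by rewrite CDE size_cat -[(_ + _)%N]add0n; apply: order_geM ceo.
- rewrite lead ?size_cat // swap ?size_cat // subr0.
  by rewrite take_size_cat // drop_size_cat // /C /D le le' mulr1.
- move=> x; rewrite size_cat => xuv xlt;
  rewrite lead // swap ?(ltW xlt) // subr0.
  move: xlt; rewrite -{1}(cat_take_drop (size u) x) ltxi_cat; last first.
    by rewrite size_takel // xuv leq_addr.
  case/orP => [lt|/andP [_ lt]].
    by rewrite /C ll ?mul0r // size_takel // xuv leq_addr.
  by rewrite /D ll' ?mulr0 // size_drop xuv addKn.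
move=> G phi s; rewrite mem_cat evalg_comml => /orP [su|sv] s1.
  by rewrite (lk _ _ _ su s1) invg1 mul1g mulg1 mulVg.
by rewrite (lk' _ _ _ sv s1) invg1 !mulg1 mulVg.
Qed.

Lemma lyndon_leads w : lyndon w -> exists l, leads w l.
Proof.
have [n] := ubnP (size w); elim: n w => [//|n IH] w wn lw.
have [w1|w1] := leqP (size w) 1.
  case: w lw w1 {wn} => [//|a [|//]] _ _.
  by exists [:: (a, true)]; apply: leads_letter.
have [u [v [wE lu lv]]] := lyndon_factor lw w1.
have [[u0 _] [v0 _]] := (lyndonP _ lu, lyndonP _ lv).
have su : (0 < size u)%N by case: (u) u0.
have sv : (0 < size v)%N by case: (v) v0.
move: wn; rewrite wE size_cat => wn.
have [l lu'] : exists l, leads u l by apply: IH => //; lia.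
have [l' lv'] : exists l, leads v l by apply: IH => //; lia.
exists (comml l l'); apply: leads_comml => //.
by apply: lyndon_lt_rot; rewrite // -wE.
Qed.

End Commutator.
(** * A basis of the reduced space *)

Section Triangular.
Variables (V : lmodType rat) (m : nat).

Definition scalar_map (f : V -> rat) : Prop :=
  forall a x y, f (a *: x + y) = a * f x + f y.

Lemma scalar_map0 f : scalar_map f -> f 0 = 0.
Proof.
by move=> fl; have := fl (-1) 0 0; rewrite scaler0 addr0 mulN1r addNr.
Qed.

Lemma scalar_map_sum f (J : Type) (r : seq J) (c : J -> rat) (x : J -> V) :
  scalar_map f -> f (\sum_(j <- r) c j *: x j) = \sum_(j <- r) c j * f (x j).
Proof.
move=> fl; elim: r => [|j r IH]; first by rewrite !big_nil scalar_map0.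
by rewrite !big_cons fl IH.
Qed.

Lemma scalar_map_spanned f (A : V -> Prop) x : scalar_map f ->
  (forall y, A y -> f y = 0) -> x \in spanned A -> f x = 0.
Proof.
move=> fl fA /asboolP [s As ->]; rewrite scalar_map_sum // big_seq big1 //.
by move=> p /As /fA ->; rewrite mulr0.
Qed.

Lemma has_dim_dual (e : 'I_m -> V) (phi : 'I_m -> V -> rat) :
  (forall i, scalar_map (phi i)) ->
  (forall x, exists c : 'I_m -> rat, x = \sum_j c j *: e j) ->
  \matrix_(i, j) phi i (e j) \in unitmx -> has_dim V m.
Proof.
move=> phil span Au; set A := \matrix_(i, j) _ in Au; constructor.
exists (fun x => \row_i phi i x) => [a x y|].
  by apply/rowP => i; rewrite !mxE phil.
exists (fun r : 'rV_m => \sum_j (r *m invmx A^T) 0 j *: e j) => [x|r].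
  have [c xE] := span x.
  have -> : \row_i phi i x = (\row_j c j) *m A^T.
    apply/rowP => i; rewrite !mxE {1}xE scalar_map_sum //.
    by apply: eq_bigr => j _; rewrite !mxE.
  by rewrite mulmxK ?unitmx_tr // xE; apply: eq_bigr => j _; rewrite mxE.
apply/rowP => i; rewrite !mxE scalar_map_sum //.
rewrite -[r in RHS](mulmxKV (_ : A^T \in unitmx)) ?unitmx_tr // mxE.
by apply: eq_bigr => j _; rewrite !mxE.
Qed.

End Triangular.

(** The words [w] need not be enumerated in order: a kernel vector vanishes at
    the smallest word of its support. *)
Lemma unitmx_triangular (d : Order.disp_t) (W : orderType d) m
    (w : 'I_m -> W) (A : 'M[rat]_m) : injective w ->
  (forall i, A i i = 1) -> (forall i j, (w j < w i)%O -> A i j = 0) ->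
  A \in unitmx.
Proof.
move=> winj A1 A0; rewrite -row_free_unit; apply: inj_row_free => r rA.
apply/eqP/negPn/negP => r0.
have [i ri] : exists i, r 0 i != 0.
  apply/existsP; apply: contraR r0; rewrite negb_exists => /forallP H.
  by apply/eqP/rowP => i; rewrite mxE; apply/eqP; move: (H i); rewrite negbK.
case: (@Order.TotalTheory.arg_minP _ _ _ i (fun i => r 0 i != 0) w ri) =>
  j rj jmin.
have := congr1 (fun B : 'rV_m => B 0 j) rA.
rewrite !mxE (bigD1 j) //= A1 mulr1 big1 ?addr0 => [rj0|i' ij].
  by rewrite rj0 eqxx in rj.
have [->|ri'] := eqVneq (r 0 i') 0; first by rewrite mul0r.
rewrite A0 ?mulr0 // lt_neqAle jmin // andbT.
by apply: contraNneq ij => /winj ->.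
Qed.

Section Lift.
Variables (V : lmodType rat) (S : submodClosed V) (f : V -> rat).
Hypothesis fl : scalar_map f.
Hypothesis fS : forall x, x \in S -> f x = 0.

Lemma scalar_map_repr x : f (repr (\pi_(lquot S) x)) = f x.
Proof.
have : repr (\pi_(lquot S) x) - x \in S by apply/lquotP; rewrite reprK.
move=> /fS; rewrite addrC -scaleN1r fl mulN1r addrC => /eqP.
by rewrite subr_eq0 => /eqP.
Qed.

Lemma scalar_map_lquot : scalar_map (fun z : lquot S => f (repr z)).
Proof.
move=> a; elim/quotW => x; elim/quotW => y.
by rewrite -(pi_lquot_linear S a x y) !scalar_map_repr fl.
Qed.

End Lift.

Section Basis.
Variables k n : nat.
Hypothesis k_gt0 : (0 < k)%N.
Hypothesis n_gt0 : (0 < n)%N.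

(** The letters are the first k - 1 strands: an invariant that misses one of
    them is induced. *)
Definition full_lyndon : {set n.-tuple 'I_k.-1} :=
  [set w : n.-tuple 'I_k.-1 | lyndon w && [forall t, t \in w]].

Definition fword (i : 'I_#|full_lyndon|) : n.-tuple 'I_k.-1 := enum_val i.

Lemma fword_lyndon i : lyndon (fword i).
Proof. by have := enum_valP i; rewrite inE => /andP []. Qed.

Lemma fword_full i t : t \in fword i.
Proof. by have := enum_valP i; rewrite inE => /andP [_ /forallP]. Qed.

Definition spanned_by_basis (x : reduced k n) : Prop :=
  exists c : 'I_#|full_lyndon| -> rat,
    x = \sum_j c j *: red_class (Vmilnor (fword j)).

Lemma spanned_by_basis0 : spanned_by_basis 0.
Proof. by exists (fun=> 0); rewrite big1 // => j _; rewrite scale0r. Qed.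

Lemma spanned_by_basisD a x y :
  spanned_by_basis x -> spanned_by_basis y -> spanned_by_basis (a *: x + y).
Proof.
move=> [c ->] [c' ->]; exists (fun j => a * c j + c' j).
rewrite scaler_sumr -big_split; apply: eq_bigr => j _ /=.
by rewrite scalerDl scalerA.
Qed.

Lemma spanned_by_basis_sum (J : Type) (r : seq J) (P : pred J) c x :
  (forall j, P j -> spanned_by_basis (x j)) ->
  spanned_by_basis (\sum_(j <- r | P j) c j *: x j).
Proof.
move=> H; elim/big_rec: _ => [|j y Pj Hy]; first exact: spanned_by_basis0.
by apply: spanned_by_basisD => //; apply: H.
Qed.

(** A word that is not a Lyndon word is replaced with smaller ones, by the
    relation of which it is the largest term. *)
Lemma milnor_spanned (w : n.-tuple 'I_k.-1) :
  spanned_by_basis (red_class (Vmilnor w)).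
Proof.
have [m] := ubnP #|[set x : n.-tuple 'I_k.-1 | (tval x < tval w)%O]|.
elim: m w => [//|m IH] w; rewrite ltnS => wm.
have [/forallP wfull|] := boolP [forall t, t \in w]; last first.
  rewrite negb_forall => /existsP [t tw].
  by rewrite (red_class_missing tw); apply: spanned_by_basis0.
have [lw|nl] := boolP (lyndon w).
  have wL : w \in full_lyndon by rewrite inE lw; apply/forallP.
  exists (fun j => (j == enum_rank_in wL w)%:R).
  rewrite (bigD1 (enum_rank_in wL w)) //= eqxx scale1r /fword enum_rankK_in //.
  by rewrite big1 ?addr0 // => j /negPf ->; rewrite scale0r.
have w0 : tval w != [::] by rewrite -size_eq0 size_tuple -lt0n.
have [u [v [wE u0 v0 wuv uvmax]]] := nonlyndon_shuffle w0 nl.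
have uvn : (size u + size v)%N = n by rewrite -size_cat -wE size_tuple.
have := red_class_shuffles k_gt0 uvn u0 v0; rewrite (bigD1 w) //=.
move=> /eqP; rewrite addr_eq0 => /eqP rel.
have c0 : (shuffles w u v)%:R != 0 :> rat by rewrite pnatr_eq0.
have -> : red_class (Vmilnor w) =
    - (shuffles w u v)%:R^-1 *: (\sum_(x | x != w)
       (shuffles x u v)%:R *: red_class (Vmilnor x)) + 0.
  by rewrite addr0 scaleNr -scalerN -rel scalerA mulVf // scale1r.
apply: spanned_by_basisD spanned_by_basis0.
rewrite (bigID (fun x : n.-tuple 'I_k.-1 =>
  shuffles x u v == 0%N)) /= big1 ?add0r.
  apply: spanned_by_basis_sum => x /andP [xw /uvmax xle].
  have xlt : (tval x < tval w)%O by rewrite lt_neqAle xle andbT.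
  apply: IH; apply: leq_trans wm; apply: proper_card.
  apply/properP; split.
    by apply/subsetP => y; rewrite !inE => /lt_trans; apply.
  by exists x; rewrite !inE ?ltxx.
by move=> x /andP [_ /eqP ->]; rewrite scale0r.
Qed.

Lemma reduced_spanned (z : reduced k n) : spanned_by_basis z.
Proof.
rewrite -[z]reprK -[repr z]reprK -[repr (repr z)]reprK.
rewrite -/(red_class (repr (repr (repr z)))) red_class_expand //.
by apply: spanned_by_basis_sum => w _; apply: milnor_spanned.
Qed.

Section Functional.
Variables (w : n.-tuple 'I_k.-1) (l : seq ('I_k.-1 * bool)).
Hypothesis wfull : forall t, t \in w.
Hypothesis wl : leads w l.

Let p : pure k := evalg (@gen k) l.

(** Modulo the n-th power of the augmentation ideal p is 1, and p dies when a
    strand is forgotten; so the probe kills the invariants of lower type, the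
    products and the induced invariants. *)
Definition probe (v : Vspace k n) : rat := val v p - val v 1%g.

Lemma probe_scalar : scalar_map probe.
Proof.
move=> a v v'; rewrite /probe.
have E q : val (a *: v + v') q = a * val v q + val v' q by rewrite linearP.
by rewrite !E mulrBr opprD addrACA.
Qed.

Lemma commutator_type m (v : invariant k) : v \in finite_type m -> (m < n)%N ->
  v p = v 1%g.
Proof.
move=> vm mn; rewrite -[p]mulg1 (taylor_evalg _ _ vm) /taylor big_ord_recl.
rewrite sum_tuple0 -/(magnus_series l) magnus_series_nil mul1r /=.
rewrite big1 ?addr0 // => i _; rewrite big1 // => x _.
have xS : size x = i.+1 by rewrite size_tuple.
have x1 : (1 : series 'I_k.-1) x = 0 by case: (tval x) xS.
have := leads_order wl (x := x); rewrite xS size_tuple seriesBE x1 subr0.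
rewrite /magnus_series => ->; first by rewrite mul0r.
by apply: leq_ltn_trans mn; apply: (ltn_ord i).
Qed.

Lemma probe_lower v : v \in @lower k n -> probe v = 0.
Proof.
rewrite /probe; case: (n) n_gt0 v (@commutator_type) => // n' _ v H vl.
by rewrite (H n' (val v)) ?subrr.
Qed.

Lemma probe_Vmul a b (e : (a + b)%N = n) (v : Vspace k a) (v' : Vspace k b) :
  (0 < a)%N -> (0 < b)%N -> probe (Vmul e v v') = 0.
Proof.
move=> a0 b0; rewrite /probe.
have E q : val (Vmul e v v') q = val v q * val v' q by [].
rewrite !E.
rewrite (commutator_type (valP v)) 1?(commutator_type (valP v')) ?subrr //.
  by rewrite -e -{1}[b]add0n ltn_add2r.
by rewrite -e -{1}[a]addn0 ltn_add2l.
Qed.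

Lemma probe_Vpull (S : {set 'I_k}) (v : Vspace #|S| n) : (#|S| < k)%N ->
  probe (Vpull v) = 0.
Proof.
have E q : val (Vpull v) q = val v (forget S q) by [].
move=> Sk; rewrite /probe !E forget1 /p forget_evalg.
have kk : (k.-1 < k)%N by lia.
have [x xS] : exists x, x \notin S.
  apply/existsP; rewrite -negb_forall; apply: contraTN Sk => /forallP H.
  by rewrite -leqNgt -{1}(card_ord k); apply/subset_leq_card/subsetP => x _.
have [s sw fs] : exists2 s, s \in w & forget S (gen s) = 1%g.
  have [xlast|xk] := eqVneq (x : nat) k.-1.
    have [s sw] : exists s, s \in tval w.
      have : size w != 0%N by rewrite size_tuple -lt0n.
      by case: (tval w) => [//|s w'] _; exists s; apply: mem_head.
    by exists s => //; apply: (forget_gen_out xlast); rewrite (negPf xS) andbF.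
  have xs : (x < k.-1)%N by have := ltn_ord x; lia.
  exists (Ordinal xs) => //; apply: (@forget_gen_out _ _ (Ordinal kk)) => //.
  rewrite (_ : lpos _ = x) ?(negPf xS) //; exact: val_inj.
by rewrite (leads_kill wl (phi := forget S \o @gen k) sw fs) subrr.
Qed.

Definition reduced_probe (z : reduced k n) : rat :=
  probe (repr (repr (repr z))).

Lemma gr_probe_mul x : x \in @decomposable k n -> probe (repr x) = 0.
Proof.
have gl := scalar_map_lquot probe_scalar probe_lower.
apply: (scalar_map_spanned gl) => _ [a [b [e [y [z [a0 b0 ->]]]]]].
elim/quotW: y => y; elim/quotW: z => z; rewrite gr_mul_pi.
by rewrite (scalar_map_repr probe_scalar probe_lower) probe_Vmul.
Qed.

Lemma indec_probe_pull x : x \in @induced k n -> probe (repr (repr x)) = 0.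
Proof.
have gl := scalar_map_lquot probe_scalar probe_lower.
have il := scalar_map_lquot gl gr_probe_mul.
apply: (scalar_map_spanned il) => _ [S [y [Sk ->]]].
elim/quotW: y => y; elim/quotW: y => y; rewrite indec_pull_pi gr_pull_pi.
rewrite (scalar_map_repr gl gr_probe_mul).
by rewrite (scalar_map_repr probe_scalar probe_lower) probe_Vpull.
Qed.

Lemma reduced_probe_scalar : scalar_map reduced_probe.
Proof.
have gl := scalar_map_lquot probe_scalar probe_lower.
exact: scalar_map_lquot (scalar_map_lquot gl gr_probe_mul) indec_probe_pull.
Qed.

Lemma reduced_probe_milnor (x : n.-tuple 'I_k.-1) :
  reduced_probe (red_class (Vmilnor x)) = magnus_series l x.
Proof.
have gl := scalar_map_lquot probe_scalar probe_lower.
have il := scalar_map_lquot gl gr_probe_mul.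
rewrite /reduced_probe (scalar_map_repr il indec_probe_pull).
rewrite (scalar_map_repr gl gr_probe_mul).
rewrite (scalar_map_repr probe_scalar probe_lower).
have long1 : longitude (1%g : pure k) = 1%g.
  have := longitude_evalg [::] (1%g : pure k); rewrite /= mul1g => H.
  have <- : pure_class [::] = 1%g :> pure k.
    by apply: val_inj; rewrite val_pure_class.
  exact: longitude_avoids_last.
rewrite -[probe _]/(milnor x p - milnor x 1%g) /milnor long1.
rewrite -[p]mulg1 longitude_evalg long1 mulg1 uval1 series1E.
rewrite (_ : nilp x = false) ?subr0 //.
by rewrite /nilp size_tuple gtn_eqF.
Qed.

End Functional.

Lemma reduced_dim : has_dim (reduced k n) #|full_lyndon|.
Proof.
have /boolp.choice [l wl] : forall i, exists l, leads (fword i) l.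
  by move=> i; apply/lyndon_leads/fword_lyndon.
apply: (@has_dim_dual _ _ (fun j => red_class (Vmilnor (fword j)))
  (fun i => reduced_probe (l i))).
- by move=> i; apply: reduced_probe_scalar (wl i); apply: fword_full.
- exact: reduced_spanned.
apply: (@unitmx_triangular _ _ _ (fun i => tval (fword i))).
- by move=> i j /val_inj /enum_val_inj.
- move=> i; rewrite mxE (reduced_probe_milnor (@fword_full i) (wl i)).
  exact: leads_eq (wl i).
move=> i j ji; rewrite mxE (reduced_probe_milnor (@fword_full i) (wl i)).
by apply: (leads_lt (wl i)) => //; rewrite !size_tuple.
Qed.

End Basis.
(** * Moebius inversion *)

Section Mobius.

Lemma mobiusE n : mobius n =
  if all (fun p => logn p n == 1%N) (primes n) then (-1) ^+ size (primes n)
    else 0.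
Proof. by []. Qed.

Lemma mobius_square p e :
  prime p -> (0 < e)%N -> (p %| e)%N -> mobius (p * e) = 0.
Proof.
move=> pp e0 pe; rewrite mobiusE ifF //; apply/negbTE/allPn; exists p.
  by rewrite mem_primes pp muln_gt0 prime_gt0 // e0 dvdn_mulr.
rewrite lognM ?(prime_gt0 pp) // logn_prime // eqxx.
by have := pfactor_dvdn 1 pp e0; rewrite expn1 pe; lia.
Qed.

Lemma mobius_prime_mul p e : prime p -> (0 < e)%N -> ~~ (p %| e)%N ->
  mobius (p * e) = - mobius e.
Proof.
move=> pp e0 pe; have p0 := prime_gt0 pp.
have perm : perm_eq (primes (p * e)) (p :: primes e).
  apply: uniq_perm; rewrite ?primes_uniq //= ?primes_uniq ?andbT.
    by rewrite mem_primes pp e0.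
  by move=> q; rewrite primesM // inE primes_prime // inE.
rewrite !mobiusE (perm_size perm) (perm_all _ perm) /= lognM // logn_prime //.
have -> : logn p e = 0%N.
  by apply/eqP; have := pfactor_dvdn 1 pp e0; rewrite expn1 (negPf pe); lia.
rewrite eqxx /=.
have -> : all (fun q => logn q (p * e) == 1%N) (primes e) =
          all (fun q => logn q e == 1%N) (primes e).
  apply: eq_in_all => q; rewrite mem_primes => /and3P [qp _ qe].
  rewrite lognM // logn_prime // (_ : (q == p) = false) //.
  by apply: contraNF pe => /eqP <-.
by case: ifP => _; rewrite ?oppr0 // exprS mulN1r.
Qed.

(** For a prime factor p of n, the divisors e that are prime to p cancel with
    the p * e, and p * e contributes 0 if p divides e. *)
Lemma sum_mobius n :
  (0 < n)%N -> \sum_(e <- divisors n) mobius e = (n == 1%N)%:R.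
Proof.
move=> n0; have [->|n1] := eqVneq n 1%N.
  by rewrite big_cons big_nil mobiusE /= addr0.
have n1' : (1 < n)%N by rewrite ltn_neqAle eq_sym n1.
have pp := pdiv_prime n1'; have pn := pdiv_dvd n; set p := pdiv n in pp pn.
have p0 := prime_gt0 pp.
have np0 : (0 < n %/ p)%N by rewrite divn_gt0 // dvdn_leq.
rewrite (bigID (fun e => (p %| e)%N)) /=.
have -> : \sum_(e <- divisors n | (p %| e)%N) mobius e =
    \sum_(e <- divisors (n %/ p)) mobius (p * e)%N.
  rewrite -big_filter -(big_map (fun e => p * e)%N xpredT mobius).
  apply: perm_big; apply: uniq_perm.
  - by rewrite filter_uniq // divisors_uniq.
  - by rewrite map_inj_uniq ?divisors_uniq // => x y /eqP;
      rewrite eqn_pmul2l // => /eqP.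
  move=> e; rewrite mem_filter -dvdn_divisors //; apply/andP/mapP.
    move=> [pe en]; exists (e %/ p)%N; last by rewrite mulnC divnK.
    by rewrite -dvdn_divisors // dvdn_divRL // divnK.
  move=> [c]; rewrite -dvdn_divisors // => cn ->; rewrite dvdn_mulr //.
  by split=> //; rewrite mulnC -dvdn_divRL.
rewrite (bigID (fun e => (p %| e)%N)) /= big1_seq ?add0r; last first.
  move=> e /andP [pe]; rewrite -dvdn_divisors // => en.
  by apply: mobius_square => //; apply: dvdn_gt0 en.
have -> : \sum_(e <- divisors (n %/ p) | ~~ (p %| e)%N) mobius (p * e)%N =
    - \sum_(e <- divisors n | ~~ (p %| e)%N) mobius e.
  rewrite -sumrN -[LHS]big_filter -[RHS]big_filter.
  rewrite (perm_big [seq e <- divisors n | ~~ (p %| e)%N]) /=.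
    apply: eq_big_seq => e; rewrite mem_filter -dvdn_divisors // =>
      /andP [pe en].
    by apply: mobius_prime_mul => //; apply: dvdn_gt0 en.
  apply: uniq_perm; rewrite ?filter_uniq ?divisors_uniq // => e.
  rewrite !mem_filter -!dvdn_divisors //; case: (boolP (p %| e)%N) => //= pe.
  apply/idP/idP => [en|en]; first exact: dvdn_trans en (dvdn_div pn).
  by move: en; rewrite -{1}(divnK pn) Gauss_dvdl // coprime_sym prime_coprime.
by rewrite addNr.
Qed.

Lemma divn_codivisor n d : (0 < n)%N -> (d %| n)%N -> (n %/ (n %/ d))%N = d.
Proof.
move=> n0 dn; have d0 := dvdn_gt0 n0 dn.
have nd0 : (0 < n %/ d)%N by rewrite divn_gt0 // dvdn_leq.
by rewrite -{1}(divnK dn) mulKn.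
Qed.

Lemma mobius_inversion (f g : nat -> rat) n : (0 < n)%N ->
  (forall m, (0 < m)%N -> f m = \sum_(d <- divisors m) g d) ->
  g n = \sum_(m <- divisors n) (mobius (n %/ m))%:~R * f m.
Proof.
move=> n0 fE.
have -> : \sum_(m <- divisors n) (mobius (n %/ m))%:~R * f m =
    \sum_(m <- divisors n) \sum_(d <- divisors n | (d %| m)%N)
      (mobius (n %/ m))%:~R * g d.
  apply: eq_big_seq => m; rewrite -dvdn_divisors // => mn.
  have m0 := dvdn_gt0 n0 mn; rewrite fE // mulr_sumr -[RHS]big_filter.
  apply: perm_big; apply: uniq_perm; rewrite ?filter_uniq ?divisors_uniq //.
  move=> d; rewrite mem_filter -!dvdn_divisors //.
  by case: (boolP (d %| m)%N) => //= dm; rewrite (dvdn_trans dm mn).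
rewrite (exchange_big_dep xpredT) //=.
have inner d : (d %| n)%N ->
    \sum_(m <- divisors n | (d %| m)%N) (mobius (n %/ m))%:~R * g d =
    (d == n)%:R * g d.
  move=> dn; have d0 := dvdn_gt0 n0 dn.
  have nd0 : (0 < n %/ d)%N by rewrite divn_gt0 // dvdn_leq.
  rewrite -mulr_suml; congr (_ * _).
  have -> : (d == n)%:R = (n %/ d == 1)%N%:R%:~R :> rat.
    have -> : (d == n) = (n %/ d == 1)%N by rewrite [RHS]eq_sym eqn_div //
      mul1n.
    by case: eqP.
  rewrite -sum_mobius // rmorph_sum /=.
  rewrite -big_filter -(big_map (fun m => n %/ m)%N xpredT
    (fun e => (mobius e)%:~R : rat)).
  apply: perm_big; apply: uniq_perm; rewrite ?divisors_uniq //.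
    rewrite map_inj_in_uniq ?filter_uniq ?divisors_uniq // => x y.
    rewrite !mem_filter -!dvdn_divisors // => /andP [_ xn] /andP [_ yn] xy.
    by rewrite -[x](divn_codivisor n0) // xy divn_codivisor.
  move=> e; rewrite -dvdn_divisors //; apply/mapP/idP.
    move=> [m]; rewrite mem_filter -dvdn_divisors // => /andP [dm mn] ->.
    have m0 := dvdn_gt0 n0 mn.
    have nm0 : (0 < n %/ m)%N by rewrite divn_gt0 // dvdn_leq.
    by rewrite dvdn_divRL // -{2}(divnK mn) dvdn_pmul2l.
  move=> end_; have en : (e %| n)%N.
    by apply: dvdn_trans end_ _; apply: dvdn_div.
  exists (n %/ e)%N; last by rewrite divn_codivisor.
  rewrite mem_filter -dvdn_divisors // dvdn_div // andbT.
  by rewrite dvdn_divRL // mulnC -dvdn_divRL.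
transitivity (\sum_(d <- divisors n) (d == n)%:R * g d); last first.
  apply: eq_big_seq => d; rewrite -dvdn_divisors // => dn.
  by rewrite inner.
rewrite (bigD1_seq n) ?divisors_uniq -?dvdn_divisors //= eqxx mul1r.
by rewrite big1 ?addr0 // => d /negPf ->; rewrite mul0r.
Qed.

End Mobius.
(** * Rotations and powers of words *)

Section Rotations.
Variables (d : Order.disp_t) (T : orderType d).
Implicit Types (u v w x : seq T).

(** If a suffix v of w = uv were smaller than w, it would be a prefix of w, and
    one of the rotations of w by u and by v would be at most w. *)
Lemma lyndon_rotP w : w != [::] -> reflect
  (forall i, (0 < i < size w)%N -> (w < rot i w)%O) (lyndon w).
Proof.
move=> w0; apply: (iffP idP) => [lw i /andP [i0 iw]|H].
  rewrite /rot -{1}(cat_take_drop i w); apply: lyndon_lt_rot.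
  - by rewrite -size_eq0 size_takel ?(ltnW iw) // -lt0n.
  - by rewrite -size_eq0 size_drop subn_eq0 -ltnNge.
  - by rewrite cat_take_drop.
apply/lyndonP; split=> // u v wE u0 v0.
have su : (0 < size u < size w)%N.
  by rewrite wE size_cat -{2}[size u]addn0 ltn_add2l;
    case: (u) (v) u0 v0 => [|? ?] [].
have := H _ su; rewrite wE rot_size_cat => uv.
rewrite ltNge; apply/negP => vu.
have [[s sE]|/(_ u [::])] := lexi_split vu; last first.
  by rewrite cats0 ltNge (ltW uv).
have ss : size s = size u.
  by have /eqP := congr1 size sE; rewrite !size_cat addnC eqn_add2l => /eqP.
have sv : (0 < size v < size w)%N.
  by rewrite wE size_cat -{2}[size v]add0n ltn_add2r;
    case: (u) (v) u0 v0 => [|? ?] [].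
have := H _ sv; rewrite wE {2}sE rot_size_cat ltxi_cat ?ss // ltxx andbF orbF.
by move: uv; rewrite sE ltxi_cat2l => su' /lt_trans /(_ su'); rewrite ltxx.
Qed.

Definition primitive w : bool :=
  all (fun i => rot i w != w) (iota 1 (size w).-1).

Lemma primitiveP w : reflect
  (forall i, (0 < i < size w)%N -> rot i w != w) (primitive w).
Proof.
apply: (iffP allP) => H i iw; apply: H; move: iw; rewrite mem_iota;
  by case: (size w) => [|s] /=; lia.
Qed.

Lemma lyndon_primitive w : lyndon w -> primitive w.
Proof.
move=> lw; have [w0 _] := lyndonP _ lw.
apply/primitiveP => i iw; have := (lyndon_rotP w0 lw) i iw.
by rewrite lt_neqAle eq_sym => /andP [].
Qed.

Lemma rot_rot_lt w i j : (i < j < size w)%N -> rot (j - i) (rot i w) = rot j w.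
Proof. by case/andP => ij jw; rewrite -rotD ?subnK // ltnW. Qed.

Lemma rot_rot_gt w i j : (i < j < size w)%N ->
  rot (size w - (j - i)) (rot j w) = rot i w.
Proof.
move=> ijw; have [ij jw] := andP ijw.
rewrite -(rot_rot_lt ijw) -[in LHS](size_rot i w).
have -> : rot (size (rot i w) - (j - i)) (rot (j - i) (rot i w)) =
    rotr (j - i) (rot (j - i) (rot i w)) by rewrite /rotr !size_rot.
by rewrite rotK.
Qed.

Lemma lyndon_rot_uniq w i j : (i < size w)%N -> (j < size w)%N ->
  lyndon (rot i w) -> lyndon (rot j w) -> i = j.
Proof.
wlog ij : i j / (i <= j)%N => [H iw jw li lj|iw jw li lj].
  by case/orP: (leq_total i j) => ?; [apply: H|apply/esym/H].
move: ij; rewrite leq_eqVlt => /orP [/eqP //|ij].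
have ijw : (i < j < size w)%N by rewrite ij.
have [[i0 _] [j0 _]] := (lyndonP _ li, lyndonP _ lj).
have lt1 : (rot i w < rot j w)%O.
  by rewrite -(rot_rot_lt ijw); apply: (lyndon_rotP i0 li); rewrite size_rot;
    lia.
have : (rot j w < rot i w)%O.
  by rewrite -(rot_rot_gt ijw); apply: (lyndon_rotP j0 lj); rewrite size_rot;
    lia.
by move/(lt_trans lt1); rewrite ltxx.
Qed.

Lemma primitive_rot w i : primitive (rot i w) = primitive w.
Proof.
rewrite /primitive size_rot; apply: eq_all => j.
by rewrite rot_rot (inj_eq (@rot_inj _ _)).
Qed.

Lemma primitive_lyndon_rot w : w != [::] -> primitive w ->
  exists2 i, (i < size w)%N & lyndon (rot i w).
Proof.
move=> w0 pw; have sw : (0 < size w)%N by rewrite lt0n size_eq0.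
case: (@Order.TotalTheory.arg_minP _ _ _ (Ordinal sw) xpredT
  (fun i : 'I_(size w) => rot i w) isT) => i _ imin.
exists i => //; have ri0 : rot i w != [::] by rewrite -size_eq0 size_rot -lt0n.
apply/(lyndon_rotP ri0) => j; rewrite size_rot => jw.
have [m mw e] : exists2 m, (m < size w)%N & rot j (rot i w) = rot m w.
  have [_ jw'] := andP jw.
  exists (if j + i < size w then j + i else j + i - size w)%N.
    by case: ifP => //; have := ltn_ord i; lia.
  rewrite rot_add_mod ?(ltnW jw') ?(ltnW (ltn_ord i)) //.
  by case: ltngtP => // ->; rewrite subnn rot0 rot_size.
rewrite lt_neqAle {2}e (imin (Ordinal mw)) // andbT eq_sym.
by move: pw; rewrite -(primitive_rot _ i) => /primitiveP; apply;
  rewrite size_rot.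
Qed.

End Rotations.
Section Repetition.
Variable T : eqType.
Implicit Types (w x : seq T).

Definition rep q x : seq T := flatten (nseq q x).

Lemma size_rep q x : size (rep q x) = (q * size x)%N.
Proof. by rewrite /rep size_flatten /shape map_nseq sumn_nseq mulnC. Qed.

Lemma mem_rep q x a : (0 < q)%N -> (a \in rep q x) = (a \in x).
Proof.
case: q => // q _; elim: q => [|q IH]; first by rewrite /rep /= cats0.
by rewrite /rep /= mem_cat -/(rep q.+1 x) IH orbb.
Qed.

Lemma take_rep q x : (0 < q)%N -> take (size x) (rep q x) = x.
Proof. by case: q => // q _; rewrite /rep /= take_size_cat. Qed.

Lemma rot_rep q x i : (i <= size x)%N -> rot i (rep q x) = rep q (rot i x).
Proof.
move=> ix; case: q => [//|q].
have shift m u v : v ++ rep m (u ++ v) = rep m (v ++ u) ++ v.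
  elim: m => [|m IH]; first by rewrite /rep /= cats0.
  by rewrite /rep /= -!/(rep _ _) -catA IH !catA.
have E u v : rot (size u) (rep q.+1 (u ++ v)) = rep q.+1 (v ++ u).
  rewrite {1}/rep /= -catA rot_size_cat -/(rep q _) shift -catA.
  by rewrite /rep -[q.+1]addn1 nseqD flatten_cat /= cats0.
by rewrite -{1}(cat_take_drop i x) -{1}(size_takel ix) E.
Qed.

(** A word that is invariant under a rotation by n starts twice with its first n
    letters, unless it is short. *)
Lemma rep_period q w n : size w = (q * n)%N -> rot n w = w ->
  w = rep q (take n w).
Proof.
elim: q w => [|q IH] w; first by move/size0nil => ->.
rewrite mulSn => sw rw; have [q0|q0] := posnP q.
  by rewrite q0 /rep /= cats0 take_oversize // sw q0 addn0.
have nw : (n <= size w)%N by rewrite sw leq_addr.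
set x := take n w; set w' := drop n w.
have sx : size x = n by rewrite size_takel.
have wE : w = x ++ w' by rewrite cat_take_drop.
have sw' : size w' = (q * n)%N by rewrite size_drop sw addKn.
have nw' : (n <= size w')%N by rewrite sw' leq_pmull.
have e : w' ++ x = x ++ w' by rewrite -[RHS]wE -[RHS]rw /rot.
have xE : take n w' = x.
  by have := congr1 (take n) e; rewrite takel_cat // take_size_cat.
rewrite wE /rep /=; congr (_ ++ _); rewrite -/(rep q x) -xE.
apply: IH => //; have dE : drop n (w' ++ x) = drop n w' ++ x.
  rewrite drop_cat; move: nw'; rewrite leq_eqVlt => /orP [/eqP nE|->] //.
  by rewrite -nE ltnn subnn drop0 nE drop_size.
by rewrite /rot xE -dE e drop_size_cat.
Qed.

Definition is_period n w : bool :=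
  [&& (0 < n)%N, rot n w == w & all (fun i => rot i w != w) (iota 1 n.-1)].

Lemma is_periodP n w : reflect
  [/\ (0 < n)%N, rot n w = w & forall i, (0 < i < n)%N -> rot i w != w]
  (is_period n w).
Proof.
apply: (iffP and3P) => -[n0 rn H]; split=> //.
- exact/eqP.
- move=> i iw; apply: (allP H); rewrite mem_iota; lia.
- exact/eqP.
by apply/allP => i; rewrite mem_iota => iw; apply: H; lia.
Qed.

Lemma is_period_uniq n m w : is_period n w -> is_period m w -> n = m.
Proof.
move=> /is_periodP [n0 rn Hn] /is_periodP [m0 rm Hm].
case: (ltngtP n m) => // lt.
  by have := Hm n; rewrite n0 lt rn eqxx => /(_ isT).
by have := Hn m; rewrite m0 lt rm eqxx => /(_ isT).
Qed.

(** The remainder of the length modulo the smallest period is a period. *)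
Lemma period_exists w : w != [::] -> exists2 n, is_period n w & (n %| size w)%N.
Proof.
move=> w0; have sw : (0 < size w)%N by rewrite lt0n size_eq0.
have ex : exists n, (0 < n)%N && (rot n w == w).
  by exists (size w); rewrite sw rot_size eqxx.
case: (ex_minnP ex) => n /andP [n0 /eqP rn] nmin; exists n.
  apply/is_periodP; split=> // i /andP [i0 ilt]; apply/negP => ri.
  by have := nmin i; rewrite i0 ri leqNgt ilt => /(_ isT).
have rotM q : (q * n <= size w)%N -> rot (q * n) w = w.
  elim: q => [|q IH]; first by rewrite mul0n rot0.
  rewrite mulSn => le; rewrite rotD // IH //.
  exact: leq_trans (leq_addl _ _) le.
rewrite /dvdn; apply/negPn/negP => r0.
have r := nmin (size w %% n)%N; move: r; rewrite lt0n r0 /=.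
have /eqP -> : rot (size w %% n) w == w.
  have := rot_size w; rewrite {1}(divn_eq (size w) n) addnC rotD.
    by rewrite rotM ?leq_divM // => ->.
  by rewrite addnC -divn_eq.
by rewrite eqxx leqNgt ltn_pmod // => /(_ isT).
Qed.

End Repetition.

Lemma is_period_rep (d : Order.disp_t) (T : orderType d) q (x : seq T) :
  (0 < q)%N -> x != [::] -> is_period (size x) (rep q x) = primitive x.
Proof.
move=> q0 x0; have sx : (0 < size x)%N by rewrite lt0n size_eq0.
have E i : (i <= size x)%N -> (rot i (rep q x) == rep q x) = (rot i x == x).
  move=> ix; rewrite rot_rep //;
    apply/eqP/eqP => [/(congr1 (take (size x)))|-> //].
  by rewrite -{1}(size_rot i x) !take_rep.
apply/is_periodP/primitiveP => [[_ _ H] i iw|H].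
  by rewrite -E ?H //; case/andP: iw => _ /ltnW.
split=> //; first by apply/eqP; rewrite E // rot_size.
by move=> i iw; rewrite E ?H //; case/andP: iw => _ /ltnW.
Qed.

(** * The number of Lyndon words *)

Section Count.
Variable j : nat.

Definition full_words n : {set n.-tuple 'I_j} :=
  [set w : n.-tuple 'I_j | [forall t, t \in w]].
Definition primitive_words n : {set n.-tuple 'I_j} :=
  [set w in full_words n | primitive w].
Definition lyndon_words n : {set n.-tuple 'I_j} :=
  [set w in full_words n | lyndon w].

Lemma card_full_words n : #|full_words n| = sur n j.
Proof.
pose f (w : n.-tuple 'I_j) : {ffun 'I_n -> 'I_j} := [ffun i => tnth w i].
have finj : injective f.
  by move=> w w' /ffunP e; apply: eq_from_tnth => i; have := e i;
    rewrite !ffunE.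
rewrite /sur -(card_imset _ finj); congr #|pred_of_set _|; apply/setP => g.
rewrite inE; apply/imsetP/idP => [[w + ->]|/forallP sg].
  rewrite inE => /forallP wf; apply/forallP => t.
  by have /tnthP [i ti] := wf t; apply/existsP; exists i; rewrite ffunE ti.
exists [tuple g i | i < n]; last by apply/ffunP => i;
  rewrite ffunE tnth_mktuple.
rewrite inE; apply/forallP => t; have /existsP [i /eqP <-] := sg t.
by apply/tnthP; exists i; rewrite tnth_mktuple.
Qed.

(** Each primitive word has exactly one rotation that is a Lyndon word. *)
Lemma card_primitive_words n : (0 < n)%N ->
  #|primitive_words n| = (n * #|lyndon_words n|)%N.
Proof.
move=> n0; have nz (w : n.-tuple 'I_j) : tval w != [::].
  by rewrite -size_eq0 size_tuple -lt0n.
transitivity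
  (\sum_(w in primitive_words n) \sum_(i < n) (lyndon (rot i w) : nat))%N.
  rewrite -sum1_card; apply: eq_bigr => w; rewrite inE => /andP [_ pw].
  have [i iw li] := primitive_lyndon_rot (nz w) pw.
  have iw' := iw; rewrite size_tuple in iw'.
  rewrite (bigD1 (Ordinal iw')) //= li big1 ?addn0 // => i' ii'.
  apply/eqP; rewrite eqb0; apply: contraNN ii' => li'.
  by apply/eqP/val_inj; apply: lyndon_rot_uniq li' li; rewrite ?size_tuple.
rewrite exchange_big /= -[X in (X * _)%N]card_ord -sum_nat_const.
apply: eq_bigr => i _.
pose r (w : n.-tuple 'I_j) := [tuple of rot i w].
have rinj : injective r.
  by move=> w w' /(congr1 val) /rot_inj /val_inj.
rewrite -(card_preimset _ rinj) -sum1_card big_mkcond [RHS]big_mkcond.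
apply: eq_bigr => w _; rewrite !inE.
rewrite (_ : [forall t, t \in r w] = [forall t, t \in w]); last first.
  by apply: eq_forallb => t; rewrite mem_rot.
case: (boolP [forall t, t \in w]) => //= _.
rewrite -(primitive_rot w i); case lw: (lyndon (rot i w)); last by case: ifP.
by rewrite (lyndon_primitive lw).
Qed.

(** The words of period m are the powers of the primitive words of length m. *)
Lemma card_period n m : (0 < n)%N -> (m %| n)%N ->
  #|[set w in full_words n | is_period m (tval w)]| = #|primitive_words m|.
Proof.
move=> n0 mn; have m0 := dvdn_gt0 n0 mn.
have q0 : (0 < n %/ m)%N by rewrite divn_gt0 // dvdn_leq.
have size_f (x : m.-tuple 'I_j) : size (rep (n %/ m) x) == n.
  by rewrite size_rep size_tuple divnK.
pose f x : n.-tuple 'I_j := Tuple (size_f x).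
have nz (x : m.-tuple 'I_j) : tval x != [::].
  by rewrite -size_eq0 size_tuple -lt0n.
have perE (x : m.-tuple 'I_j) : is_period m (rep (n %/ m) x) = primitive x.
  by have := is_period_rep q0 (nz x); rewrite size_tuple.
have finj : injective f.
  have takeE (x : m.-tuple 'I_j) : take m (rep (n %/ m) x) = x.
    by have := take_rep x q0; rewrite size_tuple.
  by move=> x y /(congr1 (fun w => take m (tval w))) /=;
    rewrite !takeE => /val_inj.
rewrite -(card_imset _ finj); congr #|pred_of_set _|; apply/setP => w.
rewrite !inE; apply/andP/imsetP => [[/forallP wf wp]|[x]]; last first.
  rewrite !inE => /andP [/forallP xf xp] ->; rewrite /= perE xp; split=> //.
  by apply/forallP => t; rewrite -[t \in _]/(t \in rep _ _) mem_rep.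
have /is_periodP [_ rw _] := wp.
have sw : size (take m w) == m.
  by rewrite size_takel // size_tuple dvdn_leq.
have wE : tval w = rep (n %/ m) (take m w).
  by apply: rep_period => //; rewrite size_tuple divnK.
exists (Tuple sw); last exact: val_inj.
rewrite !inE -perE /= -wE wp andbT; apply/forallP => t.
by have := wf t; rewrite -[t \in w]/(t \in tval w) {1}wE mem_rep.
Qed.

Lemma sum_primitive_words n : (0 < n)%N ->
  #|full_words n| = (\sum_(m <- divisors n) #|primitive_words m|)%N.
Proof.
move=> n0.
transitivity (\sum_(w in full_words n) \sum_(m <- divisors n)
    (is_period m (tval w) : nat))%N.
  rewrite -sum1_card; apply: eq_bigr => w _.
  have w0 : tval w != [::] by rewrite -size_eq0 size_tuple -lt0n.
  have [m wm] := period_exists w0; rewrite size_tuple => mn.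
  rewrite (bigD1_seq m) ?divisors_uniq -?dvdn_divisors //= wm big1 ?addn0 //.
  move=> m' mm'; apply/eqP; rewrite eqb0; apply: contraNN mm' => wm'.
  by apply/eqP; apply: is_period_uniq wm' wm.
rewrite exchange_big /=; apply: eq_big_seq => m;
  rewrite -dvdn_divisors // => mn.
rewrite -(card_period n0 mn) -sum1_card big_mkcond [RHS]big_mkcond.
apply: eq_bigr => w _; rewrite [in RHS]inE.
by case: (w \in _) => //=; case: is_period.
Qed.

Lemma card_lyndon_words n : (0 < n)%N ->
  n%:R * #|lyndon_words n|%:R =
  \sum_(m <- divisors n) (mobius (n %/ m))%:~R * (sur m j)%:R :> rat.
Proof.
move=> n0; rewrite -natrM -card_primitive_words //.
have H := @mobius_inversion (fun m => (sur m j)%:R)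
  (fun m => #|primitive_words m|%:R) n n0.
rewrite H => // m m0.
by rewrite -card_full_words sum_primitive_words // natr_sum.
Qed.

End Count.

Theorem theorem9 (k n : nat) (hk : (1 <= k)%N) (hn : (1 <= n)%N) :
  exists psi : nat, has_dim (reduced k n) psi /\
    psi%:R = n%:R^-1 * \sum_(m <- divisors n)
                         (mobius (n %/ m))%:~R * (sur m (k - 1))%:R :> rat.
Proof.
exists #|full_lyndon k n|; split; first exact: reduced_dim.
rewrite subn1 -card_lyndon_words // mulrA mulVf ?mul1r ?pnatr_eq0 -?lt0n //.
congr _%:R; apply: eq_card => w; rewrite !inE; exact: andbC.
Qed.
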